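(* Let $h>0$, let $\Omega\subseteq\mathbb R^3$ be a helical domain with cross-section $D=\{(x_1,x_2)\in\mathbb R^2 : (x_1,x_2,0)\in\Omega\}$, where $D$ is a simply connected bounded domain with smooth boundary. (i) Let $(\mathbf v,P)$ be a helical solution pair of the Euler equations $$\partial_t\mathbf v+(\mathbf v\cdot\nabla)\mathbf v=-\nabla P,\quad \nabla\cdot\mathbf v=0\ \text{ in }\Omega\times(0,T),\qquad \mathbf v\cdot\mathbf n=0\ \text{ on }\partial\Omega\times(0,T),$$ with initial velocity $\mathbf v(\cdot,0)=\mathbf v_0$, and let $\mathbf w=(w_1,w_2,w_3)^t=\nabla\times\mathbf v$. Let $v_{\vec\xi}=\mathbf v\cdot\vec\xi$ be the helical swirl. For $(x_1,x_2)\in D$ set $v(x_1,x_2,t)=v_{\vec\xi}(x_1,x_2,0,t)$ and $w(x_1,x_2,t)=w_3(x_1,x_2,0,t)$. Then $(v,w)$ solves, with a stream function $\varphi:D\times(0,T)\to\mathbb R$, the system $$\begin{cases} \partial_t v+\nabla^\perp\varphi\cdot\nabla v=0 & \text{in } D\times(0,T),\\[2pt] \partial_t w+\nabla^\perp\varphi\cdot\nabla w=\partial_{x_1}v\,\partial_{x_2}\!\left(\dfrac{x_1\partial_{x_1}\varphi+x_2\partial_{x_2}\varphi}{|\vec\xi|^2}\right)-\partial_{x_2}v\,\partial_{x_1}\!\left(\dfrac{x_1\partial_{x_1}\varphi+x_2\partial_{x_2}\varphi}{|\vec\xi|^2}\right)+\dfrac{2v\,(x_2\partial_{x_1}v-x_1\partial_{x_2}v)}{|\vec\xi|^4}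 & \text{in } D\times(0,T),\\[4pt] \mathcal L_K\varphi=w+\dfrac{2h^2v}{|\vec\xi|^4}+\dfrac{x_1\partial_{x_1}v+x_2\partial_{x_2}v}{|\vec\xi|^2} & \text{in } D\times(0,T),\\[4pt] \varphi=0 & \text{on }\partial D\times(0,T), \end{cases}\tag{S}$$ with initial data $w(\cdot,0)=w_3((\cdot,0),0)$ and $v(\cdot,0)=v_{\vec\xi}((\cdot,0),0)$ in $D$. (ii) Conversely, suppose that $(v,w)$ is a solution pair of (S), with stream function $\varphi$. Define on $D$ (suppressing $t$) the vector fields $\tilde{\mathbf u}=(\tilde u_1,\tilde u_2,\tilde u_3)^t$ and $\tilde{\mathbf v}$ by $$\begin{pmatrix}\tilde u_1\\ \tilde u_2\end{pmatrix}=\frac1{|\vec\xi|^2}\begin{pmatrix}-x_1x_2 & h^2+x_1^2\\ -(h^2+x_2^2) & x_1x_2\end{pmatrix}\begin{pmatrix}\partial_{x_1}\varphi\\ \partial_{x_2}\varphi\end{pmatrix},\qquad \tilde u_3=\frac{-x_2\tilde u_1+x_1\tilde u_2}{h},\qquad \tilde{\mathbf v}=\tilde{\mathbf u}+\frac{v\,\vec\xi}{|\vec\xi|^2}.$$ For $(x_1,x_2,x_3)\in\Omega$ define $$\mathbf v(x_1,x_2,x_3)=Q_{x_3/h}\,\tilde{\mathbf v}\big(R_{-x_3/h}(x_1,x_2)\big),$$ $$\mathbf w(x_1,x_2,x_3)=\frac{w\big(R_{-x_3/h}(x_1,x_2)\big)}{h}\,\vec\xi+\frac1h\Big(\partial_{x_2}\big[v(R_{-x_3/h}(x_1,x_2))\big],\,-\partial_{x_1}\big[v(R_{-x_3/h}(x_1,x_2))\big],\,0\Big)^t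 .$$ Then $(\mathbf v,\mathbf w)$ is a helical solution pair of the vorticity equations, i.e. $\mathbf v$ and $\mathbf w$ are helical, $\mathbf w=\nabla\times\mathbf v$, and $$\partial_t\mathbf w+(\mathbf v\cdot\nabla)\mathbf w=(\mathbf w\cdot\nabla)\mathbf v\ \text{ in }\Omega\times(0,T),\qquad \mathbf v\cdot\mathbf n=0\ \text{ on }\partial\Omega\times(0,T).$$
   Context: Superscript $t$ on a vector or matrix denotes transposition; $\mathbf n$ is the outward unit normal to $\partial\Omega$. For $\theta\in\mathbb R$ let $R_\theta=\begin{pmatrix}\cos\theta&\sin\theta\\-\sin\theta&\cos\theta\end{pmatrix}$, $Q_\theta=\begin{pmatrix}R_\theta&0\\0&1\end{pmatrix}$, and $H_\theta(x)=Q_\theta x+(0,0,h\theta)^t$ on $\mathbb R^3$. A domain $\Omega\subseteq\mathbb R^3$ is helical if $H_\theta(\Omega)=\Omega$ for all $\theta\in\mathbb R$. A scalar function $f$ on $\Omega$ is helical if $f(H_\theta(x))=f(x)$ for all $\theta,x$; a vector field $\mathbf v:\Omega\to\mathbb R^3$ is helical if $\mathbf v(H_\theta(x))=Q_\theta\mathbf v(x)$ for all $\theta,x$. A solution pair $(\mathbf v,P)$ is helical if both $\mathbf v$ and $P$ are helical (at each time). $\vec\xi(x)=(x_2,-x_1,h)^t$, $|\vec\xi|^2=h^2+x_1^2+x_2^2$ (both depend only on $(x_1,x_2)$). For a planar vector, $(a,b)^\perp=(b,-a)$, so $\nabla^\perp\varphi=(\partial_{x_2}\varphi,-\partial_{x_1}\varphi)$.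 $\mathcal L_K\varphi=-\operatorname{div}(K(x_1,x_2)\nabla\varphi)$ with $$K(x_1,x_2)=\frac1{h^2+x_1^2+x_2^2}\begin{pmatrix}h^2+x_2^2&-x_1x_2\\-x_1x_2&h^2+x_1^2\end{pmatrix}.$$ All solutions are understood to be classical (sufficiently smooth). The initial data in (S) are the values of $v,w$ at $t=0$. *)

(* Defs.v *)
From mathcomp Require Export all_boot all_order all_algebra.
From mathcomp Require Export all_classical all_reals all_analysis.
Export numFieldNormedType.Exports.

Set Implicit Arguments.
Unset Strict Implicit.
Unset Printing Implicit Defensive.

Import Order.TTheory GRing.Theory Num.Theory.

#[global] Open Scope classical_set_scope.
#[global] Open Scope ring_scope.

(* Conventions.  Vectors are column vectors and their coordinates are numbered
   from 0, so that x i 0 is the coordinate x_{i+1} of the literature.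
   Time-dependent fields are curried, f : R -> 'cV[R]_n -> W, time first.
   A field on a set A is a total function whose values outside A are ignored:
   its values on the boundary of A are always limits from inside A. *)

Section vectors.
Variable R : realType.

Definition col2 (a b : R) : 'cV[R]_2 := \col_i nth 0 [:: a; b] i.
Definition col3 (a b c : R) : 'cV[R]_3 := \col_i nth 0 [:: a; b; c] i.
Definition mat2 (a b c d : R) : 'M[R]_2 :=
  \matrix_(i, j) nth 0 (nth [::] [:: [:: a; b]; [:: c; d]] i) j.

Definition point (y : 'cV[R]_2) (s : R) : 'cV[R]_3 := col_mx y s%:M : 'cV[R]_(2 + 1).
Definition hor (x : 'cV[R]_3) : 'cV[R]_2 := usubmx (x : 'cV[R]_(2 + 1)).
Definition ht (x : 'cV[R]_3) : R := x 2 0.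

Definition dot n (x y : 'cV[R]_n) : R := \sum_i x i 0 * y i 0.
(* the norm `|x| of the library is the maximum norm *)
Definition enorm n (x : 'cV[R]_n) : R := Num.sqrt (dot x x).

Definition perp (a : 'cV[R]_2) : 'cV[R]_2 := col2 (a 1 0) (- a 0 0).

End vectors.

Section differential_operators.
Variable R : realType.

Definition partial n (W : normedModType R) (i : 'I_n) (f : 'cV[R]_n -> W)
  (x : 'cV[R]_n) : W := 'D_(delta_mx i 0) f x.

Definition dt n (W : normedModType R) (f : R -> 'cV[R]_n -> W) (t : R)
  (x : 'cV[R]_n) : W := derive1 (fun s => f s x) t.

Definition grad n (f : 'cV[R]_n -> R) (x : 'cV[R]_n) : 'cV[R]_n :=
  \col_i partial i f x.

Definition div n (u : 'cV[R]_n -> 'cV[R]_n) (x : 'cV[R]_n) : R :=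
  \sum_i partial i (fun y => u y i 0) x.

Definition curl (u : 'cV[R]_3 -> 'cV[R]_3) (x : 'cV[R]_3) : 'cV[R]_3 :=
  let d (i j : 'I_3) := partial i (fun y => u y j 0) x in
  col3 (d 1 2 - d 2 1) (d 2 0 - d 0 2) (d 0 1 - d 1 0).

(* (u . nabla) f *)
Definition adv n (W : normedModType R) (u : 'cV[R]_n -> 'cV[R]_n)
  (f : 'cV[R]_n -> W) (x : 'cV[R]_n) : W :=
  \sum_i u x i 0 *: partial i f x.

End differential_operators.

Section regularity.
Variable R : realType.

(* For U open and U `<=` M `<=` K `<=` closure U: f is of class C^k on U, its
   derivatives of order at most k extend continuously from U to K, and the
   extension of f itself takes the values of f on M. *)
Fixpoint Ck_upto (k : nat) (V W : normedModType R) (U M K : set V)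
    (f : V -> W) : Prop :=
  (exists g : V -> W, {within K, continuous g} /\ (forall x, M x -> f x = g x)) /\
  (if k is k'.+1 then
     forall e : V, (forall x, U x -> derivable f x e) /\
       Ck_upto k' U U K (fun x => 'D_e f x)
   else True).

Definition Ck_on k (V W : normedModType R) (U : set V) (f : V -> W) : Prop :=
  Ck_upto k U U U f.

Definition smooth_on (V W : normedModType R) (U : set V) (f : V -> W) : Prop :=
  forall k, Ck_on k U f.

Definition time_oo (T : \bar R) : set R := [set t | 0 < t /\ (t%:E < T)%E].
Definition time_co (T : \bar R) : set R := [set t | 0 <= t /\ (t%:E < T)%E].

(* C^k (closure A x I), jointly in time and space, for I = (0, T) or [0, T) *)
Definition Ck_field k (T : \bar R) (I : set R) n (A : set 'cV[R]_n)
    (W : normedModType R) (f : R -> 'cV[R]_n -> W) : Prop :=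
  Ck_upto k (time_oo T `*` A) (I `*` A) (I `*` closure A)
    (fun z : R * 'cV[R]_n => f z.1 z.2).

End regularity.

Section domains.
Variable R : realType.

Definition domain (T : topologicalType) (A : set T) : Prop :=
  [/\ A !=set0, open A & connected A].

Definition frontier (T : topologicalType) (A : set T) : set T :=
  closure A `\` interior A.

Definition I01 : set R := `[0, 1]%classic.

Definition path_in (T : topologicalType) (A : set T) (c : R -> T) : Prop :=
  {within I01, continuous c} /\ (forall s, I01 s -> A (c s)).

Definition null_homotopic_in (T : topologicalType) (A : set T) (c : R -> T) :
    Prop :=
  exists F : R * R -> T,
    [/\ {within I01 `*` I01, continuous F},
        (forall z, (I01 `*` I01) z -> A (F z)),
        (forall s, I01 s -> F (0, s) = c s /\ F (1, s) = c 0) &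
        (forall r, I01 r -> F (r, 0) = c 0 /\ F (r, 1) = c 0)].

Definition simply_connected (T : topologicalType) (A : set T) : Prop :=
  (forall x y, A x -> A y ->
     exists c : R -> T, [/\ path_in A c, c 0 = x & c 1 = y]) /\
  (forall c : R -> T, path_in A c -> c 0 = c 1 -> null_homotopic_in A c).

(* near p, A is the set where rho is negative, and p is not critical for rho *)
Definition defining_function n (A : set 'cV[R]_n) (p : 'cV[R]_n)
    (rho : 'cV[R]_n -> R) : Prop :=
  exists U : set 'cV[R]_n,
    [/\ open U, U p, smooth_on U rho, grad rho p != 0 &
        (forall x, U x -> (A x <-> rho x < 0))].

Definition smooth_boundary n (A : set 'cV[R]_n) : Prop :=
  forall p, frontier A p -> exists rho, defining_function A p rho.

Definition outward_unit_normal n (A : set 'cV[R]_n) (p m : 'cV[R]_n) : Prop :=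
  exists2 rho, defining_function A p rho &
    m = (enorm (grad rho p))^-1 *: grad rho p.

(* u . n = 0 on the boundary of A *)
Definition tangent_to_boundary n (A : set 'cV[R]_n)
    (u : 'cV[R]_n -> 'cV[R]_n) : Prop :=
  forall p m, frontier A p -> outward_unit_normal A p m ->
    (fun x => dot (u x) m) @ within A (nbhs p) --> (0 : R).

Definition vanishes_on_boundary n (A : set 'cV[R]_n) (f : 'cV[R]_n -> R) :
    Prop :=
  forall p, frontier A p -> f @ within A (nbhs p) --> (0 : R).

End domains.

Section helical_symmetry.
Variables (R : realType) (h : R).

Definition rot (theta : R) : 'M[R]_2 :=
  mat2 (cos theta) (sin theta) (- sin theta) (cos theta).

Definition rot3 (theta : R) : 'M[R]_3 :=
  block_mx (rot theta) 0 0 1%:M : 'M[R]_(2 + 1).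

Definition helix (theta : R) (x : 'cV[R]_3) : 'cV[R]_3 :=
  rot3 theta *m x + col3 0 0 (h * theta).

Definition helical_set (A : set 'cV[R]_3) : Prop :=
  forall theta, helix theta @` A = A.

Definition helical_function (A : set 'cV[R]_3) (f : 'cV[R]_3 -> R) : Prop :=
  forall theta x, A x -> f (helix theta x) = f x.

Definition helical_field (A : set 'cV[R]_3) (u : 'cV[R]_3 -> 'cV[R]_3) : Prop :=
  forall theta x, A x -> u (helix theta x) = rot3 theta *m u x.

Definition cross_section (A : set 'cV[R]_3) : set 'cV[R]_2 :=
  [set y | A (point y 0)].

(* xi and |xi|^2 depend only on the horizontal coordinates *)
Definition xi (y : 'cV[R]_2) : 'cV[R]_3 := col3 (y 1 0) (- y 0 0) h.
Definition xi2 (y : 'cV[R]_2) : R := h ^+ 2 + y 0 0 ^+ 2 + y 1 0 ^+ 2.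

Definition swirl (u : 'cV[R]_3 -> 'cV[R]_3) (x : 'cV[R]_3) : R :=
  dot (u x) (xi (hor x)).

Definition Kmat (y : 'cV[R]_2) : 'M[R]_2 :=
  (xi2 y)^-1 *: mat2 (h ^+ 2 + y 1 0 ^+ 2) (- (y 0 0 * y 1 0))
                     (- (y 0 0 * y 1 0)) (h ^+ 2 + y 0 0 ^+ 2).

Definition LK (f : 'cV[R]_2 -> R) (y : 'cV[R]_2) : R :=
  - div (fun z => Kmat z *m grad f z) y.

End helical_symmetry.

Section equations.
Variable R : realType.
Variable T : \bar R.

Definition euler_solution (A : set 'cV[R]_3) (v0 : 'cV[R]_3 -> 'cV[R]_3)
    (v : R -> 'cV[R]_3 -> 'cV[R]_3) (P : R -> 'cV[R]_3 -> R) : Prop :=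
  [/\ Ck_field 2 T (time_co T) A v /\
        (forall t, time_oo T t -> Ck_on 1 A (P t)),
      (forall t x, time_oo T t -> A x ->
         dt v t x + adv (v t) (v t) x = - grad (P t) x),
      (forall t x, time_oo T t -> A x -> div (v t) x = 0),
      (forall t, time_oo T t -> tangent_to_boundary A (v t)) &
      (forall x, A x -> v 0 x = v0 x)].

Definition vorticity_solution (A : set 'cV[R]_3)
    (v w : R -> 'cV[R]_3 -> 'cV[R]_3) : Prop :=
  [/\ Ck_field 2 T (time_oo T) A v /\ Ck_field 1 T (time_oo T) A w,
      (forall t x, time_oo T t -> A x -> w t x = curl (v t) x),
      (forall t x, time_oo T t -> A x ->
         dt w t x + adv (v t) (w t) x = adv (w t) (v t) x) &
      (forall t, time_oo T t -> tangent_to_boundary A (v t))].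

Section planar_system.
Variables (h : R) (D : set 'cV[R]_2).

Definition radial (f : 'cV[R]_2 -> R) (y : 'cV[R]_2) : R :=
  y 0 0 * partial 0 f y + y 1 0 * partial 1 f y.

(* Only the spatial derivatives of the stream function enter the system. *)
Definition stream_regular (phi : R -> 'cV[R]_2 -> R) : Prop :=
  forall i : 'I_2,
    (forall t y, time_oo T t -> D y -> derivable (phi t) y (delta_mx i 0)) /\
    Ck_field 2 T (time_oo T) D (fun t => partial i (phi t)).

Definition planar_solution (v0 w0 : 'cV[R]_2 -> R)
    (phi v w : R -> 'cV[R]_2 -> R) : Prop :=
  [/\ [/\ Ck_field 2 T (time_co T) D v, Ck_field 1 T (time_co T) D w &
          stream_regular phi],
      (forall t y, time_oo T t -> D y ->
         [/\ dt v t y + dot (perp (grad (phi t) y)) (grad (v t) y) = 0,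
             dt w t y + dot (perp (grad (phi t) y)) (grad (w t) y) =
               partial 0 (v t) y *
                 partial 1 (fun z => radial (phi t) z / xi2 h z) y
               - partial 1 (v t) y *
                 partial 0 (fun z => radial (phi t) z / xi2 h z) y
               + 2 * v t y *
                 (y 1 0 * partial 0 (v t) y - y 0 0 * partial 1 (v t) y)
                 / xi2 h y ^+ 2 &
             LK h (phi t) y =
               w t y + 2 * h ^+ 2 * v t y / xi2 h y ^+ 2
               + radial (v t) y / xi2 h y]),
      (forall t, time_oo T t -> vanishes_on_boundary D (phi t)) &
      (forall y, D y -> v 0 y = v0 y /\ w 0 y = w0 y)].

End planar_system.

End equations.

Section reconstruction.
Variables (R : realType) (h : R).

Definition utilde (f : 'cV[R]_2 -> R) (y : 'cV[R]_2) : 'cV[R]_3 :=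
  let u : 'cV[R]_2 :=
    (xi2 h y)^-1 *:
    (mat2 (- (y 0 0 * y 1 0)) (h ^+ 2 + y 0 0 ^+ 2)
          (- (h ^+ 2 + y 1 0 ^+ 2)) (y 0 0 * y 1 0) *m grad f y) in
  point u ((- y 1 0 * u 0 0 + y 0 0 * u 1 0) / h).

Definition vtilde (f v : 'cV[R]_2 -> R) (y : 'cV[R]_2) : 'cV[R]_3 :=
  utilde f y + (v y / xi2 h y) *: xi h y.

Definition helical_velocity (f v : 'cV[R]_2 -> R) (x : 'cV[R]_3) : 'cV[R]_3 :=
  rot3 (ht x / h) *m vtilde f v (rot (- ht x / h) *m hor x).

Definition helical_vorticity (v w : 'cV[R]_2 -> R) (x : 'cV[R]_3) : 'cV[R]_3 :=
  let r := rot (- ht x / h) in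
  (w (r *m hor x) / h) *: xi h (hor x) +
  h^-1 *: col3 (partial 1 (fun y => v (r *m y)) (hor x))
               (- partial 0 (fun y => v (r *m y)) (hor x)) 0.

End reconstruction.

(* Main.v *)
Require Import Defs.
From HB Require Import structures.
From mathcomp Require Import ring lra.

(** A helical vector field is determined by its values a on the plane x3 = 0:
    with y = foot x the point where the helix through x meets that plane, the
    field is ext a x = rot3 (x3 / h) *m a y.  Advection, curl, divergence and
    gradient of such fields are again extensions, of expressions in a and its
    two plane derivatives (adv_ext, curl_ext, div_ext, grad_foot); in them the
    role of the velocity is played by flow_comp a, the velocity of the foot.
    So both directions of the theorem are statements about functions on the
    cross-section D.

    Every a has the form (F1 + y2 Q, - F0 - y1 Q, h Q), that is, the turned
    field of (F0, F1) plus Q times xi (stream_of_field); then flow_comp a is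
    (F1, - F0), the swirl is v = xi2 Q + (y1 F0 + y2 F1), and the vertical
    vorticity is stream_vorticity.  The divergence of the extension is zero
    exactly when (F0, F1) is a closed field, and when it is the gradient of
    phi, the equation for LK phi is the formula for the vertical vorticity
    with Q written through v (LK_stream).

    From the plane to space, a is given by phi and v (vtildeE, vorticity_ext).
    The third component of the vorticity equation is the transport equation of
    w, whose right-hand side is the Jacobian of v and Q (stretching_term); the
    horizontal components are the derivatives of the transport equation of v
    (plane_vorticity_equation).  For the tangency, a defining function of the
    domain is constant along helices, so the part along xi is tangent
    (grad_rho_xi), and the turned gradient of phi is tangent because phi
    vanishes on the boundary (ext_tangent).

    From space to the plane, the transport of v is the Euler equation
    projected on xi, along which the pressure has no derivative
    (swirl_transport); the equation of w is the plane curl of the horizontal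
    Euler equations, where the pressure disappears by the symmetry of its
    mixed derivatives (mixed_partials).  The stream function is a potential of
    (F0, F1) on the simply connected D (poincare).  Tangency says that its
    gradient is normal to the boundary, so its boundary values are locally
    constant, and it remains to see that they are all equal, that is, that the
    boundary of a bounded simply connected plane domain is connected.

    Two points need a construction.  First, velocity and stream function are
    regular up to the boundary only as limits from inside, so the boundary is
    reached through a first order expansion of a function whose gradient has a
    limit at a regular boundary point (boundary_expansion): paths inside the
    domain, of length comparable to the distance, are built in coordinates
    along the tangent and the normal.  Tangential derivatives of boundary
    values are read from this expansion (tangential_derivative_zero,
    boundary_values_flat, boundary_values_locally_constant).

    Second, potentials and the connectedness of the boundary both follow from
    one principle (monodromy): functions given near each point, which agree
    near each point up to additive constants, come from one function if the set
    is simply connected, because increments along a path are well defined and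
    vanish around a contracted loop.  Applied to local potentials it gives
    poincare.  Applied to integer valued branches of the angle around a point
    it shows that the complement of D has no bounded part (no_hole), and
    applied on the whole plane to extensions of a function that separates two
    parts of the boundary it produces such a bounded part
    (boundary_dichotomy). *)

Set Implicit Arguments.
Unset Strict Implicit.
Unset Printing Implicit Defensive.

Import Order.TTheory GRing.Theory Num.Theory.

(** * Directional derivatives, the mean value inequality and the chain rule *)

Section directional.
Variable R : realType.
Implicit Types (V W : normedModType R).

Lemma line_quotient V W (f : V -> W) (x e : V) (s : R) :
  (fun k : R => k^-1 *: ((f \o shift (x + s *: e)) (k *: e) - f (x + s *: e))) =
  (fun k : R => k^-1 *: (((fun r : R => f (x + r *: e)) \o shift s) (k *: 1) -
                         f (x + s *: e))).
Proof.
apply/funext => k /=; congr (_ *: (f _ - _)).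
by rewrite -[k *: 1]/(k * 1) mulr1 scalerDl addrCA.
Qed.

Lemma derivable_line V W (f : V -> W) (x e : V) (s : R) :
  derivable f (x + s *: e) e <-> derivable (fun r : R => f (x + r *: e)) s 1.
Proof. by rewrite /derivable line_quotient. Qed.

Lemma derive_line V W (f : V -> W) (x e : V) (s : R) :
  'D_e f (x + s *: e) = 'D_1 (fun r : R => f (x + r *: e)) s.
Proof. by rewrite /derive line_quotient. Qed.

Lemma is_derive_line V W (f : V -> W) (x e : V) (s : R) d :
  is_derive (x + s *: e) e f d <->
  is_derive s 1 (fun r : R => f (x + r *: e)) d.
Proof.
split=> -[H1 H2]; apply: DeriveDef.
- exact/derivable_line.
- by rewrite -derive_line.
- exact/derivable_line.
- by rewrite derive_line.
Qed.

Lemma mean_value_line V (f : V -> R) (x e : V) (a : R) :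
  (forall s : R, 0 <= s <= 1 -> derivable f (x + (s * a) *: e) e) ->
  exists2 s, 0 <= s <= 1 & f (x + a *: e) - f x = a * 'D_e f (x + (s * a) *: e).
Proof.
move=> df; pose g (s : R) := f (x + (s * a) *: e).
have dg (s : R) : 0 <= s <= 1 -> is_derive s 1 g (a * 'D_e f (x + (s * a) *: e)).
  move=> s01; have /derivable_line d1 := df s s01.
  have d2 : is_derive (s * a) 1 (fun r : R => f (x + r *: e))
      ('D_e f (x + (s * a) *: e)).
    by apply: (is_derive_line f x e (s * a) _).1; apply/derivableP/df.
  have d3 : is_derive s 1 (fun r : R => r * a) a.
    have -> : (fun r : R => r * a) = (a \*: (@id R)).
      by apply/funext => r /=; rewrite /GRing.scale /= mulrC.
    by apply: is_derive_eq; rewrite /GRing.scale /= mulr1.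
  have -> : g = (fun r : R => f (x + r *: e)) \o (fun r : R => r * a) by [].
  by rewrite mulrC; exact: is_derive1_comp.
have g_cont : {within `[0, 1], continuous g}.
  apply: derivable_within_continuous => s; rewrite in_itv /= => s01.
  by have [] := dg s s01.
have dgo (s : R) : s \in `]0, 1[ ->
    is_derive s 1 g (a * 'D_e f (x + (s * a) *: e)).
  by rewrite in_itv /= => /andP[s0 s1]; apply: dg; rewrite !ltW.
have [c c01 Ec] := MVT_segment ler01 dgo g_cont.
exists c; first by move: c01; rewrite in_itv.
by move: Ec; rewrite /g mul1r mul0r scale0r addr0 subr0 mulr1.
Qed.

Lemma increment_bound V (f : V -> R) (x e : V) (a d eps : R) :
  (forall s : R, 0 <= s <= 1 -> derivable f (x + (s * a) *: e) e /\
     `|'D_e f (x + (s * a) *: e) - d| <= eps) ->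
  `|f (x + a *: e) - f x - a * d| <= eps * `|a|.
Proof.
move=> H; have [|s s01 ->] := @mean_value_line V f x e a.
  by move=> s /H [].
rewrite -mulrBr normrM mulrC ler_wpM2r //.
by have [] := H s s01.
Qed.

(** A finite basis with its continuous coordinate forms, indexed by initial
    segments of nat so that partial sums can be formed; it makes the calculus
    below apply at once to column vectors and to space-time R * 'cV_n. *)
Definition frame V (r : nat) (e : nat -> V) (l : nat -> {linear V -> R}) :=
  (forall x, x = \sum_(j < r) l j x *: e j) /\ (forall j, continuous (l j)).

(** The step h is run one coordinate at a time; on each side of this polygonal
    path the mean value theorem gives the increment of f with a slope close to
    the partial derivative at x. *)
Lemma C1_differentiable V r (e : nat -> V) l (f : V -> R) (x : V) :
  frame r e l ->
  (forall j : 'I_r, \forall z \near x, derivable f z (e j)) ->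
  (forall j : 'I_r, {for x, continuous ('D_(e j) f)}) ->
  differentiable f x.
Proof.
move=> [el cl] df cdf.
pose d (j : nat) := 'D_(e j) f x.
pose g h := \sum_(j < r) l j h * d j.
have lg : linear g.
  move=> a u v; rewrite /g scaler_sumr -big_split; apply: eq_bigr => j _ /=.
  by rewrite linearP mulrDl -scalerAl.
pose gM := GRing.isLinear.Build _ _ _ _ g lg.
pose gL : {linear V -> R} := HB.pack g gM.
have /choice[k kP] : forall j, exists k : R, 0 < k /\ forall h, `|l j h| <= k * `|h|.
  by move=> j; have [k k0 kP] := linear_lipschitz (cl j); exists k.
have k_ge0 j : 0 <= k j by have [/ltW] := kP j.
(* A compares the sum of the coordinates of h with the norm of h, and B the
   length of the polygonal path, which must stay where the slopes are close. *)
pose A := \sum_(j < r) k j; pose B := \sum_(j < r) k j * `|e j|.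
have A0 : 0 <= A by apply: sumr_ge0.
have B0 : 0 <= B by apply: sumr_ge0 => j _; apply: mulr_ge0.
have gb h : `|g h| <= (\sum_(j < r) k j * `|d j|) * `|h|.
  rewrite mulr_suml; apply: le_trans (ler_norm_sum _ _ _) _.
  apply: ler_sum => j _; rewrite normrM mulrAC ler_wpM2r //.
  by have [_] := kP j.
have gc : continuous gL.
  apply/linear_bounded_continuous.
  apply/linear_boundedP; exists (\sum_(j < r) k j * `|d j|).
  split; first exact: num_real.
  by move=> M /ltW kM h; apply: le_trans (gb h) _; apply: ler_wpM2r.
have fg : f \o shift x = cst (f x) + gL +o_ 0 id.
  apply/eqaddoP => _/posnumP[eps].
  pose eps' := eps%:num / (A + 1).
  have eps'0 : 0 < eps' by rewrite divr_gt0 // ltr_wpDl.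
  have near_x : \forall z \near x, forall j : 'I_r,
      derivable f z (e j) /\ `|'D_(e j) f z - d j| <= eps'.
    apply: filter_forall => j; near=> z; split; first by near: z; exact: df.
    by rewrite distrC; near: z; move/cvgrPdist_le : (cdf j); apply.
  have /nbhs_ballP[dl /= dl0 xdl] := near_x.
  have Bh (h : V) : `|h| < dl / (B + 1) -> B * `|h| < dl.
    rewrite ltr_pdivlMr ?ltr_wpDl // mulrC; apply: le_lt_trans.
    by apply: ler_wpM2r => //; rewrite lerDl.
  near=> h.
  have hdl : B * `|h| < dl.
    apply: Bh; near: h; apply: nbhs0_lt; rewrite divr_gt0 // ltr_wpDl //.
  rewrite /= -[X in `|X|]/(f (h + x) - (f x + g h)).
  pose p (m : nat) := x + \sum_(j < m) l j h *: e j.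
  have Hm m : (m <= r)%N ->
      `|f (p m) - f x - \sum_(j < m) l j h * d j|
        <= eps' * (\sum_(j < m) k j * `|h|).
    elim: m => [_|m IH mr].
      by rewrite /p !big_ord0 addr0 subrr subr0 normr0 mulr0.
    have {}IH := IH (ltnW mr).
    have step : `|f (p m + l m h *: e m) - f (p m) - l m h * d m|
        <= eps' * `|l m h|.
      apply: increment_bound => s /andP[s0 s1].
      apply: (xdl _ _ (Ordinal mr)).
      rewrite -ball_normE /= /p -addrA opprD addNKr normrN.
      apply: le_lt_trans hdl.
      apply: (@le_trans _ _ (\sum_(j < m.+1) (k j * `|e j|) * `|h|)).
        rewrite big_ord_recr /=; apply: le_trans (ler_normD _ _) _.
        apply: lerD.
          apply: le_trans (ler_norm_sum _ _ _) _; apply: ler_sum => j _.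
          rewrite normrZ mulrAC ler_wpM2r //.
          by have [_] := kP j.
        rewrite normrZ mulrAC ler_wpM2r // normrM ger0_norm //.
        have [_ /(_ h) lk] := kP m.
        by rewrite (le_trans _ lk) // ler_piMl.
      rewrite -mulr_suml ler_wpM2r // /B.
      rewrite -[leLHS](big_mkord xpredT (fun j => k j * `|e j|)).
      rewrite -[leRHS](big_mkord xpredT (fun j => k j * `|e j|)).
      rewrite (big_cat_nat (leq0n m.+1) mr) /= lerDl.
      by apply: sumr_ge0 => j _; apply: mulr_ge0.
    have -> : p m.+1 = p m + l m h *: e m by rewrite /p big_ord_recr /= addrA.
    rewrite !big_ord_recr /= mulrDr.
    have -> : f (p m + l m h *: e m) - f x -
        (\sum_(i < m) l i h * d i + l m h * d m) =
        (f (p m) - f x - \sum_(j < m) l j h * d j) +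
        (f (p m + l m h *: e m) - f (p m) - l m h * d m) by ring.
    apply: le_trans (ler_normD _ _) _; apply: lerD => //.
    apply: le_trans step _; rewrite ler_wpM2l ?(ltW eps'0) //.
    by have [_] := kP m.
  have := Hm r (leqnn r).
  have -> : p r = h + x by rewrite /p -el addrC.
  rewrite -mulr_suml -/A -/(g h) opprD addrA => /le_trans; apply.
  rewrite mulrA ler_wpM2r // /eps' mulrAC ler_pdivrMr ?ltr_wpDl //.
  by rewrite ler_wpM2l // lerDl.
have dfg : 'd f x = gL :> (V -> R) by apply: diff_unique.
by apply/diff_locallyP; rewrite dfg.
Unshelve. all: by end_near. Qed.

Lemma derive_frame V r (e : nat -> V) l (f : V -> R) (x u : V) :
  frame r e l -> differentiable f x ->
  'D_u f x = \sum_(j < r) l j u * 'D_(e j) f x.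
Proof.
move=> [el cl] df; rewrite deriveE // {1}(el u) linear_sum.
by apply: eq_bigr => j _; rewrite linearZ /= deriveE.
Qed.

(** The chain rule, where only the coordinates of the inner map are asked to
    be derivable, and only in the direction considered. *)
Lemma is_derive_comp V V' r (e : nat -> V') l (f : V' -> R) (Phi : V -> V')
    (x u : V) (dPhi : nat -> R) :
  frame r e l -> differentiable f (Phi x) ->
  (forall j : 'I_r, is_derive x u (fun z => l j (Phi z)) (dPhi j)) ->
  is_derive x u (fun z => f (Phi z)) (\sum_(j < r) dPhi j * 'D_(e j) f (Phi x)).
Proof.
move=> Fr df dP.
pose c (s : R) := Phi (x + s *: u).
have x0 : x = x + (0 : R) *: u by rewrite scale0r addr0.
have dc (j : 'I_r) : is_derive (0 : R) 1 (fun s : R => l j (c s)) (dPhi j).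
  apply: (is_derive_line (fun z => l j (Phi z)) x u 0 _).1; rewrite -x0; exact: dP.
have cE : c = \sum_(j < r) (fun s => l j (c s) *: e j).
  by apply/funext => s; rewrite fct_sumE; have [el _] := Fr; exact: el.
have dcj (j : 'I_r) : differentiable (fun s => l j (c s) *: e j) (0 : R).
  by apply: differentiableZl; apply/derivable1_diffP; have [] := dc j.
have dcc : differentiable c (0 : R).
  by rewrite cE; apply: differentiable_sum.
have c0 : c 0 = Phi x by rewrite /c -x0.
have ldc (j : 'I_r) : l j ('d c (0 : R) 1) = dPhi j.
  have [dlj <-] := dc j.
  rewrite deriveE; last exact/derivable1_diffP.
  have -> : (fun s : R => l j (c s)) = l j \o c by [].
  have [_ /(_ j) clj] := Fr.
  have dl : differentiable (l j) (c 0) by exact: linear_differentiable.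
  rewrite (diff_comp dcc dl) /=; congr (_ _).
  by rewrite (diff_lin _ clj).
rewrite x0; apply: (is_derive_line (fun z => f (Phi z)) x u 0 _).2.
have dfc : differentiable (f \o c) (0 : R).
  by apply: differentiable_comp => //; rewrite c0.
apply: DeriveDef; first exact: diff_derivable.
have -> : (fun r0 : R => f (Phi (x + r0 *: u))) = f \o c by [].
have dfc0 : differentiable f (c 0) by rewrite c0.
rewrite deriveE // (diff_comp dcc dfc0) /= c0 -deriveE // (derive_frame _ Fr) //.
rewrite -x0.
by apply: eq_bigr => j _; rewrite ldc.
Qed.

End directional.

(** * Symmetry of mixed derivatives *)

Section schwarz.
Variables (R : realType) (V : normedModType R).

Lemma translate_quotient (f : V -> R) (c x e : V) :
  (fun k : R => k^-1 *: (((fun z => f (z + c)) \o shift x) (k *: e) - f (x + c)))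
  = (fun k : R => k^-1 *: ((f \o shift (x + c)) (k *: e) - f (x + c))).
Proof. by apply/funext => k /=; rewrite addrA. Qed.

Lemma derivable_translate (f : V -> R) (c x e : V) :
  derivable f (x + c) e -> derivable (fun z => f (z + c)) x e.
Proof. by rewrite /derivable translate_quotient. Qed.

Lemma derive_translate (f : V -> R) (c x e : V) :
  'D_e (fun z => f (z + c)) x = 'D_e f (x + c).
Proof. by rewrite /derive translate_quotient. Qed.

(** The increment of f along e2 is taken at two points a *: e1 apart; the mean
    value theorem in the direction e1, then in the direction e2, writes the
    difference as a ^+ 2 times the mixed derivative at a point nearby. *)
Lemma second_difference (f : V -> R) (x e1 e2 : V) (eps : R) :
  (\forall z \near x, derivable f z e1) ->
  (\forall z \near x, derivable ('D_e1 f) z e2) ->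
  {for x, continuous ('D_e2 ('D_e1 f))} -> 0 < eps ->
  \forall a \near (0 : R)^'+,
    `|f (x + a *: e1 + a *: e2) - f (x + a *: e1) - (f (x + a *: e2) - f x)
      - a ^+ 2 * 'D_e2 ('D_e1 f) x| <= eps * a ^+ 2.
Proof.
move=> d1 d21 c21 eps0.
have near_x : \forall z \near x, [/\ derivable f z e1, derivable ('D_e1 f) z e2
    & `|'D_e2 ('D_e1 f) z - 'D_e2 ('D_e1 f) x| <= eps].
  have c' : \forall z \near x, `|'D_e2 ('D_e1 f) z - 'D_e2 ('D_e1 f) x| <= eps.
    by move/cvgrPdistC_le : c21; apply.
  by apply: (filterS _ (filterI d1 (filterI d21 c'))) => z [? []].
have /nbhs_ballP[dl /= dl0 xdl] := near_x.
near=> a.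
have a0 : 0 < a by near: a; exact: nbhs_right_gt.
have adl : a * (`|e1| + `|e2|) < dl.
  have : a < dl / (`|e1| + `|e2| + 1).
    by near: a; apply: nbhs_right_lt; rewrite divr_gt0 // ltr_wpDl // addr_ge0.
  rewrite ltr_pdivlMr; last by rewrite ltr_wpDl // addr_ge0.
  by apply: le_lt_trans; rewrite ler_pM2l // lerDl.
have inball (s s' : R) : 0 <= s <= 1 -> 0 <= s' <= 1 ->
    ball x dl (x + (s * a) *: e1 + (s' * a) *: e2).
  move=> /andP[s0 s1] /andP[s'0 s'1].
  rewrite -ball_normE /= -addrA opprD addNKr normrN.
  apply: le_lt_trans adl; apply: le_trans (ler_normD _ _) _.
  rewrite mulrDr; apply: lerD; rewrite normrZ normrM (gtr0_norm a0) ler_wpM2r //.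
    by rewrite ger0_norm // ler_piMl // ltW.
  by rewrite ger0_norm // ler_piMl // ltW.
pose g z := f (z + a *: e2) - f z.
have dg (s : R) : 0 <= s <= 1 -> is_derive (x + (s * a) *: e1) e1 g
    ('D_e1 f (x + (s * a) *: e1 + a *: e2) - 'D_e1 f (x + (s * a) *: e1)).
  move=> s01; apply: is_deriveB.
    apply: DeriveDef; last by rewrite derive_translate.
    apply: derivable_translate.
    have [] := xdl _ (inball s 1 s01 _); first by rewrite ler01 lexx.
    by rewrite mul1r.
  apply/derivableP.
  have [] := xdl _ (inball s 0 s01 _); first by rewrite ler01 lexx.
  by rewrite mul0r scale0r addr0.
have [|s s01 Es] := @mean_value_line R V g x e1 a.
  by move=> s /dg[].
have [_ Ds] := dg s s01.
have [|s' s'01 Es'] := @mean_value_line R V ('D_e1 f) (x + (s * a) *: e1) e2 a.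
  by move=> s' s'01; have [] := xdl _ (inball s s' s01 s'01).
have [_ _ B] := xdl _ (inball s s' s01 s'01).
rewrite [X in X - _](_ : _ = g (x + a *: e1) - g x); last by rewrite /g.
rewrite Es Ds Es' mulrA -expr2 -mulrBr normrM mulrC.
by rewrite [`|a ^+ 2|]ger0_norm ?sqr_ge0 // ler_wpM2r // sqr_ge0.
Unshelve. all: by end_near. Qed.

(** Both mixed derivatives are limits of the same symmetric second difference. *)
Lemma schwarz (f : V -> R) (x e1 e2 : V) :
  (\forall z \near x, derivable f z e1) -> (\forall z \near x, derivable f z e2) ->
  (\forall z \near x, derivable ('D_e1 f) z e2) ->
  (\forall z \near x, derivable ('D_e2 f) z e1) ->
  {for x, continuous ('D_e2 ('D_e1 f))} ->
  {for x, continuous ('D_e1 ('D_e2 f))} ->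
  'D_e2 ('D_e1 f) x = 'D_e1 ('D_e2 f) x.
Proof.
move=> d1 d2 d21 d12 c21 c12.
apply/eqP; rewrite -subr_eq0 -normr_le0; apply/ler_addgt0Pr => eps eps0.
rewrite add0r.
have eps20 : 0 < eps / 2 by rewrite divr_gt0.
have S1 := second_difference d1 d21 c21 eps20.
have S2 := second_difference d2 d12 c12 eps20.
have [a [[H1 H2] a0]] := filter_ex (filterI (filterI S1 S2) (nbhs_right_gt (0 : R))).
set A := 'D_e2 _ x in H1 *; set B := 'D_e1 _ x in H2 *.
rewrite -(ler_pM2r (exprn_gt0 2 a0)).
rewrite -[X in _ * X](ger0_norm (sqr_ge0 a)) -normrM.
set q := f _ - f _ - _ in H1.
have Eq : f (x + a *: e2 + a *: e1) - f (x + a *: e2) - (f (x + a *: e1) - f x) = q.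
  rewrite /q -(addrA x) (addrC (a *: e2)) (addrA x); ring.
rewrite Eq in H2.
have -> : (A - B) * a ^+ 2 = (q - a ^+ 2 * B) - (q - a ^+ 2 * A) by ring.
apply: le_trans (ler_normB _ _) _.
have E : eps / 2 * a ^+ 2 + eps / 2 * a ^+ 2 = eps * a ^+ 2 by rewrite -mulrDl -splitr.
rewrite -E; exact: (lerD H2 H1).
Qed.

End schwarz.

(** * Calculus of the classes C^k up to the boundary *)

Section Ck.
Variable R : realType.
Implicit Types (V W : normedModType R).

(** As U is open, the derivatives at its points see only the values on U. *)
Lemma Ck_eq k V W (U M K : set V) (f g : V -> W) :
  open U -> U `<=` M -> (forall x, M x -> f x = g x) ->
  Ck_upto k U M K f -> Ck_upto k U M K g.
Proof.
move=> oU; elim: k M f g => [|k IH] M f g UM fg /= [[F [cF fF]] df]; split.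
- by exists F; split => // x Mx; rewrite -fg // fF.
- by [].
- by exists F; split => // x Mx; rewrite -fg // fF.
move=> e; have [d1 d2] := df e.
have nfg x : U x -> \forall z \near x, f z = g z.
  move=> Ux; have : nbhs x U by exact: open_nbhs_nbhs.
  by apply: filterS => z /UM; exact: fg.
split; first by move=> x Ux; apply: near_eq_derivable (d1 x Ux); exact: nfg.
apply: IH d2 => // x Ux.
exact/near_eq_derive/nfg.
Qed.

Lemma Ck_mono k V W (U M K U' M' K' : set V) (f : V -> W) :
  U' `<=` U -> M' `<=` M -> K' `<=` K ->
  Ck_upto k U M K f -> Ck_upto k U' M' K' f.
Proof.
elim: k M M' f => [|k IH] M M' f UU MM KK /= [[F [cF fF]] df]; split => //.
- by exists F; split; [exact: continuous_subspaceW cF|move=> x /MM; exact: fF].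
- by exists F; split; [exact: continuous_subspaceW cF|move=> x /MM; exact: fF].
move=> e; have [d1 d2] := df e; split; first by move=> x /UU; exact: d1.
exact: IH d2.
Qed.

Lemma Ck_pred k V W (U M K : set V) (f : V -> W) :
  Ck_upto k.+1 U M K f -> Ck_upto k U M K f.
Proof.
elim: k M f => [|k IH] M f [Hf df]; split => // e.
by have [d1 d2] := df e; split => //; exact: IH.
Qed.

Lemma Ck_derivable k V W (U M K : set V) (f : V -> W) x e :
  Ck_upto k.+1 U M K f -> U x -> derivable f x e.
Proof. by move=> [_ /(_ e)[d _]] Ux; exact: d. Qed.

Lemma Ck_derive k V W (U M K : set V) (f : V -> W) e :
  Ck_upto k.+1 U M K f -> Ck_upto k U U K ('D_e f).
Proof. by move=> [_ /(_ e)[_ d]]. Qed.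

Lemma Ck_le k k' V W (U M K : set V) (f : V -> W) :
  (k <= k')%N -> Ck_upto k' U M K f -> Ck_upto k U M K f.
Proof.
elim: k' => [|k' IH]; first by rewrite leqn0 => /eqP ->.
rewrite leq_eqVlt => /orP[/eqP -> //|kk' /Ck_pred]; exact: IH.
Qed.

Lemma Ck_continuous k V W (U M K : set V) (f : V -> W) x :
  open U -> U `<=` M -> U `<=` K -> Ck_upto k U M K f -> U x ->
  {for x, continuous f}.
Proof.
move=> oU UM UK fk Ux.
have [[F [cF fF]] _] : Ck_upto 0 U M K f by exact: Ck_le fk.
have nU : nbhs x U by exact: open_nbhs_nbhs.
have FF : {for x, continuous F}.
  have : {within U, continuous F} by exact: continuous_subspaceW cF.
  by rewrite (continuous_open_subspace F oU); apply; rewrite inE.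
rewrite /prop_for /continuous_at (fF x (UM _ Ux)).
apply: cvg_trans FF; apply: near_eq_cvg.
by apply: filterS nU => z /UM /fF ->.
Qed.

Lemma Ck_near_derivable k V W (U M K : set V) (f : V -> W) x e :
  open U -> Ck_upto k.+1 U M K f -> U x -> \forall z \near x, derivable f z e.
Proof.
move=> oU fk Ux; have : nbhs x U by exact: open_nbhs_nbhs.
by apply: filterS => z; exact: Ck_derivable fk.
Qed.

Lemma Ck_differentiable k V r (e : nat -> V) (l : nat -> {linear V -> R}) (U M K : set V) (f : V -> R) x :
  frame r e l -> open U -> U `<=` K ->
  Ck_upto k.+1 U M K f -> U x -> differentiable f x.
Proof.
move=> Fr oU UK fk Ux; apply: (C1_differentiable Fr) => j.
  exact: Ck_near_derivable fk Ux.
by apply: (@Ck_continuous _ _ _ U U K) => //; exact: Ck_derive fk.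
Qed.

Lemma Ck_cst k V W (U M K : set V) (c : W) : open U -> U `<=` M ->
  Ck_upto k U M K (fun _ => c).
Proof.
move=> oU; elim: k M c => [|k IH] M c UM; split => //.
- by exists (fun _ => c); split => //; apply: continuous_subspaceT => ?; exact: cvg_cst.
- by exists (fun _ => c); split => //; apply: continuous_subspaceT => ?; exact: cvg_cst.
move=> e; split; first by move=> x _; exact: derivable_cst.
by apply: (@Ck_eq _ _ _ U U K (fun _ => 0)) => // [x _|]; [rewrite derive_cst|exact: IH].
Qed.

Lemma Ck_add k V W (U M K : set V) (f g : V -> W) : open U -> U `<=` M ->
  Ck_upto k U M K f -> Ck_upto k U M K g -> Ck_upto k U M K (fun x => f x + g x).
Proof.
move=> oU; elim: k M f g => [|k IH] M f g UM fk gk; split => //.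
- have [[F [cF fF]] _] := fk; have [[G [cG gG]] _] := gk.
  exists (fun x => F x + G x); split; last by move=> x Mx; rewrite fF // gG.
  by move=> x; apply: continuousD; [exact: cF|exact: cG].
- have [[F [cF fF]] _] := fk; have [[G [cG gG]] _] := gk.
  exists (fun x => F x + G x); split; last by move=> x Mx; rewrite fF // gG.
  by move=> x; apply: continuousD; [exact: cF|exact: cG].
move=> e.
have df x : U x -> derivable f x e by exact: Ck_derivable fk.
have dg x : U x -> derivable g x e by exact: Ck_derivable gk.
split; first by move=> x Ux; apply: derivableD; [exact: df|exact: dg].
apply: (@Ck_eq _ _ _ U U K (fun x => 'D_e f x + 'D_e g x)) => // [x Ux|].
  by rewrite -deriveD; [|exact: df|exact: dg].
by apply: IH => //; apply: Ck_derive; eassumption.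
Qed.

Lemma Ck_mul k V (U M K : set V) (f g : V -> R) : open U -> U `<=` M ->
  Ck_upto k U M K f -> Ck_upto k U M K g -> Ck_upto k U M K (fun x => f x * g x).
Proof.
move=> oU; elim: k M f g => [|k IH] M f g UM fk gk; split => //.
- have [[F [cF fF]] _] := fk; have [[G [cG gG]] _] := gk.
  exists (fun x => F x * G x); split; last by move=> x Mx; rewrite fF // gG.
  by move=> x; apply: continuousM; [exact: cF|exact: cG].
- have [[F [cF fF]] _] := fk; have [[G [cG gG]] _] := gk.
  exists (fun x => F x * G x); split; last by move=> x Mx; rewrite fF // gG.
  by move=> x; apply: continuousM; [exact: cF|exact: cG].
move=> e.
have df x : U x -> derivable f x e by exact: Ck_derivable fk.
have dg x : U x -> derivable g x e by exact: Ck_derivable gk.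
split; first by move=> x Ux; apply: derivableM; [exact: df|exact: dg].
apply: (@Ck_eq _ _ _ U U K (fun x => f x * 'D_e g x + g x * 'D_e f x)) => // [x Ux|].
  by rewrite -[RHS]/('D_e (f * g) x) deriveM; [|exact: df|exact: dg].
have mU h : Ck_upto k.+1 U M K h -> Ck_upto k U U K h.
  by move=> /Ck_pred; apply: Ck_mono.
apply: Ck_add => //; apply: IH => //.
- exact: mU.
- exact: Ck_derive gk.
- exact: mU.
- exact: Ck_derive fk.
Qed.

Lemma Ck_scale k V (U M K : set V) (c : R) (f : V -> R) : open U -> U `<=` M ->
  Ck_upto k U M K f -> Ck_upto k U M K (fun x => c * f x).
Proof. by move=> oU UM fk; apply: Ck_mul => //; exact: Ck_cst. Qed.

Lemma Ck_opp k V (U M K : set V) (f : V -> R) : open U -> U `<=` M ->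
  Ck_upto k U M K f -> Ck_upto k U M K (fun x => - f x).
Proof.
move=> oU UM fk; apply: (@Ck_eq _ _ _ U M K (fun x => -1 * f x)) => // [x _|].
  by rewrite mulN1r.
exact: Ck_scale.
Qed.

Lemma Ck_sub k V (U M K : set V) (f g : V -> R) : open U -> U `<=` M ->
  Ck_upto k U M K f -> Ck_upto k U M K g -> Ck_upto k U M K (fun x => f x - g x).
Proof. by move=> oU UM fk gk; apply: Ck_add => //; exact: Ck_opp. Qed.

Lemma Ck_sum k V (U M K : set V) n (f : 'I_n -> V -> R) : open U -> U `<=` M ->
  (forall j, Ck_upto k U M K (f j)) -> Ck_upto k U M K (fun x => \sum_(j < n) f j x).
Proof.
move=> oU UM; elim: n f => [|n IH] f fk.
  apply: (@Ck_eq _ _ _ U M K (fun _ => 0)) => // [x _|]; first by rewrite big_ord0.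
  exact: Ck_cst.
apply: (@Ck_eq _ _ _ U M K (fun x => f ord0 x + \sum_(j < n) f (lift ord0 j) x)) => //.
  by move=> x _; rewrite big_ord_recl.
by apply: Ck_add => //; exact: IH.
Qed.

Definition Sm V (f : V -> R) := forall k, Ck_upto k setT setT setT f.

Lemma Sm_continuous V (f : V -> R) : Sm f -> continuous f.
Proof.
by move=> /(_ 0%N) f0 x; apply: (Ck_continuous _ _ _ f0) => //; exact: openT.
Qed.

Lemma Sm_derivable V (f : V -> R) x e : Sm f -> derivable f x e.
Proof. by move=> /(_ 1%N) f1; exact: (@Ck_derivable 0 V R setT setT setT f x e f1). Qed.

Lemma Sm_cst V (c : R) : Sm (fun _ : V => c).
Proof. by move=> k; apply: Ck_cst => //; exact: openT. Qed.

Lemma Sm_add V (f g : V -> R) : Sm f -> Sm g -> Sm (fun x => f x + g x).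
Proof. by move=> fk gk k; apply: Ck_add => //; exact: openT. Qed.

Lemma Sm_sub V (f g : V -> R) : Sm f -> Sm g -> Sm (fun x => f x - g x).
Proof. by move=> fk gk k; apply: Ck_sub => //; exact: openT. Qed.

Lemma Sm_opp V (f : V -> R) : Sm f -> Sm (fun x => - f x).
Proof. by move=> fk k; apply: Ck_opp => //; exact: openT. Qed.

Lemma Sm_mul V (f g : V -> R) : Sm f -> Sm g -> Sm (fun x => f x * g x).
Proof. by move=> fk gk k; apply: Ck_mul => //; exact: openT. Qed.

Lemma Sm_exp V (f : V -> R) n : Sm f -> Sm (fun x => f x ^+ n).
Proof.
move=> fk; elim: n => [|n IH] k.
  by under eq_fun do rewrite expr0; exact: Sm_cst.
by under eq_fun do rewrite exprS; exact: Sm_mul.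
Qed.

Lemma Sm_lin V (l : {linear V -> R}) : continuous l -> Sm l.
Proof.
move=> cl [|k]; split => //.
- by exists l; split => //; exact: continuous_subspaceT.
- by exists l; split => //; exact: continuous_subspaceT.
move=> e; split; first by move=> x _; exact/diff_derivable/linear_differentiable.
apply: (@Ck_eq _ _ _ setT setT setT (fun _ => l e)) => //; first exact: openT.
  by move=> x _; rewrite deriveE ?diff_lin //; exact: linear_differentiable.
exact: Sm_cst.
Qed.

Lemma Sm_inv V (f : V -> R) : Sm f -> (forall x, f x != 0) -> Sm (fun x => (f x)^-1).
Proof.
move=> fk f0; elim=> [|k IH]; split => //.
- exists (fun x => (f x)^-1); split => //; apply: continuous_subspaceT => x.
  by apply: continuousV; [exact: f0|exact: Sm_continuous].
- exists (fun x => (f x)^-1); split => //; apply: continuous_subspaceT => x.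
  by apply: continuousV; [exact: f0|exact: Sm_continuous].
move=> e.
have df x : derivable f x e by exact: Sm_derivable.
split; first by move=> x _; apply: derivableV.
apply: (@Ck_eq _ _ _ setT setT setT
   (fun x => - ((f x)^-1 * (f x)^-1) * 'D_e f x)) => //; first exact: openT.
  by move=> x _; rewrite deriveV // -exprVn expr2.
apply: Ck_mul => //; first exact: openT.
  by apply: Ck_opp => //; [exact: openT|apply: Ck_mul => //; exact: openT].
exact: Ck_derive (fk k.+1).
Qed.

Lemma is_derive_compl V (g : R -> R) (f : V -> R) x e a b :
  is_derive (f x) 1 g a -> is_derive x e f b ->
  is_derive x e (fun z => g (f z)) (a * b).
Proof.
move=> dg df; have x0 : x = x + (0 : R) *: e by rewrite scale0r addr0.
rewrite x0; apply: (is_derive_line (fun z => g (f z)) x e 0 _).2.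
apply: is_derive1_comp; first by rewrite -x0.
by apply: (is_derive_line f x e 0 _).1; rewrite -x0.
Qed.

(** Proved together, since up to the sign each is the derivative of the other. *)
Lemma Sm_cos_sin V (f : V -> R) : Sm f ->
  Sm (fun x => cos (f x)) /\ Sm (fun x => sin (f x)).
Proof.
move=> fk.
suff H k : Ck_upto k setT setT setT (fun x => cos (f x)) /\
           Ck_upto k setT setT setT (fun x => sin (f x)).
  by split => k; have [] := H k.
have cc : continuous (fun x => cos (f x)).
  by move=> x; apply: continuous_comp; [exact: Sm_continuous|exact: continuous_cos].
have cs : continuous (fun x => sin (f x)).
  by move=> x; apply: continuous_comp; [exact: Sm_continuous|exact: continuous_sin].
have df x e : is_derive x e f ('D_e f x) by apply/derivableP; exact: Sm_derivable.
have dc x e : is_derive x e (fun x => cos (f x)) (- sin (f x) * 'D_e f x).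
  exact: is_derive_compl.
have ds x e : is_derive x e (fun x => sin (f x)) (cos (f x) * 'D_e f x).
  exact: is_derive_compl.
elim: k => [|k [IHc IHs]]; split; split => //.
- by exists (fun x => cos (f x)); split => //; exact: continuous_subspaceT.
- by exists (fun x => sin (f x)); split => //; exact: continuous_subspaceT.
- by exists (fun x => cos (f x)); split => //; exact: continuous_subspaceT.
- move=> e; split; first by move=> x _; have [] := dc x e.
  apply: (@Ck_eq _ _ _ setT setT setT (fun x => - sin (f x) * 'D_e f x)) => //.
  + exact: openT.
  + by move=> x _; have [_ ->] := dc x e.
  apply: Ck_mul => //; first exact: openT.
    by apply: Ck_opp => //; exact: openT.
  exact: Ck_derive (fk k.+1).
- by exists (fun x => sin (f x)); split => //; exact: continuous_subspaceT.
move=> e; split; first by move=> x _; have [] := ds x e.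
apply: (@Ck_eq _ _ _ setT setT setT (fun x => cos (f x) * 'D_e f x)) => //.
- exact: openT.
- by move=> x _; have [_ ->] := ds x e.
apply: Ck_mul => //; first exact: openT.
exact: Ck_derive (fk k.+1).
Qed.

Lemma frame_continuous V V' r e (l : nat -> {linear V' -> R}) (Phi : V -> V') :
  frame r e l -> (forall j : 'I_r, continuous (fun z => l j (Phi z))) ->
  continuous Phi.
Proof.
move=> [el cl] cP.
have -> : Phi = \sum_(j < r) (fun z => l j (Phi z) *: e j).
  by apply/funext => s; rewrite fct_sumE; exact: el.
move=> x; apply: (big_ind (fun F : V -> V' => {for x, continuous F})).
- exact: cvg_cst.
- by move=> f g cf cg; exact: continuousD.
move=> j _; apply: continuousZl; exact: cP.
Qed.

Lemma within_comp V V' W (K : set V) (K' : set V') (g : V' -> W) (Phi : V -> V') :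
  continuous Phi -> (forall x, K x -> K' (Phi x)) ->
  {within K', continuous g} -> {within K, continuous (fun x => g (Phi x))}.
Proof.
move=> cP KK cg; apply/subspace_continuousP => x Kx.
have /subspace_continuousP/(_ _ (KK _ Kx)) cgx := cg.
apply: (cvg_comp Phi g); last exact: cgx.
move=> A; rewrite /within /= !nbhs_simpl /= => nA.
have H : nbhs x (Phi @^-1` (fun y => K' y -> A y)) by exact: cP.
by apply: (filterS _ H) => z Az Kz; exact/Az/KK.
Qed.

Lemma within_add V W (K : set V) (f g : V -> W) :
  {within K, continuous f} -> {within K, continuous g} ->
  {within K, continuous (fun x => f x + g x)}.
Proof. by move=> cf cg x; apply: continuousD; [exact: cf|exact: cg]. Qed.

(** The chain rule gives the derivatives of the composite as sums of products
    of derivatives of f at Phi x and of coordinates of Phi, so the induction on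
    k needs the coordinates of Phi to be smooth of every order. *)
Lemma Ck_comp k V V' r e (l : nat -> {linear V' -> R}) (f : V' -> R)
    (Phi : V -> V') (U M K : set V) (U' M' K' : set V') :
  frame r e l -> open U -> open U' -> U `<=` M -> U' `<=` K' ->
  (forall x, U x -> U' (Phi x)) -> (forall x, M x -> M' (Phi x)) ->
  (forall x, K x -> K' (Phi x)) ->
  (forall j : 'I_r, Sm (fun z => l j (Phi z))) ->
  Ck_upto k U' M' K' f -> Ck_upto k U M K (fun x => f (Phi x)).
Proof.
move=> Fr oU oU' UM UK' UU MM KK sP.
have cP : continuous Phi.
  by apply: (frame_continuous Fr) => j; exact: Sm_continuous.
elim: k M M' f UM MM => [|k IH] M M' f UM MM fk; split => //.
- have [[F [cF fF]] _] := fk.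
  exists (fun x => F (Phi x)); split; last by move=> x /MM /fF.
  exact: within_comp cF.
- have [[F [cF fF]] _] := fk.
  exists (fun x => F (Phi x)); split; last by move=> x /MM /fF.
  exact: within_comp cF.
move=> u.
have dfP x : U x -> is_derive x u (fun z => f (Phi z))
    (\sum_(j < r) 'D_u (fun z => l j (Phi z)) x * 'D_(e j) f (Phi x)).
  move=> Ux; apply: (@is_derive_comp _ _ _ _ _ _ _ _ _ _
      (fun j => 'D_u (fun z => l j (Phi z)) x) Fr).
    by apply: (Ck_differentiable Fr oU' UK' fk); exact: UU.
  by move=> j; apply/derivableP; exact: Sm_derivable.
split; first by move=> x Ux; have [] := dfP x Ux.
apply: (@Ck_eq _ _ _ U U K (fun x =>
  \sum_(j < r) 'D_u (fun z => l j (Phi z)) x * 'D_(e j) f (Phi x))) => //.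
  by move=> x Ux; have [_ ->] := dfP x Ux.
apply: Ck_sum => // j; apply: Ck_mul => //.
  apply: (@Ck_mono _ _ _ setT setT setT) => //; exact: Ck_derive (sP j k.+1).
by apply: (IH U U' ('D_(e j) f)) => //; exact: Ck_derive fk.
Qed.

End Ck.

(** * Coordinates of space-time, and regularity up to the initial time *)

Lemma ord2_ind (P : 'I_2 -> Prop) : P 0 -> P 1 -> forall j, P j.
Proof.
move=> P0 P1 -[[|[|j]] p]; last by [].
- by have -> : Ordinal p = 0 by exact/val_inj.
- by have -> : Ordinal p = 1 by exact/val_inj.
Qed.

Lemma ord3_ind (P : 'I_3 -> Prop) : P 0 -> P 1 -> P 2 -> forall j, P j.
Proof.
move=> P0 P1 P2 -[[|[|[|j]]] p]; last by [].
- by have -> : Ordinal p = 0 by exact/val_inj.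
- by have -> : Ordinal p = 1 by exact/val_inj.
- by have -> : Ordinal p = 2 by exact/val_inj.
Qed.

Section frames.
Variable R : realType.

Definition mkl (V : normedModType R) (f : V -> R) (lf : linear f) :
  {linear V -> R} := HB.pack f (GRing.isLinear.Build _ _ _ _ f lf).

Lemma coord_linear n (i : 'I_n) : linear (fun x : 'cV[R]_n => x i 0 : R).
Proof. by move=> a u v; rewrite !mxE. Qed.

(** Indexed by nat, as a frame asks; only the indices at most n matter. *)
Definition cvl n (j : nat) : {linear 'cV[R]_n.+1 -> R} :=
  mkl (@coord_linear n.+1 (inord j)).
Definition cve n (j : nat) : 'cV[R]_n.+1 := delta_mx (inord j) 0.

Lemma cv_frame n : frame n.+1 (@cve n) (@cvl n).
Proof.
split=> [x|j]; last by move=> x; exact: coord_continuous.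
apply/matrixP => i k; rewrite ord1 summxE (bigD1 i) //= big1 => [|j ji].
  by rewrite !mxE inord_val !eqxx mulr1 addr0.
rewrite !mxE inord_val eqxx andbT.
by rewrite eq_sym (negbTE ji) mulr0.
Qed.

Lemma st0_linear n : linear (fun z : R * 'cV[R]_n => z.1 : R).
Proof. by []. Qed.

Lemma stS_linear n (i : 'I_n) : linear (fun z : R * 'cV[R]_n => z.2 i 0 : R).
Proof. by move=> a u v; rewrite !mxE. Qed.

Definition stl n (j : nat) : {linear (R * 'cV[R]_n.+1)%type -> R} :=
  if j is i.+1 then mkl (@stS_linear n.+1 (inord i)) else mkl (@st0_linear n.+1).

Definition time_dir n : (R * 'cV[R]_n)%type := (1, 0).
Definition space_dir n (i : 'I_n) : (R * 'cV[R]_n)%type := (0, delta_mx i 0).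

Definition ste n (j : nat) : (R * 'cV[R]_n.+1)%type :=
  if j is i.+1 then space_dir (inord i) else time_dir n.+1.

Lemma fst_sum n m (F : 'I_m -> R * 'cV[R]_n) :
  (\sum_(i < m) F i).1 = \sum_(i < m) (F i).1.
Proof. exact: (big_morph (fun z => z.1)). Qed.

Lemma snd_sum n m (F : 'I_m -> R * 'cV[R]_n) :
  (\sum_(i < m) F i).2 = \sum_(i < m) (F i).2.
Proof. exact: (big_morph (fun z => z.2)). Qed.

Lemma st_frame n : frame n.+2 (@ste n) (@stl n).
Proof.
split=> [[t x]|[|j]].
- rewrite big_ord_recl /=.
  rewrite [X in _ = _ + X](_ : _ = (0, x)).
    apply: injective_projections => /=; last by rewrite scaler0 add0r.
    by rewrite addr0 -[t *: 1]/(t * 1) mulr1.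
  apply/eqP; rewrite -pair_eqE; apply/andP; split; apply/eqP => /=.
    by rewrite fst_sum big1 // => i _ /=; rewrite scaler0.
  rewrite snd_sum /=; have [el _] := cv_frame n.
  by rewrite [RHS]el; apply: eq_bigr => i _.
- by move=> z; exact: cvg_fst.
- move=> z; apply: (@continuous_comp _ _ _ snd (fun x : 'cV[R]_n.+1 => x (inord j) 0)).
    exact: cvg_snd.
  exact: coord_continuous.
Qed.

End frames.

Section curry.
Variables (R : realType) (n : nat) (W : normedModType R).
Implicit Types f : R -> 'cV[R]_n -> W.

Let unc f := fun z : R * 'cV[R]_n => f z.1 z.2.

Lemma partial_quotient f t x (i : 'I_n) :
  (fun k : R => k^-1 *: ((unc f \o shift (t, x)) (k *: space_dir R i) - unc f (t, x))) =
  (fun k : R => k^-1 *: ((f t \o shift x) (k *: delta_mx i 0) - f t x)).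
Proof. by apply/funext => k; rewrite /unc /= scaler0 add0r. Qed.

Lemma partial_unc f t x (i : 'I_n) : partial i (f t) x = 'D_(space_dir R i) (unc f) (t, x).
Proof. by rewrite /partial /derive partial_quotient. Qed.

Lemma derivable_unc f t x (i : 'I_n) :
  derivable (f t) x (delta_mx i 0) <-> derivable (unc f) (t, x) (space_dir R i).
Proof. by rewrite /derivable partial_quotient. Qed.

Lemma dt_quotient f t x :
  (fun k : R => k^-1 *: ((unc f \o shift (t, x)) (k *: time_dir R n) - unc f (t, x))) =
  (fun k : R => k^-1 *: (((fun s => f s x) \o shift t) (k *: 1) - f t x)).
Proof. by apply/funext => k; rewrite /unc /= scaler0 add0r. Qed.

Lemma dt_unc f t x : dt f t x = 'D_(time_dir R n) (unc f) (t, x).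
Proof. by rewrite /dt derive1E /derive dt_quotient. Qed.

Lemma derivable_dt_unc f t x :
  derivable (fun s => f s x) t 1 <-> derivable (unc f) (t, x) (time_dir R n).
Proof. by rewrite /derivable dt_quotient. Qed.

End curry.

Section initial_time.
Variable R : realType.

(** A form without quotient of the definition, which mean value estimates and
    their limits meet directly. *)
Lemma is_derive_bound (V : normedModType R) (f : V -> R) (x e : V) (d : R) :
  (forall eps, 0 < eps -> \forall a \near (0 : R),
     `|f (x + a *: e) - f x - a * d| <= eps * `|a|) ->
  is_derive x e f d.
Proof.
move=> H.
suff C : (fun k : R => k^-1 *: ((f \o shift x) (k *: e) - f x)) @ 0^' --> d.
  by apply: DeriveDef; [apply/cvg_ex; exists d|exact/cvg_lim].
apply/cvgrPdist_le => eps eps0.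
have He := H eps eps0.
near=> k.
have k0 : k != 0 by near: k; exact: nbhs_dnbhs_neq.
have kH : `|f (x + k *: e) - f x - k * d| <= eps * `|k|.
  by near: k; exact: nbhs_dnbhs He.
rewrite distrC /= [k *: e + x]addrC.
rewrite -[X in _ - X](mulKf k0) -[_ *: _]/(_ * _) -mulrBr normrM normfV.
by rewrite ler_pdivrMl ?normr_gt0 // (mulrC `|k|).
Unshelve. all: by end_near. Qed.

(** Outside U, the set M constrains only the values of f itself. *)
Lemma Ck_enlarge k (V W : normedModType R) (U M K : set V) (f g : V -> W) :
  {within K, continuous g} -> (forall x, M x -> f x = g x) ->
  Ck_upto k U U K f -> Ck_upto k U M K f.
Proof. by move=> cg fg; case: k => [|k] [_ H]; split => //; exists g. Qed.

Lemma open_time_oo (T : \bar R) : open (time_oo T).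
Proof.
have -> : time_oo T = [set t | 0 < t] `&` [set t | (t%:E < T)%E] by [].
apply: openI; first exact: open_gt.
case: T => [r||].
- by rewrite (_ : [set t | _] = [set t | t < r]); [exact: open_lt|
    apply/funext => t /=; rewrite lte_fin].
- rewrite (_ : [set t | _] = setT); first exact: openT.
  by apply/funext => t /=; rewrite ltry propeqE.
- rewrite (_ : [set t | _] = set0); first exact: open0.
  by apply/funext => t /=; rewrite ltNge leNye propeqE.
Qed.

(** Up to the initial time included, the spatial derivatives of a C^1 field
    are the limits of those at positive times: a mean value estimate that is
    uniform in time passes to the limit. *)
Lemma Ck_field_partial k (T : \bar R) n (A : set 'cV[R]_n)
    (f : R -> 'cV[R]_n -> R) (i : 'I_n) :
  (0 < T)%E -> open A -> Ck_field k.+1 T (time_co T) A f ->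
  Ck_field k T (time_co T) A (fun t => partial i (f t)).
Proof.
move=> T0 oA fk; pose F := fun z : R * 'cV[R]_n => f z.1 z.2.
set K := time_co T `*` closure A.
have DF := Ck_derive (space_dir R i) fk.
have DFE (z : R * 'cV[R]_n) : 'D_(space_dir R i) F z = partial i (f z.1) z.2.
  by case: z => t x; rewrite partial_unc.
have {}DF : Ck_upto k (time_oo T `*` A) (time_oo T `*` A) K
    (fun z => partial i (f z.1) z.2).
  by move: DF; rewrite -/F; under eq_fun do rewrite DFE.
have [[g [cg gE]] _] := Ck_le (leq0n k) DF.
have [[G [cG GE]] _] := fk.
refine (Ck_enlarge cg _ DF) => -[t x] [/= [t0 tT] Ax].
have [tp|] := ltP 0 t; first by rewrite -gE.
move=> t0'; have {t0 t0' tT} -> : t = 0 by apply/eqP; rewrite eq_le t0 t0'.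
suff : is_derive x (delta_mx i 0) (f 0) (g (0, x)) by case.
apply: is_derive_bound => eps eps0.
have K0x (y : 'cV[R]_n) : A y -> K (0, y).
  by move=> Ay; split; [split|exact: subset_closure].
have gx : \forall z \near (0 : R, x), K z -> `|g z - g (0, x)| <= eps.
  have /subspace_continuousP/(_ _ (K0x x Ax)) := cg.
  by move/cvgrPdistC_le; apply.
have [[B1 B2] [/= nB1 nB2] B12] := gx.
have nA : nbhs x A by exact: open_nbhs_nbhs.
have [dl /= dl0 xdl] := (nbhs_ballP x _).1 (filterI nA nB2).
have nT : \forall t \near (0 : R)^'+, time_oo T t.
  have : \forall t \near (0 : R)^'+, (t%:E < T)%E.
    case: T T0 {fk K DF gE cg cG GE K0x gx B12} => [r|_|//].
      by rewrite lte_fin => r0; near=> u; rewrite lte_fin; near: u; exact: nbhs_right_lt.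
    by near=> u; exact: ltry.
  by move=> H; near=> u; split; near: u; [exact: nbhs_right_gt|exact: H].
have nB1' : \forall t \near (0 : R)^'+, B1 t by apply: cvg_within; exact: nB1.
pose e := delta_mx i 0 : 'cV[R]_n.
have ndl : \forall a \near (0 : R), `|a| * `|e| < dl.
  have : \forall a \near (0 : R), `|a| < dl / (`|e| + 1).
    by apply: nbhs0_lt; rewrite divr_gt0 // ltr_wpDl.
  apply: filterS => a; rewrite ltr_pdivlMr ?ltr_wpDl //.
  by apply: le_lt_trans; rewrite ler_wpM2l // lerDl.
near=> a.
have adl : `|a| * `|e| < dl by near: a.
have inb (s : R) : 0 <= s <= 1 -> ball x dl (x + (s * a) *: e).
  move=> /andP[s0 s1]; rewrite -ball_normE /= opprD addNKr normrN normrZ.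
  apply: le_lt_trans adl; rewrite ler_wpM2r // normrM ger0_norm //.
  by rewrite ler_piMl.
have inA (s : R) : 0 <= s <= 1 -> A (x + (s * a) *: e).
  by move=> /inb /xdl [].
have Ft (y : 'cV[R]_n) : A y -> f t y @[t --> 0^'+] --> f 0 y.
  move=> Ay; rewrite (GE (0, y)); last by split => //; split.
  have /subspace_continuousP/(_ _ (K0x y Ay)) cGy := cG.
  have : G (t, y) @[t --> 0^'+] --> G (0, y).
    apply: (cvg_comp (fun t : R => (t, y)) G); last exact: cGy.
    move=> P [[Q1 Q2] [/= nQ1 nQ2] Q12].
    have nQ1' : \forall t \near (0 : R)^'+, Q1 t by apply: cvg_within; exact: nQ1.
    have [/= _ Q2y] := (isT, nbhs_singleton nQ2).
    near=> u; apply: (Q12 (u, y)); first by split => //=; near: u; exact: nQ1'.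
    split; last exact: subset_closure.
    have [/ltW ? ?] : time_oo T u by near: u; exact: nT.
    by split.
  apply: cvg_trans; apply: near_eq_cvg; near=> u.
  rewrite (GE (u, y)) //; split => //=.
  have [/ltW ? ?] : time_oo T u by near: u; exact: nT.
  by split.
have Ax' : A (x + a *: e) by have := inA 1; rewrite mul1r; apply; rewrite ler01 lexx.
(* For a fixed, the mean value estimate holds at small positive times u, and u
   tends to 0. *)
have lim : `|f t (x + a *: e) - f t x - a * g (0, x)| @[t --> 0^'+] -->
    `|f 0 (x + a *: e) - f 0 x - a * g (0, x)|.
  apply: cvg_norm; apply: cvgB; last exact: cvg_cst.
  by apply: cvgB; exact: Ft.
rewrite -(cvg_lim _ lim) //; apply: limr_le; first by apply/cvg_ex; eexists; exact: lim.
near=> u.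
have tT : time_oo T u by near: u; exact: nT.
apply: increment_bound => s s01.
have UA : (time_oo T `*` A) (u, x + (s * a) *: e).
  by split => //=; exact: inA.
split; first by apply/derivable_unc; exact: Ck_derivable fk UA.
rewrite (_ : 'D_e (f u) _ = g (u, x + (s * a) *: e)); last exact: gE UA.
apply: (B12 (u, x + (s * a) *: e)).
  split => /=; first by near: u; exact: nB1'.
  by have [] := xdl _ (inb s s01).
by split => /=; [have [/ltW ? ?] := tT; split|apply: subset_closure; exact: inA].
Unshelve. all: by end_near. Qed.

End initial_time.

(** * Monodromy: local primitives on a simply connected set have a global one *)

Lemma near_continuous (T U : topologicalType) (f : T -> U) x (P : U -> Prop) :
  f @ x --> f x -> (\forall y \near f x, P y) -> \forall z \near x, P (f z).
Proof. by move=> cf nP; exact: cf. Qed.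

Lemma near_within (T U : topologicalType) (f : T -> U) (B : set T) (x : T) (l : U) (P : U -> Prop) :
  f @ within B (nbhs x) --> l -> (\forall y \near l, P y) ->
  \forall z \near x, B z -> P (f z).
Proof. by move=> cf nP; exact: cf. Qed.

(** The points of A that satisfy P and those that do not form relatively open
    subsets of A. *)
Lemma connected_induction (T : topologicalType) (A : set T) (P : T -> Prop) :
  connected A -> (exists2 x, A x & P x) ->
  (forall x, A x -> \forall y \near x, A y -> (P y <-> P x)) ->
  forall x, A x -> P x.
Proof.
move=> cA [x0 Ax0 Px0] loc x Ax.
have AE : A `&` P = A.
  apply: cA; first by exists x0.
  - exists (interior [set y | A y -> P y]); first exact: open_interior.
    apply/seteqP; split => y [Ay Py]; split => //.
      by have := loc y Ay; apply: filterS => z + Az => /(_ Az) [_]; apply.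
    by have := nbhs_singleton Py; apply.
  - exists (~` interior [set y | A y -> ~ P y]).
      by apply: open_closedC; exact: open_interior.
    apply/seteqP; split => y [Ay Py]; split => //.
      by move=> /nbhs_singleton /(_ Ay).
    apply: contrapT => nPy; apply: Py.
    by have := loc y Ay; apply: filterS => z + Az Pz => /(_ Az) [/(_ Pz)].
by have [] : (A `&` P) x by rewrite AE.
Qed.

Lemma locally_constant (T : topologicalType) (W : Type) (A : set T) (g : T -> W) :
  connected A -> (forall x, A x -> \forall y \near x, A y -> g y = g x) ->
  forall x y, A x -> A y -> g x = g y.
Proof.
move=> cA loc x y Ax Ay; apply: (connected_induction (P := fun z => g z = g y) cA) => //.
  by exists y.
by move=> z /loc; apply: filterS => t gt /gt ->.
Qed.

Section intervals.
Variable R : realType.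

Lemma I01_connected : connected (@I01 R).
Proof. exact: segment_connected. Qed.

Lemma I01E (r : R) : I01 r <-> 0 <= r <= 1.
Proof. by rewrite /I01 /= in_itv. Qed.

(** The points reached from 0 form an open and closed part of [0, 1]; this
    takes the place of subdivisions into small intervals. *)
Lemma interval_induction (T : R -> R -> Prop) :
  (forall a b c, 0 <= a -> a <= b -> b <= c -> c <= 1 -> T a b -> T b c -> T a c) ->
  (forall x, 0 <= x <= 1 -> exists2 eps, 0 < eps & forall a b, 0 <= a -> a <= b ->
     b <= 1 -> x - eps < a -> b < x + eps -> T a b) ->
  T 0 1.
Proof.
move=> glue loc.
pose P (b : R) := forall c, 0 <= c <= b -> T 0 c.
suff : P 1 by apply; rewrite ler01 lexx.
apply: (connected_induction (P := P) I01_connected); last by apply/I01E; rewrite ler01 lexx.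
  exists 0; first by apply/I01E; rewrite lexx ler01.
  move=> c; rewrite -eq_le eq_sym => /eqP ->.
  have [|eps e0] := loc 0; first by rewrite lexx ler01.
  by apply => //; rewrite ?ler01 ?sub0r ?add0r ?oppr_lt0.
move=> x /I01E x01; have [eps e0 H] := loc x x01.
have step (b b' : R) : 0 <= b -> b' <= 1 -> x - eps < b -> b' < x + eps ->
    P b -> P b'.
  move=> b0 b'1 xb b'x Pb c /andP[c0 cb'].
  have [cb|/ltW bc] := leP c b; first by apply: Pb; rewrite c0.
  have c1 := le_trans cb' b'1.
  apply: (glue 0 b c) => //; first by apply: Pb; rewrite b0 lexx.
  by apply: H => //; exact: le_lt_trans b'x.
exists eps => //= y; rewrite /ball /= => xy /I01E /andP[y0 y1].
have [xy1 xy2] : x - eps < y /\ y < x + eps.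
  by move: xy; rewrite ltr_norml; lra.
have /andP[x0 x1] := x01.
split; apply: step => //; lra.
Qed.

Lemma locally_constant_I01 (W : Type) (g : R -> W) :
  (forall r, I01 r -> \forall r' \near r, I01 r' -> g r' = g r) -> g 1 = g 0.
Proof.
move=> loc; apply: (locally_constant I01_connected loc); apply/I01E.
  by rewrite ler01 lexx.
by rewrite lexx ler01.
Qed.

Definition clampI (r : R) : R := Num.min 1 (Num.max 0 r).

Lemma clampI_in r : I01 (clampI r).
Proof. by apply/I01E; rewrite /clampI le_min ler01 le_max lexx ge_min lexx. Qed.

Lemma clampI_le0 r : r <= 0 -> clampI r = 0.
Proof. by move=> r0; rewrite /clampI max_l // min_r // ler01. Qed.

Lemma clampI_ge1 r : 1 <= r -> clampI r = 1.
Proof. by move=> r1; rewrite /clampI max_r ?min_l // (le_trans ler01 r1). Qed.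

Lemma clampI_id r : 0 <= r <= 1 -> clampI r = r.
Proof. by move=> /andP[r0 r1]; rewrite /clampI max_r ?min_r. Qed.

Lemma clampI_continuous : continuous clampI.
Proof.
by move=> r; apply: continuous_min; [exact: cvg_cst|apply: continuous_max;
  [exact: cvg_cst|exact: cvg_id]].
Qed.

End intervals.

Section monodromy.
Variables (R : realType) (V : normedModType R) (A : set V).

(** sec x is a function defined near x, a local primitive of some closed
    datum.  Two of them differ by a local constant wherever both are used:
    this is the cocycle condition, written with differences so that the
    additive constants never appear. *)
Definition compatible (sec : V -> V -> R) (x : V) :=
  \forall y \near x, \forall z \near y,
    sec y z - sec y y = sec x z - sec x y.

Variable sec : V -> V -> R.
Hypothesis compat : forall x, A x -> compatible sec x.

Let box (a b c d : R) : set (R * R) :=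
  [set p | (a <= p.1 <= b) /\ (c <= p.2 <= d)].

(** A primitive of the germs along F.  As F may pass several times through a
    point, it is a function of the parameter and not of the point. *)
Let Prim (F : R * R -> V) (B : set (R * R)) (Psi : R * R -> R) :=
  forall p, B p -> \forall q \near p, B q ->
    Psi q - Psi p = sec (F p) (F q) - sec (F p) (F p).

Lemma prim_local (F : R * R -> V) p :
  {within @I01 R `*` @I01 R, continuous F} ->
  (forall z, (@I01 R `*` @I01 R) z -> A (F z)) -> (@I01 R `*` @I01 R) p ->
  exists2 eps, 0 < eps & forall B, B `<=` (@I01 R `*` @I01 R) ->
    B `<=` [set q | `|p.1 - q.1| < eps /\ `|p.2 - q.2| < eps] ->
    exists Psi, Prim F B Psi.
Proof.
move=> cF FA Ip.
have /subspace_continuousP cF' := cF.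
have : \forall q \near p, (@I01 R `*` @I01 R) q -> \forall z \near F q,
    sec (F q) z - sec (F q) (F q) = sec (F p) z - sec (F p) (F q).
  exact: (cF' p Ip _ (compat (FA _ Ip))).
move=> /(nbhs_ballP p) [eps /= e0 H]; exists eps => // B BI Bp.
exists (fun q => sec (F p) (F q)) => q Bq.
have Hq : ball p eps q by have [] := Bp _ Bq; split.
apply: (filterS _ (near_within (cF' q (BI _ Bq)) (H _ Hq (BI _ Bq)))) => q' + Bq'.
by move=> /(_ (BI _ Bq')) ->.
Qed.

Lemma prim_swap F a b c d Psi : Prim F (box a b c d) Psi ->
  Prim (fun q => F (q.2, q.1)) (box c d a b) (fun q => Psi (q.2, q.1)).
Proof.
move=> HP [p1 p2] [/= P1 P2].
have [] := HP (p2, p1); first by split.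
move=> [Q1 Q2] [/= n1 n2] Q; exists (Q2, Q1) => //= -[q1 q2] [/= q1Q q2Q] [/= B1 B2].
by apply: (Q (q2, q1)).
Qed.

(** On the common side, which is connected, the two primitives differ by a
    constant, and this constant is added to the second one. *)
Lemma prim_glue F a b c d1 d2 Psi1 Psi2 : a <= b -> b <= c -> d1 <= d2 ->
  Prim F (box a b d1 d2) Psi1 -> Prim F (box b c d1 d2) Psi2 ->
  exists Psi, Prim F (box a c d1 d2) Psi.
Proof.
move=> ab bc d12 H1 H2.
have edge y : d1 <= y <= d2 ->
    Psi1 (b, y) - Psi2 (b, y) = Psi1 (b, d1) - Psi2 (b, d1).
  move=> yd.
  apply: (@locally_constant R R `[d1, d2]%classic
    (fun y => Psi1 (b, y) - Psi2 (b, y))).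
  - exact: segment_connected.
  - move=> r /=; rewrite in_itv /= => rd.
    have [] := H1 (b, r); first by split; rewrite //= ab lexx.
    move=> [P1 P2] [/= n1 n2] Q1.
    have [] := H2 (b, r); first by split; rewrite //= bc lexx.
    move=> [P1' P2'] [/= n1' n2'] Q2.
    apply: (filterS _ (filterI n2 n2')) => r' [p2 p2']; rewrite in_itv /= => rd'.
    have E1 := Q1 (b, r'); have E2 := Q2 (b, r').
    have {}E1 := E1 (conj (nbhs_singleton n1) p2).
    have {}E2 := E2 (conj (nbhs_singleton n1') p2').
    rewrite /box /= ab lexx in E1; rewrite /box /= bc lexx in E2.
    by have := E1 (conj isT rd'); have := E2 (conj isT rd'); lra.
  - by rewrite /= in_itv.
  - by rewrite /= in_itv /= lexx.
set k := Psi1 (b, d1) - Psi2 (b, d1) in edge.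
exists (fun q => if q.1 <= b then Psi1 q else Psi2 q + k).
move=> [p1 p2] [/= /andP[ap1 p1c] pd].
have [p1b|bp1|p1b] := ltgtP p1 b.
- have := H1 (p1, p2); rewrite /box /= ap1 (ltW p1b) => /(_ (conj isT pd)) H.
  have n : \forall q \near (p1, p2), q.1 < b.
    by exists ([set x | x < b], setT) => /=; [split; [exact: lt_nbhsl|exact: filterT]|move=> q []].
  apply: (filterS _ (filterI H n)) => -[q1 q2] /= [Hq qb] [/andP[aq1 q1c] qd].
  by rewrite (ltW qb); apply: Hq; rewrite aq1 (ltW qb).
- have := H2 (p1, p2); rewrite /box /= p1c (ltW bp1) => /(_ (conj isT pd)) H.
  have n : \forall q \near (p1, p2), b < q.1.
    by exists ([set x | b < x], setT) => /=; [split; [by apply: open_nbhs_nbhs; split => //; exact: open_gt|exact: filterT]|move=> q []].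
  apply: (filterS _ (filterI H n)) => -[q1 q2] /= [Hq qb] [/andP[aq1 q1c] qd].
  rewrite leNgt qb /= [LHS](_ : _ = Psi2 (q1, q2) - Psi2 (p1, p2)); last by ring.
  by apply: Hq; rewrite q1c (ltW qb).
rewrite {p1 ap1 p1c}p1b.
have H1' := H1 (b, p2); have H2' := H2 (b, p2).
rewrite /box /= ab lexx in H1'; rewrite /box /= bc lexx in H2'.
have {}H1' := H1' (conj isT pd); have {}H2' := H2' (conj isT pd).
apply: (filterS _ (filterI H1' H2')) => -[q1 q2] /= [Q1 Q2] [/andP[aq1 q1c] qd].
have [q1b|bq1] := leP q1 b; first by apply: Q1; rewrite aq1 q1b.
have E2 := Q2 _; rewrite (ltW bq1) q1c in E2.
have -> : Psi1 (b, p2) = Psi2 (b, p2) + k by have := edge _ pd; lra.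
by rewrite -E2 //; ring.
Qed.

(** Small squares are glued into strips and strips into the unit square; one
    of the two directions of gluing is the other one after a swap. *)
Lemma prim_exists (F : R * R -> V) :
  {within @I01 R `*` @I01 R, continuous F} ->
  (forall z, (@I01 R `*` @I01 R) z -> A (F z)) ->
  exists Psi, Prim F (box 0 1 0 1) Psi.
Proof.
move=> cF FA.
apply: (@interval_induction R (fun a b => exists Psi, Prim F (box a b 0 1) Psi)).
  move=> a b c a0 ab bc c1 [Psi1 H1] [Psi2 H2].
  exact: (prim_glue ab bc ler01 H1 H2).
move=> x x01.
pose T c d := exists2 eps, 0 < eps & forall a b, 0 <= a -> a <= b ->
  b <= 1 -> x - eps < a -> b < x + eps -> exists Psi, Prim F (box a b c d) Psi.
apply: (@interval_induction R T).
  move=> c d e c0 cd de e1 [eps1 e10 H1] [eps2 e20 H2].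
  exists (Num.min eps1 eps2); first by rewrite lt_min e10.
  move=> a b a0 ab b1 xa bx.
  have m1 : Num.min eps1 eps2 <= eps1 by rewrite ge_min lexx.
  have m2 : Num.min eps1 eps2 <= eps2 by rewrite ge_min lexx orbT.
  have [||Psi1 P1] := H1 a b a0 ab b1; [lra|lra|].
  have [||Psi2 P2] := H2 a b a0 ab b1; [lra|lra|].
  have [Psi HP] := prim_glue cd de ab (prim_swap P1) (prim_swap P2).
  exists (fun q => Psi (q.2, q.1)).
  have := prim_swap HP.
  by have -> : (fun q : R * R => F ((q.2, q.1).2, (q.2, q.1).1)) = F
    by apply/funext => -[].
move=> y y01.
have Ixy : (@I01 R `*` @I01 R) (x, y) by split; apply/I01E.
have [eps e0 H] := prim_local cF FA Ixy.
exists eps => // c d c0 cd d1 yc dy; exists eps => // a b a0 ab b1 xa bx.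
apply: H => -[q1 q2] [/= /andP[aq1 q1b] /andP[cq2 q2d]].
  by split; apply/I01E => /=; apply/andP; split; lra.
by split => /=; rewrite ltr_norml; apply/andP; split; lra.
Qed.

Let Prim1 (c : R -> V) (psi : R -> R) :=
  forall r, I01 r -> \forall r' \near r, I01 r' ->
    psi r' - psi r = sec (c r) (c r') - sec (c r) (c r).

Let boxI (p : R * R) : I01 p.1 -> I01 p.2 -> box 0 1 0 1 p.
Proof. by move=> /I01E ? /I01E ?. Qed.

Let I0 : I01 (0 : R). Proof. by apply/I01E; rewrite lexx ler01. Qed.
Let I1 : I01 (1 : R). Proof. by apply/I01E; rewrite ler01 lexx. Qed.

Lemma prim_row F Psi s : I01 s -> Prim F (box 0 1 0 1) Psi ->
  Prim1 (fun r => F (s, r)) (fun r => Psi (s, r)).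
Proof.
move=> Is HP r Ir; have [] := HP (s, r); first exact: boxI.
move=> [P1 P2] [/= n1 n2] Q; apply: filterS n2 => r' p2 Ir'.
by apply: (Q (s, r')); [split => //=; exact: nbhs_singleton|exact: boxI].
Qed.

Lemma prim_col F Psi r : I01 r -> Prim F (box 0 1 0 1) Psi ->
  Prim1 (fun s => F (s, r)) (fun s => Psi (s, r)).
Proof.
move=> Ir HP s Is; have [] := HP (s, r); first exact: boxI.
move=> [P1 P2] [/= n1 n2] Q; apply: filterS n1 => s' p1 Is'.
by apply: (Q (s', r)); [split => //=; exact: nbhs_singleton|exact: boxI].
Qed.

Lemma prim1_exists c : path_in A c -> exists psi, Prim1 c psi.
Proof.
move=> [cc cA].
have [||Psi HP] := @prim_exists (fun z => c z.2).
- by apply: within_comp cc; [move=> z; exact: cvg_snd|move=> z []].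
- by move=> z [_]; exact: cA.
by exists (fun r => Psi (0, r)); exact: prim_row HP.
Qed.

Lemma prim1_unique c c' psi psi' : (forall r, I01 r -> c r = c' r) ->
  Prim1 c psi -> Prim1 c' psi' -> psi 1 - psi 0 = psi' 1 - psi' 0.
Proof.
move=> cc' H H'.
suff : psi 1 - psi' 1 = psi 0 - psi' 0 by lra.
apply: (@locally_constant_I01 R R (fun r => psi r - psi' r)) => r Ir.
apply: (filterS _ (filterI (H r Ir) (H' r Ir))) => r' [P P'] Ir'.
have := P Ir'; have := P' Ir'; rewrite !cc' //; lra.
Qed.

Lemma prim1_cst c psi x : (forall r, I01 r -> c r = x) -> Prim1 c psi -> psi 1 = psi 0.
Proof.
move=> cx H; apply: locally_constant_I01 => r Ir.
by have := H r Ir; apply: filterS => r' P Ir'; have := P Ir'; rewrite !cx //; lra.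
Qed.

Lemma prim1_reparam c psi alpha : continuous alpha ->
  (forall r, I01 r -> I01 (alpha r)) -> Prim1 c psi ->
  Prim1 (fun r => c (alpha r)) (fun r => psi (alpha r)).
Proof.
move=> ca aI H r Ir.
by apply: (filterS _ (near_continuous (ca r) (H _ (aI _ Ir)))) => r' P /aI; exact: P.
Qed.

(** A primitive along the homotopy is constant on the three sides of the square
    that are sent to the base point, so its increment along the fourth side,
    which is the loop, is zero. *)
Lemma loop_zero c psi : simply_connected R A -> path_in A c -> c 0 = c 1 ->
  Prim1 c psi -> psi 1 = psi 0.
Proof.
move=> [_ scA] pc c01 Hpsi.
have [F [cF FA F01 Fr]] := scA c pc c01.
have [Psi HP] := prim_exists cF FA.
have E0 : Psi (1, 0) = Psi (0, 0).
  apply: (@prim1_cst (fun s => F (s, 0)) (fun s => Psi (s, 0)) (c 0)).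
    by move=> s /Fr [].
  exact: prim_col HP.
have E1 : Psi (1, 1) = Psi (0, 1).
  apply: (@prim1_cst (fun s => F (s, 1)) (fun s => Psi (s, 1)) (c 0)).
    by move=> s /Fr [].
  exact: prim_col HP.
have E2 : Psi (1, 1) = Psi (1, 0).
  apply: (@prim1_cst (fun r => F (1, r)) (fun r => Psi (1, r)) (c 0)).
    by move=> r /F01 [].
  exact: prim_row HP.
have := @prim1_unique c (fun r => F (0, r)) psi (fun r => Psi (0, r)).
have -> // : Psi (0, 1) - Psi (0, 0) = 0 by rewrite -E1 E2 E0 subrr.
  by move=> /(_ _ Hpsi) H; apply/eqP; rewrite -subr_eq0 H // => [r /F01 []|];
     [move=> ->|exact: prim_row HP].
Qed.

(** The value at x is the increment of a primitive along a chosen path from x0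
    to x.  For z near x, the path to x, the segment from x to z and the path
    from z back to x0 form a loop, along which the increment is zero. *)
Theorem monodromy : open A -> simply_connected R A ->
  exists Psi : V -> R, forall x, A x ->
    \forall z \near x, Psi z - Psi x = sec x z - sec x x.
Proof.
move=> oA scA.
have [[x0 Ax0]|A0] := pselect (exists x, A x); last first.
  by exists (fun _ => 0) => x Ax; case: A0; exists x.
have /choice[c cP] : forall x, exists c : R -> V,
    A x -> [/\ path_in A c, c 0 = x0 & c 1 = x].
  move=> x; have [Ax|nAx] := pselect (A x); last by exists (fun _ => 0).
  by have [c cP] := scA.1 _ _ Ax0 Ax; exists c.
have /choice[psi psiP] : forall x, exists psi, A x -> Prim1 (c x) psi.
  move=> x; have [Ax|nAx] := pselect (A x); last by exists (fun _ => 0).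
  by have [pc _ _] := cP x Ax; have [psi H] := prim1_exists pc; exists psi.
exists (fun x => psi x 1 - psi x 0) => x Ax.
have nA : nbhs x A by exact: open_nbhs_nbhs.
have [dl /= dl0 xdl] := (nbhs_ballP x _).1 (filterI nA (compat Ax)).
apply/(nbhs_ballP x); exists dl => //= z xz.
have Az : A z by have [] := xdl z xz.
have [[ccx cxA] cx0 cx1] := cP x Ax; have [[ccz czA] cz0 cz1] := cP z Az.
(* Each piece of the loop is run on a third of [0, 1], where clampI moves; on
   the other two thirds its term is constant. *)
pose l (r : R) := c x (clampI (3 * r)) + clampI (3 * r - 1) *: (z - x) +
  (c z (clampI (3 - 3 * r)) - z).
have lin (a b : R) : continuous (fun r => a * r + b).
  by move=> r; apply: continuousD; [apply: continuousM; [exact: cvg_cst|exact: cvg_id]|exact: cvg_cst].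
have lin1 : continuous (fun r : R => 3 * r).
  by have := lin 3 0; under eq_fun do rewrite addr0.
have lin2 : continuous (fun r : R => 3 * r - 1) by exact: lin.
have lin3 : continuous (fun r : R => 3 - 3 * r).
  by have := lin (-3) 3; under eq_fun do rewrite addrC mulNr.
have cl (f : R -> R) : continuous f -> continuous (fun r => clampI (f r)).
  by move=> cf r; apply: continuous_comp; [exact: cf|exact: clampI_continuous].
have ccl : {within @I01 R, continuous l}.
  apply: within_add.
    apply: within_add.
      by apply: within_comp ccx; [exact: cl|move=> *; exact: clampI_in].
    by apply: continuous_subspaceT => r; apply: cvgZr_tmp; exact: (cl _ lin2 r).
  apply: within_add.
    by apply: within_comp ccz; [exact: cl|move=> *; exact: clampI_in].
  by apply: continuous_subspaceT => r; exact: cvg_cst.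
have l1 (r : R) : 0 <= r <= 1 / 3 -> l r = c x (3 * r).
  move=> /andP[r0 r1]; rewrite /l (clampI_le0 (r := 3 * r - 1)); last by lra.
  rewrite (clampI_ge1 (r := 3 - 3 * r)); last by lra.
  by rewrite cz1 subrr addr0 scale0r addr0 clampI_id //; lra.
have l2 (r : R) : 1 / 3 <= r <= 2 / 3 -> l r = x + (3 * r - 1) *: (z - x).
  move=> /andP[r0 r1]; rewrite /l (clampI_ge1 (r := 3 * r)); last by lra.
  rewrite (clampI_ge1 (r := 3 - 3 * r)); last by lra.
  by rewrite cz1 cx1 subrr addr0 clampI_id //; lra.
have l3 (r : R) : 2 / 3 <= r <= 1 -> l r = c z (3 - 3 * r).
  move=> /andP[r0 r1]; rewrite /l (clampI_ge1 (r := 3 * r)); last by lra.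
  rewrite (clampI_ge1 (r := 3 * r - 1)); last by lra.
  rewrite cx1 scale1r (addrC x) subrK addrC subrK clampI_id //; lra.
have inb (s : R) : 0 <= s <= 1 -> ball x dl (x + s *: (z - x)).
  move=> /andP[s0 s1]; move: xz; rewrite -ball_normE /= => xz.
  rewrite opprD addNKr normrN normrZ ger0_norm //.
  by apply: le_lt_trans xz; rewrite distrC ler_piMl.
have lA : path_in A l.
  split => // r /I01E /andP[r0 r1].
  have [r13|r13] := leP r (1 / 3).
    by rewrite l1 ?r0 //; apply: cxA; apply/I01E; lra.
  have [r23|r23] := leP r (2 / 3).
    rewrite l2 ?(ltW r13) //.
    have r31 : 0 <= 3 * r - 1 <= 1 by lra.
    by have [] := xdl _ (inb _ r31).
  by rewrite l3 ?(ltW r23) //; apply: czA; apply/I01E; lra.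
have [psil Hl] := prim1_exists lA.
have b0 : 0 <= (0 : R) <= 1 / 3 by lra.
have b1 : 2 / 3 <= (1 : R) <= 1 by lra.
have l01 : l 0 = l 1.
  by rewrite (l1 _ b0) (l3 _ b1) mulr0 mulr1 subrr cx0 cz0.
have loop0 := loop_zero scA lA l01 Hl.
have P1 : psil (1 / 3) - psil 0 = psi x 1 - psi x 0.
  have I (r : R) : I01 r -> I01 (1 / 3 * r + 0) by move=> /I01E Ir; apply/I01E; lra.
  have e (r : R) : I01 r -> l (1 / 3 * r + 0) = c x r.
    move=> /I01E Ir; have Jr : 0 <= 1 / 3 * r + 0 <= 1 / 3 by lra.
    by rewrite (l1 _ Jr); congr (c x _); field.
  have := prim1_unique e (prim1_reparam (lin _ _) I Hl) (psiP x Ax).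
  by rewrite /= !addr0 mulr0 mulr1.
have P3 : psil (2 / 3) - psil 1 = psi z 1 - psi z 0.
  have I (r : R) : I01 r -> I01 (- (1 / 3) * r + 1) by move=> /I01E Ir; apply/I01E; lra.
  have e (r : R) : I01 r -> l (- (1 / 3) * r + 1) = c z r.
    move=> /I01E Ir; have Jr : 2 / 3 <= - (1 / 3) * r + 1 <= 1 by lra.
    by rewrite (l3 _ Jr); congr (c z _); field.
  have := prim1_unique e (prim1_reparam (lin _ _) I Hl) (psiP z Az).
  have -> : - (1 / 3) * 1 + 1 = 2 / 3 :> R by field.
  by rewrite /= mulr0 add0r.
have P2 : psil (2 / 3) - psil (1 / 3) = sec x z - sec x x.
  have I (r : R) : I01 r -> I01 (1 / 3 * r + 1 / 3) by move=> /I01E Ir; apply/I01E; lra.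
  have e (r : R) : I01 r -> l (1 / 3 * r + 1 / 3) = x + r *: (z - x).
    move=> /I01E Ir; have Jr : 1 / 3 <= 1 / 3 * r + 1 / 3 <= 2 / 3 by lra.
    by rewrite (l2 _ Jr); congr (_ + _ *: _); field.
  have Hseg : Prim1 (fun r => x + r *: (z - x)) (fun r => sec x (x + r *: (z - x))).
    move=> r /I01E Ir.
    have [_ Hr] := xdl _ (inb r Ir).
    have cr : continuous (fun r : R => x + r *: (z - x)).
      by move=> ?; apply: cvgD; [exact: cvg_cst|apply: cvgZr_tmp; exact: cvg_id].
    by apply: (filterS _ (near_continuous (cr r) Hr)) => r' /= ->.
  have := prim1_unique e (prim1_reparam (lin _ _) I Hl) Hseg.
  have -> : 1 / 3 * 1 + 1 / 3 = 2 / 3 :> R by field.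
  by rewrite /= mulr0 add0r scale1r scale0r addr0 (addrC x) subrK.
by lra.
Qed.

End monodromy.

(** * The boundary of a bounded simply connected plane domain is connected *)

Section plane.
Variable R : realType.

Lemma space_simply_connected (V : normedModType R) : simply_connected R [set: V].
Proof.
split=> [x y _ _|c [cc _] c01].
  exists (fun r => x + r *: (y - x)); split.
  - split => //; apply: continuous_subspaceT => r.
    by apply: cvgD; [exact: cvg_cst|apply: cvgZr_tmp; exact: cvg_id].
  - by rewrite scale0r addr0.
  - by rewrite scale1r addrC subrK.
exists (fun z => (1 - z.1) *: (c z.2 - c 0) + c 0); split => //.
- apply: within_add; last by apply: continuous_subspaceT => z; exact: cvg_cst.
  have c2 : {within @I01 R `*` @I01 R, continuous (fun z : R * R => c z.2 - c 0)}.
    apply: within_add; last by apply: continuous_subspaceT => z; exact: cvg_cst.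
    by apply: within_comp cc; [move=> z; exact: cvg_snd|move=> z []].
  have c1 : {within @I01 R `*` @I01 R, continuous (fun z : R * R => 1 - z.1)}.
    apply: continuous_subspaceT => z.
    by apply: cvgB; [exact: cvg_cst|exact: cvg_fst].
  apply/subspace_continuousP => z Kz.
  have /subspace_continuousP/(_ z Kz) C1 := c1.
  have /subspace_continuousP/(_ z Kz) C2 := c2.
  exact: cvgZ.
- by move=> s _ /=; rewrite subr0 scale1r subrK subrr scale0r add0r.
- by move=> r _ /=; rewrite subrr -c01 subrr !scaler0 add0r.
Qed.

Lemma coord_le_norm n (x : 'cV[R]_n) i : `|x i 0| <= `|x|.
Proof.
by rewrite [leRHS]/Num.Def.normr /= mx_normrE; apply: (le_bigmax _ _ (i, 0)).
Qed.

Lemma norm_gt_coord n (x : 'cV[R]_n) (rho : R) : 0 <= rho ->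
  rho < `|x| -> exists i, rho < `|x i 0|.
Proof.
move=> rho0 rx; apply: contrapT => H; move: rx; apply/negP; rewrite -leNgt.
rewrite [leLHS]/Num.Def.normr /= mx_normrE; apply: bigmax_le => // -[i j] _ /=.
by rewrite ord1 leNgt; apply/negP => Hi; apply: H; exists i.
Qed.

Lemma near_coord_lt n (x : 'cV[R]_n) i c :
  x i 0 < c -> \forall y \near x, (y : 'cV[R]_n) i 0 < c.
Proof.
move=> xc; apply: (near_continuous (f := fun y : 'cV[R]_n => y i 0 : R)
  (P := fun r => r < c) _ (lt_nbhsl xc)).
exact: coord_continuous.
Qed.

Lemma near_coord_gt n (x : 'cV[R]_n) i c :
  c < x i 0 -> \forall y \near x, c < (y : 'cV[R]_n) i 0.
Proof.
move=> xc; apply: (near_continuous (f := fun y : 'cV[R]_n => y i 0 : R)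
  (P := fun r => c < r) _ (lt_nbhsr xc)).
exact: coord_continuous.
Qed.

Lemma convex_constant (V : normedModType R) (A : set V) (g : V -> R) :
  (forall x y (s : R), A x -> A y -> 0 <= s <= 1 -> A (x + s *: (y - x))) ->
  (forall x, A x -> \forall y \near x, g y = g x) ->
  forall x y, A x -> A y -> g x = g y.
Proof.
move=> cvA loc x y Ax Ay.
have := @locally_constant_I01 R R (fun s => g (x + s *: (y - x))).
rewrite scale1r scale0r addr0 (addrC x) subrK => <- // r /I01E r01.
have cr : continuous (fun r : R => x + r *: (y - x)).
  by move=> ?; apply: cvgD; [exact: cvg_cst|apply: cvgZr_tmp; exact: cvg_id].
have Ar := cvA x y r Ax Ay r01.
by apply: (filterS _ (near_continuous (cr r) (loc _ Ar))) => r' /= ->.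
Qed.

Lemma halfspace_constant n (i : 'I_n) (a s : R) (g : 'cV[R]_n -> R) :
  (forall x : 'cV[R]_n, a < s * x i 0 -> \forall y \near x, g y = g x) ->
  forall x y : 'cV[R]_n, a < s * x i 0 -> a < s * y i 0 -> g x = g y.
Proof.
move=> loc x0 y0 ax0 ay0.
apply: (convex_constant (A := [set x : 'cV[R]_n | a < s * x i 0])) => //=.
move=> x y r ax ay /andP[r0 r1]; rewrite !mxE.
have -> : s * (x i 0 + r * (y i 0 - x i 0)) =
  (1 - r) * (s * x i 0) + r * (s * y i 0) by ring.
have [->|rn1] := eqVneq r 1; first by rewrite subrr mul0r add0r mul1r.
have rl1 : 0 < 1 - r by rewrite subr_gt0 lt_neqAle rn1.
by nra.
Qed.

Lemma col2E0 (u v : R) : col2 u v 0 0 = u. Proof. by rewrite mxE. Qed.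
Lemma col2E1 (u v : R) : col2 u v 1 0 = v. Proof. by rewrite mxE. Qed.

Lemma cv2P (z z' : 'cV[R]_2) : z 0 0 = z' 0 0 -> z 1 0 = z' 1 0 -> z = z'.
Proof.
by move=> E0 E1; apply/matrixP => i j; rewrite ord1; move: i; exact: ord2_ind.
Qed.

(** Four half-planes cover the points of norm greater than rho, and consecutive
    ones meet. *)
Lemma far_constant (g : 'cV[R]_2 -> R) (rho : R) : 0 <= rho ->
  (forall x, rho < `|x| -> \forall z \near x, g z = g x) ->
  forall x y, rho < `|x| -> rho < `|y| -> g x = g y.
Proof.
move=> rho0 loc.
have reg (i : 'I_2) (s : R) : `|s| = 1 ->
    forall x y : 'cV[R]_2, rho < s * x i 0 -> rho < s * y i 0 -> g x = g y.
  move=> s1; apply: halfspace_constant => x Hx; apply: loc.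
  apply: lt_le_trans Hx _; apply: le_trans (ler_norm _) _.
  by rewrite normrM s1 mul1r; exact: coord_le_norm.
have n1 : `|1 : R| = 1 by rewrite normr1.
have nN1 : `|-1 : R| = 1 by rewrite normrN normr1.
pose q (s t : R) : 'cV[R]_2 := col2 (s * (rho + 1)) (t * (rho + 1)).
have q1 : rho < 1 * (1 * (rho + 1)) by lra.
have qN1 : rho < -1 * (-1 * (rho + 1)) by lra.
have E1 : g (q 1 1) = g (q 1 (-1)) by apply: (reg 0 1 n1); rewrite col2E0.
have E2 : g (q (-1) 1) = g (q (-1) (-1)) by apply: (reg 0 (-1) nN1); rewrite col2E0.
have E3 : g (q 1 1) = g (q (-1) 1) by apply: (reg 1 1 n1); rewrite col2E1.
have E4 x : rho < `|x| -> g x = g (q 1 1).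
  move=> /(norm_gt_coord rho0) [i]; rewrite ltr_normr => /orP[] Hx.
    have i01 : i = 0 \/ i = 1.
      by case: i {Hx} => -[|[|//]] p; [left|right]; exact/val_inj.
    have {}Hx : rho < 1 * x i 0 by rewrite mul1r.
    case: i01 Hx => -> Hx.
      by apply: (reg 0 1 n1) => //; rewrite col2E0.
    by apply: (reg 1 1 n1) => //; rewrite col2E1.
  have {}Hx : rho < -1 * x i 0 by rewrite mulN1r.
  have i01 : i = 0 \/ i = 1.
    by case: i {Hx} => -[|[|//]] p; [left|right]; exact/val_inj.
  case: i01 Hx => -> Hx.
    by rewrite E3; apply: (reg 0 (-1) nN1) => //; rewrite col2E0.
  by rewrite E1; apply: (reg 1 (-1) nN1) => //; rewrite col2E1.
by move=> x y Hx Hy; rewrite (E4 x) // (E4 y).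
Qed.

Lemma near_near (T : topologicalType) (x : T) (P : T -> Prop) :
  (\forall y \near x, P y) -> \forall y \near x, \forall z \near y, P z.
Proof. by move=> /nbhs_interior. Qed.

Lemma near_out (T : topologicalType) (D : set T) x : ~ closure D x -> \forall z \near x, ~ D z.
Proof.
move=> nc; have : \forall z \near x, (~` closure D) z.
  by apply: open_nbhs_nbhs; split => //; apply: closed_openC; exact: closed_closure.
by apply: filterS => z nz Dz; apply: nz; exact: subset_closure.
Qed.

Lemma frontierE (T : topologicalType) (D : set T) x :
  open D -> frontier D x <-> closure D x /\ ~ D x.
Proof. by move=> oD; rewrite /frontier (interior_id D).1. Qed.

(** Integer-valued germs of the angle around a: the indicator of the upper
    half plane to the right of a, a constant elsewhere.  They are compatible
    away from a, and a global choice of them jumps by 1 along a loop around a. *)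
Definition up (a : 'cV[R]_2) (z : 'cV[R]_2) : R := (a 1 0 <= z 1 0)%R%:R.
Definition angle_germ (a x : 'cV[R]_2) : 'cV[R]_2 -> R :=
  if a 0 0 < x 0 0 then up a else (fun _ => 0).

Lemma up_near (a z : 'cV[R]_2) : z 1 0 != a 1 0 -> \forall y \near z, up a y = up a z.
Proof.
rewrite neq_lt => /orP[za|az].
  have := near_coord_lt za; apply: filterS => y ya.
  by rewrite /up !leNgt ya za.
have := near_coord_gt az; apply: filterS => y ya.
by rewrite /up (ltW ya) (ltW az).
Qed.

Lemma angle_germ_translate (a x z : 'cV[R]_2) :
  angle_germ a (x + a) (z + a) = angle_germ 0 x z.
Proof.
rewrite /angle_germ.
have -> : (a 0 0 < (x + a) 0 0) = ((0 : 'cV[R]_2) 0 0 < x 0 0).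
  by rewrite !mxE ltrDr.
by case: ifP => // _; rewrite /up !mxE lerDr.
Qed.

Lemma angle_germ_compatible (a x : 'cV[R]_2) : x != a -> compatible (angle_germ a) x.
Proof.
move=> xa; have [ax|xa0|x0] := ltgtP (a 0 0) (x 0 0).
- have := near_coord_gt ax; apply: filterS => y ay.
  by near=> z; rewrite /angle_germ ax ay.
- have := near_coord_lt xa0; apply: filterS => y ya.
  by near=> z; rewrite /angle_germ !ltNge (ltW ya) (ltW xa0).
have x1 : x 1 0 != a 1 0.
  by apply/eqP => x1; move/eqP: xa; apply; exact: cv2P.
have H : \forall y \near x, (y : 'cV[R]_2) 1 0 != a 1 0.
  move: x1; rewrite neq_lt => /orP[za|az].
    by have := near_coord_lt za; apply: filterS => y ya; rewrite lt_eqF.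
  by have := near_coord_gt az; apply: filterS => y ya; rewrite gt_eqF.
apply: filterS H => y /up_near; apply: filterS => z uz.
by rewrite /angle_germ x0 ltxx; case: ifP => _; rewrite ?uz !subrr.
Unshelve. all: by end_near. Qed.

(** Were there a hole a, the angle around a would have a global branch on D;
    using it to switch off the angle near the hole gives germs compatible on
    the whole plane, whose global primitive cannot jump far away. *)
Lemma no_hole (D N N' : set 'cV[R]_2) (a : 'cV[R]_2) (rho : R) :
  open D -> simply_connected R D -> open N -> open N' ->
  (forall x, N x -> N' x -> False) -> (forall x, ~ D x -> N x \/ N' x) ->
  ~ D a -> N a -> 0 <= rho -> (forall x, rho < `|x - a| -> ~ D x /\ N' x) -> False.
Proof.
move=> oD scD oN oN' NN' cov Da Na rho0 far.
have neqa x : N' x -> x != a.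
  by move=> N'x; apply/eqP => xa; apply: (NN' a Na); rewrite -xa.
have [Th ThP] : exists Th : 'cV[R]_2 -> R, forall x, D x ->
    \forall z \near x, Th z - Th x = angle_germ a x z - angle_germ a x x.
  apply: monodromy => // x Dx; apply: angle_germ_compatible.
  by apply/eqP => xa; apply: Da; rewrite -xa.
pose tau z := if pselect (N z) then 0 else Th z.
pose sec x := if pselect (D x) then tau else
  if pselect (N x) then (fun _ => 0) else angle_germ a x.
have tauN z : N z -> tau z = 0 by rewrite /tau; case: pselect.
have tauN' z : N' z -> tau z = Th z.
  by rewrite /tau; case: pselect => // Nz N'z; case: (NN' z).
have nD z : D z -> nbhs z D by move=> ?; exact: open_nbhs_nbhs.
have nN z : N z -> nbhs z N by move=> ?; exact: open_nbhs_nbhs.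
have nN' z : N' z -> nbhs z N' by move=> ?; exact: open_nbhs_nbhs.
have secD x : D x -> sec x = tau by rewrite /sec; case: pselect.
have secN x : ~ D x -> N x -> sec x = fun _ => 0.
  by rewrite /sec; case: pselect => // ?; case: pselect.
have secN' x : ~ D x -> N' x -> sec x = angle_germ a x.
  rewrite /sec; case: pselect => // ?; case: pselect => // Nx ? N'x.
  by case: (NN' x).
have csec x : [set: 'cV[R]_2] x -> compatible sec x.
  move=> _; have [Dx|nDx] := pselect (D x).
    by apply: filterS (nD x Dx) => y Dy; rewrite (secD x) // (secD y) //; exact: filterE.
  have [Nx|N'x] := cov x nDx.
    apply: filterS (nN x Nx) => y Ny; rewrite (secN x) //.
    have [Dy|nDy] := pselect (D y); last by rewrite (secN y) //; exact: filterE.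
    by apply: filterS (nN y Ny) => z Nz; rewrite (secD y) // !tauN.
  apply: filterS2 (nN' x N'x) (angle_germ_compatible (neqa x N'x)) => y N'y Hy.
  rewrite (secN' x) //.
  have [Dy|nDy] := pselect (D y); last by rewrite (secN' y).
  apply: filterS3 (nN' y N'y) Hy (ThP y Dy) => z N'z Hz Tz.
  by rewrite (secD y) // !tauN' // Tz.
have [Psi PsiP] := monodromy csec openT (space_simply_connected _).
have Psifar x : rho < `|x - a| ->
    \forall z \near x, Psi z - Psi x = angle_germ a x z - angle_germ a x x.
  by move=> /far [nDx N'x]; rewrite -secN' //; exact: PsiP.
pose g z := Psi (z + a).
have ga (z : 'cV[R]_2) : rho < `|z| ->
    \forall y \near z, g y - g z = angle_germ 0 z y - angle_germ 0 z z.
  move=> Hz.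
  have H : \forall y \near z + a, Psi y - Psi (z + a) =
      angle_germ a (z + a) y - angle_germ a (z + a) (z + a).
    by apply: Psifar; rewrite addrK.
  have ct : (fun y : 'cV[R]_2 => y + a) @ z --> z + a.
    exact: (cvgD (@cvg_id _ (nbhs z)) (cvg_cst (F := nbhs z) a)).
  apply: (filterS _ (near_continuous ct H)) => y; rewrite /g => ->.
  by rewrite !angle_germ_translate.
have reg (i : 'I_2) (s : R) (x : 'cV[R]_2) : `|s| = 1 -> rho < s * x i 0 -> rho < `|x|.
  move=> s1 Hx.
  apply: lt_le_trans Hx _; apply: le_trans (ler_norm _) _.
  by rewrite normrM s1 mul1r; exact: coord_le_norm.
have n1 : `|1 : R| = 1 by rewrite normr1.
have nN1 : `|-1 : R| = 1 by rewrite normrN normr1.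
have vert (s : R) (x : 'cV[R]_2) : `|s| = 1 -> rho < s * x 1 0 -> \forall y \near x, g y = g x.
  move=> s1 Hx; have x10 : x 1 0 != (0 : 'cV[R]_2) 1 0.
    by rewrite mxE; apply/eqP => x10; move: Hx; rewrite x10 mulr0 ltNge rho0.
  apply: filterS2 (ga x (reg _ _ _ s1 Hx)) (up_near x10) => y + uy.
  rewrite /angle_germ; case: ifP => _; rewrite ?uy subrr => /eqP.
    by rewrite subr_eq0 => /eqP.
  by rewrite subr_eq0 => /eqP.
have left (x : 'cV[R]_2) : rho < -1 * x 0 0 -> \forall y \near x, g y = g x.
  move=> Hx; apply: filterS (ga x (reg _ _ _ nN1 Hx)) => y.
  have -> : angle_germ 0 x = fun _ => 0.
    by rewrite /angle_germ mxE; case: ifP => // x0; exfalso; lra.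
  by rewrite subrr => /eqP; rewrite subr_eq0 => /eqP.
have right (x : 'cV[R]_2) : rho < 1 * x 0 0 ->
    \forall y \near x, g y - up 0 y = g x - up 0 x.
  move=> Hx; apply: filterS (ga x (reg _ _ _ n1 Hx)) => y.
  have -> : angle_germ 0 x = up 0.
    rewrite /angle_germ mxE; case: ifP => // /negbT; rewrite -leNgt => x0.
    by exfalso; lra.
  lra.
pose q (s t : R) : 'cV[R]_2 := col2 (s * (rho + 1)) (t * (rho + 1)).
have q1 : rho < 1 * (1 * (rho + 1)) by lra.
have qN1 : rho < -1 * (-1 * (rho + 1)) by lra.
have E1 : g (q 1 1) = g (q (-1) 1).
  apply: (@halfspace_constant 2 1 rho 1) => //; rewrite ?col2E1 // => x.
  exact: vert.
have E2 : g (q (-1) 1) = g (q (-1) (-1)).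
  by apply: (@halfspace_constant 2 0 rho (-1)) => //; rewrite ?col2E0.
have E3 : g (q (-1) (-1)) = g (q 1 (-1)).
  apply: (@halfspace_constant 2 1 rho (-1)) => //; rewrite ?col2E1 // => x.
  exact: vert.
have E4 : g (q 1 1) - up 0 (q 1 1) = g (q 1 (-1)) - up 0 (q 1 (-1)).
  apply: (@halfspace_constant 2 0 rho 1 (fun z => g z - up 0 z)) => //; rewrite ?col2E0 //.
have u1 : up 0 (q 1 1) = 1.
  by rewrite /up col2E1 mxE (_ : (0 <= _)%R = true) //; apply/idP; lra.
have u2 : up 0 (q 1 (-1)) = 0.
  by rewrite /up col2E1 mxE (_ : (0 <= _)%R = false) //; apply/negbTE; rewrite -ltNge; lra.
lra.
Qed.

Lemma closure_near (T : topologicalType) (D : set T) (x : T) (P : T -> Prop) :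
  closure D x -> (\forall z \near x, D z -> P z) -> exists2 z, D z & P z.
Proof. by move=> cD /cD [z [Dz Pz]]; exists z => //; exact: Pz. Qed.

(** Near a boundary point where f tends to 0, take f extended by 0 outside D;
    near one where f tends to 1, take f - 1 extended by 0.  These germs are
    compatible on the whole plane.  Their primitive is f on D and is locally
    constant outside D, with the values 0 and 1 at the two kinds of boundary
    points, so it splits the complement of D in two, and far away it is
    constant: one of the two parts is bounded, which no_hole excludes. *)
Theorem boundary_dichotomy (D : set 'cV[R]_2) (f : 'cV[R]_2 -> R) (p q : 'cV[R]_2) :
  domain D -> bounded_set D -> simply_connected R D ->
  (forall x, D x -> {for x, continuous f}) ->
  (forall x, frontier D x -> f @ within D (nbhs x) --> (0 : R) \/
                             f @ within D (nbhs x) --> (1 : R)) ->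
  frontier D p -> f @ within D (nbhs p) --> (0 : R) ->
  frontier D q -> f @ within D (nbhs q) --> (1 : R) -> False.
Proof.
move=> [_ oD cD] bD scD cf fr Fp fp Fq fq.
have frE (x : 'cV[R]_2) := frontierE x oD.
have nfr x : ~ D x -> closure D x -> frontier D x by move=> *; apply/frE.
have near0 (x : 'cV[R]_2) : f @ within D (nbhs x) --> (0 : R) ->
    \forall z \near x, D z -> f z < 1 / 3.
  have t0 : (0 : R) < 1 / 3 by lra.
  by move=> H; exact: (H [set r : R | r < 1 / 3] (lt_nbhsl t0)).
have near1 (x : 'cV[R]_2) : f @ within D (nbhs x) --> (1 : R) ->
    \forall z \near x, D z -> 2 / 3 < f z.
  have t1 : 2 / 3 < (1 : R) by lra.
  by move=> H; exact: (H [set r : R | 2 / 3 < r] (lt_nbhsr t1)).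
have excl (x : 'cV[R]_2) : closure D x -> (\forall z \near x, D z -> f z < 1 / 3) ->
    (\forall z \near x, D z -> 2 / 3 < f z) -> False.
  move=> cx H0 H1.
  have [|z _ []] := @closure_near _ D x (fun z => f z < 1 / 3 /\ 2 / 3 < f z) cx.
    by apply: filterS2 H0 H1 => z + + Dz => /(_ Dz) ? /(_ Dz).
  lra.
pose to0 (x : 'cV[R]_2) := f @ within D (nbhs x) --> (0 : R).
pose f0 z := if pselect (D z) then f z else 0.
pose f1 z := if pselect (D z) then f z - 1 else 0.
have f0D z : D z -> f0 z = f z by rewrite /f0; case: pselect.
have f1D z : D z -> f1 z = f z - 1 by rewrite /f1; case: pselect.
have f0N z : ~ D z -> f0 z = 0 by rewrite /f0; case: pselect.
have f1N z : ~ D z -> f1 z = 0 by rewrite /f1; case: pselect.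
pose sec x := if pselect (D x) then f else if pselect (to0 x) then f0 else f1.
have secD x : D x -> sec x = f by rewrite /sec; case: pselect.
have sec0 x : ~ D x -> to0 x -> sec x = f0.
  by rewrite /sec; case: pselect => // ?; case: pselect.
have sec1 x : ~ D x -> ~ to0 x -> sec x = f1.
  by rewrite /sec; case: pselect => // ?; case: pselect.
have nD z : D z -> nbhs z D by move=> ?; exact: open_nbhs_nbhs.
have n1 x : ~ D x -> ~ to0 x -> \forall z \near x, D z -> 2 / 3 < f z.
  move=> nDx n0; have [cx|ncx] := pselect (closure D x).
    by apply: near1; have [] := fr x (nfr x nDx cx).
  by apply: filterS (near_out ncx).
have csec x : [set: 'cV[R]_2] x -> compatible sec x.
  move=> _; have [Dx|nDx] := pselect (D x).
    by apply: filterS (nD x Dx) => y Dy; rewrite (secD x) // (secD y) //; exact: filterE.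
  have [t0|nt0] := pselect (to0 x).
    have H0 := near_near (near0 x t0).
    apply: filterS H0 => y Hy; rewrite (sec0 x) //.
    have [Dy|nDy] := pselect (D y).
      by rewrite (secD y) //; apply: filterS (nD y Dy) => z Dz; rewrite !f0D.
    have [ty|nty] := pselect (to0 y); first by rewrite (sec0 y) //; exact: filterE.
    rewrite (sec1 y) //; have [cy|ncy] := pselect (closure D y).
      by case: (excl y cy Hy); exact: n1.
    by apply: filterS (near_out ncy) => z nDz; rewrite !f0N // !f1N.
  have H1 := near_near (n1 x nDx nt0).
  apply: filterS H1 => y Hy; rewrite (sec1 x) //.
  have [Dy|nDy] := pselect (D y).
    rewrite (secD y) //; apply: filterS (nD y Dy) => z Dz; rewrite !f1D //; ring.
  have [ty|nty] := pselect (to0 y); last by rewrite (sec1 y) //; exact: filterE.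
  rewrite (sec0 y) //; have [cy|ncy] := pselect (closure D y).
    by case: (excl y cy _ Hy); exact: near0.
  by apply: filterS (near_out ncy) => z nDz; rewrite !f0N // !f1N.
have [Psi0 Psi0P] := monodromy csec openT (space_simply_connected _).
have [x0 Dx0] : exists x, D x.
  have [cp _] := (frE p).1 Fp.
  by have [|z Dz _] := closure_near (P := fun _ => True) cp; [exact: filterE|exists z].
pose Psi z := Psi0 z - (Psi0 x0 - f x0).
have PsiP x : \forall z \near x, Psi z - Psi x = sec x z - sec x x.
  by have := Psi0P x I; apply: filterS => z <-; rewrite /Psi; ring.
have PsiD x : D x -> Psi x = f x.
  move=> Dx; suff : Psi0 x - f x = Psi0 x0 - f x0 by rewrite /Psi; lra.
  apply: (locally_constant (g := fun x => Psi0 x - f x) cD _ Dx Dx0) => {Dx}x Dx.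
  by have := Psi0P x I; apply: filterS => z; rewrite (secD x) // => ? _; lra.
have secNx x : ~ D x -> sec x x = 0.
  move=> nDx; have [t|nt] := pselect (to0 x); first by rewrite sec0 // f0N.
  by rewrite sec1 // f1N.
have PsiN x : ~ D x -> \forall z \near x, ~ D z -> Psi z = Psi x.
  move=> nDx; apply: filterS (PsiP x) => z Hz nDz; move: Hz.
  rewrite secNx // subr0; have [t|nt] := pselect (to0 x).
    by rewrite sec0 // f0N //; lra.
  by rewrite sec1 // f1N //; lra.
have Psi0F x : ~ D x -> closure D x -> to0 x -> Psi x = 0.
  move=> nDx cx t.
  have [|z Dz] := closure_near (P := fun z => Psi z - Psi x = f z) cx.
    by apply: filterS (PsiP x) => z + Dz; rewrite secNx // sec0 // f0D // subr0.
  by rewrite PsiD //; lra.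
have Psi1F x : ~ D x -> closure D x -> ~ to0 x -> Psi x = 1.
  move=> nDx cx t.
  have [|z Dz] := closure_near (P := fun z => Psi z - Psi x = f z - 1) cx.
    by apply: filterS (PsiP x) => z + Dz; rewrite secNx // sec1 // f1D // subr0.
  by rewrite PsiD //; lra.
(* Open disjoint neighbourhoods of the two parts of the complement of D. *)
pose N := [set z | (D z /\ 2 / 3 < f z) \/ (~ D z /\ Psi z = 1)].
pose N' := [set z | (D z /\ f z < 1 / 3) \/ (~ D z /\ Psi z <> 1)].
have oN : open N.
  rewrite openE => z [[Dz fz]|[nDz Pz]].
    apply: filterS2 (nD z Dz) (near_continuous (cf z Dz) (lt_nbhsr fz)) => w Dw fw.
    by left.
  have H : \forall w \near z, D w -> 2 / 3 < f w.
    have [cz|ncz] := pselect (closure D z); last by apply: filterS (near_out ncz).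
    by apply: n1 => // t0; have := Psi0F z nDz cz t0; rewrite Pz => /eqP; rewrite oner_eq0.
  apply: filterS2 H (PsiN z nDz) => w Hw Pw.
  have [Dw|nDw] := pselect (D w); first by left; split => //; exact: Hw.
  by right; split => //; rewrite Pw.
have oN' : open N'.
  rewrite openE => z [[Dz fz]|[nDz Pz]].
    apply: filterS2 (nD z Dz) (near_continuous (cf z Dz) (lt_nbhsl fz)) => w Dw fw.
    by left.
  have H : \forall w \near z, D w -> f w < 1 / 3.
    have [cz|ncz] := pselect (closure D z); last by apply: filterS (near_out ncz).
    apply: near0; have [//|nt] := pselect (to0 z).
    by case: Pz; exact: Psi1F.
  apply: filterS2 H (PsiN z nDz) => w Hw Pw.
  have [Dw|nDw] := pselect (D w); first by left; split => //; exact: Hw.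
  by right; split => //; rewrite Pw.
have NN' x : N x -> N' x -> False.
  by case=> -[Dx Hx] [[Dx' Hx']|[Dx' Hx']] //; lra.
have cov x : ~ D x -> N x \/ N' x.
  by move=> nDx; have [e|e] := pselect (Psi x = 1); [left; right|right; right].
have [cp nDp] := (frE p).1 Fp; have [cq nDq] := (frE q).1 Fq.
have N'p : N' p.
  by right; split => //; rewrite Psi0F // => /esym /eqP; rewrite oner_eq0.
have Nq : N q.
  right; split => //; apply: Psi1F => // t0.
  by apply: (excl q) => //; [exact: near0|exact: near1].
have [M [M0 DM]] : exists M : R, 0 <= M /\ forall x, D x -> `|x| <= M.
  have [M [Mr HM]] := bD.
  exists (Num.max 0 (M + 1)); split; first by rewrite le_max lexx.
  move=> x Dx; rewrite le_max; apply/orP; right; apply: HM => //.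
  by rewrite ltrDl.
have farD x : M < `|x| -> ~ D x by move=> Mx /DM; rewrite leNgt Mx.
have Pfar x y : M < `|x| -> M < `|y| -> Psi x = Psi y.
  apply: (far_constant M0) => {x y}x Mx.
  have nx : \forall z \near x, M < `|z|.
    exact: (near_continuous (f := fun z : 'cV[R]_2 => `|z|)
      (P := fun r => M < r) (@norm_continuous _ _ x) (lt_nbhsr Mx)).
  by apply: filterS2 (PsiN x (farD x Mx)) nx => z H /farD /H.
pose w : 'cV[R]_2 := col2 (M + 1) 0.
have Mw : M < `|w|.
  by apply: lt_le_trans (coord_le_norm w 0); rewrite col2E0 ger0_norm; lra.
have tr (a x : 'cV[R]_2) : M + `|a| < `|x - a| -> M < `|x|.
  move=> H; rewrite -(ltrD2r `|a|); apply: lt_le_trans H _; exact: ler_normB.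
have [Pw|Pw] := pselect (Psi w = 1).
  apply: (@no_hole D N' N p (M + `|p|)) => //.
  - by move=> x N'x Nx; exact: (NN' x).
  - by move=> x /cov [|]; [right|left].
  - by rewrite addr_ge0.
  - move=> x /tr Mx; split; first exact: farD.
    by right; split; [exact: farD|rewrite (Pfar x w)].
apply: (@no_hole D N N' q (M + `|q|)) => //.
- by rewrite addr_ge0.
- move=> x /tr Mx; split; first exact: farD.
  by right; split; [exact: farD|rewrite (Pfar x w)].
Qed.

End plane.

(** * Closed fields on a simply connected plane set are gradients *)

Section plane_points.
Variable R : realType.
Implicit Types (z : 'cV[R]_2) (u s : R).

Definition e0 : 'cV[R]_2 := delta_mx 0 0.
Definition e1 : 'cV[R]_2 := delta_mx 1 0.

Lemma col2_coord z : z = col2 (z 0 0) (z 1 0).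
Proof. by apply: cv2P; rewrite ?col2E0 ?col2E1. Qed.

Lemma col2_shift0 u u' s : col2 u s + u' *: e0 = col2 (u + u') s.
Proof. by apply: cv2P; rewrite !mxE /= ?mulr1 ?mulr0 ?addr0. Qed.

Lemma col2_shift1 u s s' : col2 u s + s' *: e1 = col2 u (s + s').
Proof. by apply: cv2P; rewrite !mxE /= ?mulr1 ?mulr0 ?addr0. Qed.

Lemma ball_col2 z (r : R) u s :
  `|z 0 0 - u| < r -> `|z 1 0 - s| < r -> ball z r (col2 u s).
Proof.
move=> H0 H1; split; first exact: le_lt_trans H0.
by move=> i j; rewrite ord1; move: i; apply: ord2_ind; rewrite mxE.
Qed.

Lemma is_derive_col0 (f : 'cV[R]_2 -> R) u s d :
  is_derive (col2 u s) e0 f d <-> is_derive u 1 (fun r => f (col2 r s)) d.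
Proof.
have -> : (fun r => f (col2 r s)) = (fun r => f (col2 0 s + r *: e0)).
  by apply/funext => r; rewrite col2_shift0 add0r.
rewrite (_ : col2 u s = col2 0 s + u *: e0); first exact: is_derive_line.
by rewrite col2_shift0 add0r.
Qed.

Lemma is_derive_col1 (f : 'cV[R]_2 -> R) u s d :
  is_derive (col2 u s) e1 f d <-> is_derive s 1 (fun r => f (col2 u r)) d.
Proof.
have -> : (fun r => f (col2 u r)) = (fun r => f (col2 u 0 + r *: e1)).
  by apply/funext => r; rewrite col2_shift1 add0r.
rewrite (_ : col2 u s = col2 u 0 + s *: e1); first exact: is_derive_line.
by rewrite col2_shift1 add0r.
Qed.

Lemma continuous_col0 (f : 'cV[R]_2 -> R) u s : {for col2 u s, continuous f} ->
  {for u, continuous (fun r => f (col2 r s))}.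
Proof.
have -> : (fun r => f (col2 r s)) = (fun r => f (col2 0 s + r *: e0)).
  by apply/funext => r; rewrite col2_shift0 add0r.
move=> cf; apply: (@continuous_comp _ _ _ (fun r : R => col2 0 s + r *: e0) f).
  by apply: cvgD; [exact: cvg_cst|apply: cvgZr_tmp; exact: cvg_id].
by rewrite col2_shift0 add0r.
Qed.

Lemma continuous_col1 (f : 'cV[R]_2 -> R) u s : {for col2 u s, continuous f} ->
  {for s, continuous (fun r => f (col2 u r))}.
Proof.
have -> : (fun r => f (col2 u r)) = (fun r => f (col2 u 0 + r *: e1)).
  by apply/funext => r; rewrite col2_shift1 add0r.
move=> cf; apply: (@continuous_comp _ _ _ (fun r : R => col2 u 0 + r *: e1) f).
  by apply: cvgD; [exact: cvg_cst|apply: cvgZr_tmp; exact: cvg_id].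
by rewrite col2_shift1 add0r.
Qed.

End plane_points.

Section poincare.
Variable R : realType.
Notation mu := (@lebesgue_measure R).
Notation e0 := (e0 R).
Notation e1 := (e1 R).

Lemma itv_continuous_integrable (f : R -> R) (a b : R) :
  (forall t, a <= t <= b -> {for t, continuous f}) ->
  mu.-integrable `[a, b]%classic (EFin \o f) /\ {within `[a, b], continuous f}.
Proof.
move=> cf.
have wf : {within `[a, b]%classic, continuous f}.
  apply: continuous_in_subspaceT => t /set_mem /=; rewrite in_itv /=; exact: cf.
by split => //; apply: continuous_compact_integrable => //; exact: segment_compact.
Qed.

(** Integrate along the horizontal, then the vertical side of a rectangle;
    the horizontal derivative of the second integral is computed under the
    integral sign, and closedness turns it into a boundary term. *)
Lemma local_potential (g0 g1 : 'cV[R]_2 -> R) (x : 'cV[R]_2) (r M : R) : 0 < r ->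
  (forall z, ball x r z -> [/\ derivable g0 z e1, derivable g1 z e0,
     'D_e1 g0 z = 'D_e0 g1 z & `|'D_e0 g1 z| <= M]) ->
  (forall z, ball x r z -> [/\ {for z, continuous g0}, {for z, continuous g1} &
     {for z, continuous ('D_e1 g0)}]) ->
  exists psi : 'cV[R]_2 -> R, forall z, ball x (r / 2) z ->
    is_derive z e0 psi (g0 z) /\ is_derive z e1 psi (g1 z).
Proof.
move=> r0 dg cg.
pose b0 := x 0 0 - r / 2; pose b1 := x 1 0 - r / 2.
pose c0 := x 0 0 + r / 2; pose c1 := x 1 0 + r / 2.
have inb u s : b0 <= u <= c0 -> b1 <= s <= c1 -> ball x r (col2 u s).
  rewrite /b0 /b1 /c0 /c1 => Hu Hs; apply: ball_col2; rewrite ltr_norml; lra.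
pose psi (z : 'cV[R]_2) := \int[mu]_(t in `[b0, z 0 0]) g0 (col2 t b1) +
              \int[mu]_(t in `[b1, z 1 0]) g1 (col2 (z 0 0) t).
have b1b1 : b1 <= b1 <= c1 by rewrite /b1 /c1; lra.
exists psi => z xz.
have [_ Hz] := xz; have H0 := Hz 0 0; have H1 := Hz 1 0.
rewrite /ball /= !ltr_norml in H0 H1.
set u := z 0 0 in H0; set s := z 1 0 in H1.
have [bu uc] : b0 < u /\ u < c0 by rewrite /b0 /c0; lra.
have [bs sc] : b1 < s /\ s < c1 by rewrite /b1 /c1; lra.
have ub : b0 <= u <= c0 by lra.
have zE : z = col2 u s by exact: col2_coord.
split; last first.
  rewrite {1}zE; apply/is_derive_col1.
  have -> : (fun t => psi (col2 u t)) =
      (fun _ => \int[mu]_(t in `[b0, u]) g0 (col2 t b1)) +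
      (fun t => \int[mu]_(t' in `[b1, t]) g1 (col2 u t')).
    by apply/funext => t; rewrite /psi !col2E0 !col2E1.
  have [|intg _] := @itv_continuous_integrable (fun t => g1 (col2 u t)) b1 c1.
    by move=> t Ht; apply: continuous_col1; have [] := cg _ (inb _ _ ub Ht).
  have cgs : {for s, continuous (fun t => g1 (col2 u t))}.
    have ss : b1 <= s <= c1 by lra.
    by apply: continuous_col1; have [] := cg _ (inb _ _ ub ss).
  have [d1 d2] := continuous_FTC1_closed sc intg bs cgs.
  rewrite zE -[g1 _]add0r; apply: is_deriveD.
  by apply: (DeriveDef d1); rewrite -derive1E; exact: d2.
rewrite {1}zE; apply/is_derive_col0.
have -> : (fun t => psi (col2 t s)) =
    (fun u' => \int[mu]_(t in `[b0, u']) g0 (col2 t b1)) +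
    (fun u' => \int[mu]_(t in `[b1, s]) g1 (col2 u' t)).
  by apply/funext => t; rewrite /psi !col2E0 !col2E1.
have [|intg0 _] := @itv_continuous_integrable (fun t => g0 (col2 t b1)) b0 c0.
  by move=> t Ht; apply: continuous_col0; have [] := cg _ (inb _ _ Ht b1b1).
have cg0 : {for u, continuous (fun t => g0 (col2 t b1))}.
  by apply: continuous_col0; have [] := cg _ (inb _ _ ub b1b1).
have [d1 d2] := continuous_FTC1_closed uc intg0 bu cg0.
have sb t : b1 <= t <= s -> b1 <= t <= c1 by lra.
have mB : measurable (`[b1, s]%classic : set (measurableTypeR R)) by exact: measurable_itv.
have Iu : `]b0, c0[%classic u by rewrite /= in_itv /= bu.
have intf (u' : R) : `]b0, c0[%classic u' ->
    mu.-integrable `[b1, s]%classic (EFin \o (fun t => g1 (col2 u' t))).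
  rewrite /= in_itv /= => /andP[bu' u'c].
  have [|Hi _] := @itv_continuous_integrable (fun t => g1 (col2 u' t)) b1 s; last exact: Hi.
  move=> t Ht; apply: continuous_col1.
  by have [] := cg (col2 u' t) (inb _ _ _ (sb _ Ht)); rewrite ?(ltW bu') ?(ltW u'c).
have derf (u' t : R) : `]b0, c0[%classic u' -> `[b1, s]%classic t ->
    is_derive u' 1 (fun v => g1 (col2 v t)) ('D_e0 g1 (col2 u' t)).
  rewrite /= !in_itv /= => /andP[bu' u'c] Ht.
  apply/is_derive_col0/derivableP.
  by have [] := dg (col2 u' t) (inb _ _ _ (sb _ Ht)); rewrite ?(ltW bu') ?(ltW u'c).
have Gub (u' t : R) : `]b0, c0[%classic u' -> `[b1, s]%classic t ->
    `|partial1of2 (fun v t => g1 (col2 v t)) u' t| <= cst M t.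
  move=> Iu' It; rewrite partial1of2E.
  have [_ ->] := derf _ _ Iu' It.
  move: Iu' It; rewrite /= !in_itv /= => /andP[bu' u'c] Ht.
  by have [] := dg (col2 u' t) (inb _ _ _ (sb _ Ht)); rewrite ?(ltW bu') ?(ltW u'c).
have M0 : 0 <= M.
  have [_ _ _] := dg x (ballxx x r0); exact: le_trans.
have intM : mu.-integrable `[b1, s]%classic (EFin \o cst M).
  have [|Hi _] := @itv_continuous_integrable (cst M) b1 s; last exact: Hi.
  by move=> t _; exact: cvg_cst.
pose f (v t : R) := g1 (col2 v t).
have derf1 (u' t : R) : `]b0, c0[%classic u' -> `[b1, s]%classic t ->
    derivable (f^~ t) u' 1.
  by move=> Iu' It; have [] := derf _ _ Iu' It.
have M0' (t : R) : 0 <= cst M t by [].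
have dG : derivable (fun u' => \int[mu]_(t in `[b1, s]) g1 (col2 u' t)) u 1.
  have H := derivable_under_integral (mu := mu) (f := f) mB Iu intf derf1 M0' intM Gub.
  exact H.
have dGE : (fun u' => \int[mu]_(t in `[b1, s]) g1 (col2 u' t))^`()%classic u =
    \int[mu]_(t in `[b1, s]) 'D_e1 g0 (col2 u t).
  rewrite (differentiation_under_integral (mu := mu) (f := f) mB Iu intf derf1 M0' intM Gub).
  apply: eq_Rintegral => t /set_mem It.
  rewrite /= partial1of2E; have [_ ->] := derf _ _ Iu It.
  move: It; rewrite /= in_itv /= => Ht.
  by have [_ _ -> _] := dg (col2 u t) (inb _ _ ub (sb _ Ht)).
have cgt (t : R) : b1 <= t <= s -> {for t, continuous (fun t => g0 (col2 u t))}.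
  by move=> Ht; apply: continuous_col1; have [] := cg _ (inb _ _ ub (sb _ Ht)).
have FTC : \int[mu]_(t in `[b1, s]) 'D_e1 g0 (col2 u t) =
    g0 (col2 u s) - g0 (col2 u b1).
  rewrite /Rintegral (continuous_FTC2 (F := fun t => g0 (col2 u t)) bs); first by [].
  - have [|_ Hc] := @itv_continuous_integrable (fun t => 'D_e1 g0 (col2 u t)) b1 s; last exact: Hc.
    by move=> t Ht; apply: (continuous_col1 (f := 'D_e1 g0)); have [] := cg _ (inb _ _ ub (sb _ Ht)).
  - split.
    + move=> t; rewrite in_itv /= => /andP[bt ts].
      have tt : b1 <= t <= s by rewrite !ltW.
      have [d _ _ _] := dg _ (inb u t ub (sb _ tt)).
      by have /is_derive_col1[] := derivableP d.
    + by apply: cvg_at_right_filter; apply: cgt; rewrite lexx ltW.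
    + by apply: cvg_at_left_filter; apply: cgt; rewrite lexx ltW.
  - move=> t; rewrite in_itv /= => /andP[bt ts].
    have tt : b1 <= t <= s by rewrite !ltW.
    have [d _ _ _] := dg _ (inb u t ub (sb _ tt)).
    by rewrite derive1E; have /is_derive_col1[_ ->] := derivableP d.
have -> : g0 z = g0 (col2 u b1) + (g0 (col2 u s) - g0 (col2 u b1)) by rewrite zE; ring.
apply: is_deriveD.
  by apply: (DeriveDef d1); rewrite -derive1E; exact: d2.
by apply: (DeriveDef dG); rewrite -derive1E dGE; exact: FTC.
Qed.

Lemma gradient0_constant (f : 'cV[R]_2 -> R) (x z : 'cV[R]_2) (r : R) :
  (forall y, ball x r y -> is_derive y e0 f 0 /\ is_derive y e1 f 0) ->
  ball x r z -> f z = f x.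
Proof.
move=> df xz; have [r0 Hz] := xz; have H0 := Hz 0 0; have H1 := Hz 1 0.
rewrite /ball /= in H0 H1.
rewrite (col2_coord x) (col2_coord z).
set u := z 0 0 in H0 *; set s := z 1 0 in H1 *.
set a := x 0 0 in H0 *; set b := x 1 0 in H1 *.
have nt (t c d : R) : 0 <= t <= 1 -> `|c - d| < r -> `|c - (c + t * (d - c))| < r.
  move=> /andP[t0 t1] Hd; rewrite opprD addNKr normrN normrM (ger0_norm t0).
  by rewrite distrC; apply: le_lt_trans Hd; rewrite ler_piMl.
have c0 (c : R) : `|c - c| < r by rewrite subrr normr0.
have S0 : f (col2 u b) = f (col2 a b).
  have D t : 0 <= t <= 1 -> is_derive (col2 a b + (t * (u - a)) *: e0) e0 f 0.
    move=> t01; rewrite col2_shift0.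
    by have [] := df _ (ball_col2 (nt t a u t01 H0) (c0 b)).
  have [t /D[]//|t /D[_ ->]] := @mean_value_line R _ f (col2 a b) e0 (u - a).
  by rewrite mulr0 col2_shift0 (addrC a) subrK => /eqP; rewrite subr_eq0 => /eqP.
have S1 : f (col2 u s) = f (col2 u b).
  have D t : 0 <= t <= 1 -> is_derive (col2 u b + (t * (s - b)) *: e1) e1 f 0.
    move=> t01; rewrite col2_shift1.
    by have [] := df _ (ball_col2 H0 (nt t b s t01 H1)).
  have [t /D[]//|t /D[_ ->]] := @mean_value_line R _ f (col2 u b) e1 (s - b).
  by rewrite mulr0 col2_shift1 (addrC b) subrK => /eqP; rewrite subr_eq0 => /eqP.
by rewrite S1.
Qed.

(** Two local potentials differ by a constant near a common point, so they are
    compatible and monodromy applies. *)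
Theorem poincare (D : set 'cV[R]_2) (g0 g1 : 'cV[R]_2 -> R) :
  open D -> simply_connected R D -> Ck_on 1 D g0 -> Ck_on 1 D g1 ->
  (forall z, D z -> 'D_e1 g0 z = 'D_e0 g1 z) ->
  exists phi : 'cV[R]_2 -> R, forall z, D z ->
    is_derive z e0 phi (g0 z) /\ is_derive z e1 phi (g1 z).
Proof.
move=> oD scD g0k g1k closed.
have {}g0k : Ck_upto 1 D D D g0 by [].
have {}g1k : Ck_upto 1 D D D g1 by [].
have nD z : D z -> nbhs z D by move=> ?; exact: open_nbhs_nbhs.
have /choice[psi psiP] : forall x, exists psi : 'cV[R]_2 -> R, D x ->
    exists2 r, 0 < r & forall z, ball x r z ->
      is_derive z e0 psi (g0 z) /\ is_derive z e1 psi (g1 z).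
  move=> x; have [Dx|nDx] := pselect (D x); last by exists (fun _ => 0).
  have cD01 z : D z -> {for z, continuous ('D_e0 g1)}.
    by move=> Dz; exact: (Ck_continuous oD _ _ (Ck_derive e0 g1k)).
  have bd : \forall z \near x, `|'D_e0 g1 z| <= `|'D_e0 g1 x| + 1.
    move/cvgrPdist_le : (cD01 x Dx) => /(_ 1 ltr01); apply: filterS => z Hz.
    rewrite -lerBlDl; apply: le_trans Hz; rewrite distrC.
    exact: le_trans (ler_norm _) (ler_dist_dist _ _).
  have [r /= r0 xr] := (nbhs_ballP x _).1 (filterI (nD x Dx) bd).
  have [|z /xr[Dz _]|phi phiP] := @local_potential g0 g1 x r (`|'D_e0 g1 x| + 1) r0.
  - move=> z /xr[Dz Bz]; split => //; last exact: closed.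
      exact: (@Ck_derivable R 0 _ R D D D g0 z e1 g0k Dz).
    exact: (@Ck_derivable R 0 _ R D D D g1 z e0 g1k Dz).
  - split.
    + exact: (Ck_continuous oD _ _ g0k).
    + exact: (Ck_continuous oD _ _ g1k).
    + by exact: (Ck_continuous oD _ _ (Ck_derive e1 g0k)).
  by exists phi => _; exists (r / 2) => //; rewrite divr_gt0.
have compat x : D x -> compatible psi x.
  move=> Dx; have [r r0 Hr] := psiP x Dx.
  have nb : \forall y \near x, ball x r y by exact: nbhsx_ballx.
  apply: filterS2 (nD x Dx) (near_near nb) => y Dy yb.
  have [r' r'0 Hr'] := psiP y Dy.
  have [t /= t0 yt] := (nbhs_ballP y _).1 (filterI yb (nbhsx_ballx y r' r'0)).
  apply: filterS (nbhsx_ballx y t t0) => z yz.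
  suff : psi y z - psi x z = psi y y - psi x y by lra.
  apply: (@gradient0_constant (fun w => psi y w - psi x w) y z t) => // w /yt[xw yw].
  have [A0 A1] := Hr w xw; have [B0 B1] := Hr' w yw.
  by split; [rewrite -(subrr (g0 w))|rewrite -(subrr (g1 w))]; exact: is_deriveB.
have [Phi PhiP] := monodromy compat oD scD.
exists Phi => z Dz; have [r r0 Hr] := psiP z Dz.
have [A0 A1] := Hr z (ballxx z r0).
have nPhi : \forall w \near z, psi z w + (Phi z - psi z z) = Phi w.
  by apply: filterS (PhiP z Dz) => w H; lra.
split; apply: near_eq_is_derive nPhi _.
  by rewrite -[g0 z]addr0; apply: is_deriveD.
by rewrite -[g1 z]addr0; apply: is_deriveD.
Qed.

End poincare.

(** * Behaviour of a function at a smooth boundary point *)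

Section boundary.
Variable R : realType.
Notation e0 := (e0 R).
Notation e1 := (e1 R).

Lemma cve0 : cve R 1 0 = e0.
Proof. by rewrite /cve /e0; congr delta_mx; apply/val_inj; rewrite /= inordK. Qed.

Lemma cve1 : cve R 1 1 = e1.
Proof. by rewrite /cve /e1; congr delta_mx; apply/val_inj; rewrite /= inordK. Qed.

Lemma derive_plane (f : 'cV[R]_2 -> R) (z w : 'cV[R]_2) : differentiable f z ->
  'D_w f z = w 0 0 * 'D_e0 f z + w 1 0 * 'D_e1 f z.
Proof.
move=> df; rewrite (derive_frame w (cv_frame R 1) df) big_ord_recl big_ord1.
rewrite -cve0 -cve1 /=.
have -> : inord 0 = 0 :> 'I_2 by apply/val_inj; rewrite /= inordK.
by have -> : inord (bump 0 0) = 1 :> 'I_2 by apply/val_inj; rewrite /= inordK.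
Qed.

Lemma plane_differentiable (f : 'cV[R]_2 -> R) (z : 'cV[R]_2) g0 g1 :
  (\forall y \near z, is_derive y e0 f (g0 y) /\ is_derive y e1 f (g1 y)) ->
  {for z, continuous g0} -> {for z, continuous g1} -> differentiable f z.
Proof.
move=> df c0 c1; apply: (C1_differentiable (cv_frame R 1)) => -[[|[|//]] jp] /=.
- by rewrite cve0; apply: filterS df => y [[]].
- by rewrite cve1; apply: filterS df => y [_ []].
- have E : \forall y \near z, g0 y = 'D_e0 f y by apply: filterS df => y [[_ ->]].
  rewrite cve0 /prop_for /continuous_at -(nbhs_singleton E).
  exact: cvg_trans (near_eq_cvg E) c0.
- have E : \forall y \near z, g1 y = 'D_e1 f y by apply: filterS df => y [_ [_ ->]].
  rewrite cve1 /prop_for /continuous_at -(nbhs_singleton E).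
  exact: cvg_trans (near_eq_cvg E) c1.
Qed.

Lemma norm_segment (a b s d : R) : 0 <= s <= 1 -> `|a| <= d -> `|b| <= d ->
  `|a + s * (b - a)| <= d.
Proof.
move=> /andP[s0 s1] Ha Hb.
have -> : a + s * (b - a) = (1 - s) * a + s * b by ring.
apply: le_trans (ler_normD _ _) _; rewrite !normrM (ger0_norm s0) ger0_norm ?subr_ge0 //.
have -> : d = (1 - s) * d + s * d by ring.
by apply: lerD; rewrite ler_wpM2l // subr_ge0.
Qed.

Lemma sum_sqr_gt0 (a b : R) : ~ (a = 0 /\ b = 0) -> 0 < a ^+ 2 + b ^+ 2.
Proof.
move=> ab; rewrite lt_neqAle addr_ge0 ?sqr_ge0 // andbT eq_sym paddr_eq0 ?sqr_ge0 //.
by rewrite !sqrf_eq0; apply/negP => /andP[/eqP a0 /eqP b0]; exact: ab.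
Qed.

Lemma defining_frontier n (A U : set 'cV[R]_n) (rho : 'cV[R]_n -> R) z :
  open A -> open U -> U z -> {for z, continuous rho} ->
  (forall x, U x -> (A x <-> rho x < 0)) -> frontier A z -> rho z = 0.
Proof.
move=> oA oU Uz crz AU /(frontierE _ oA)[cz nAz].
have nlt : ~ rho z < 0 by move=> rz; apply: nAz; exact/(AU z Uz).2.
apply/eqP; rewrite eq_le; apply/andP; split; last by rewrite leNgt; apply/negP.
rewrite leNgt; apply/negP => rz.
have nU : nbhs z U by exact: open_nbhs_nbhs.
have [w [Aw [Uw rw]]] := cz _ (filterI nU (near_continuous crz (lt_nbhsr rz))).
by have := (AU w Uw).1 Aw; lra.
Qed.

Section chart.
Variables (D : set 'cV[R]_2) (p : 'cV[R]_2) (rho : 'cV[R]_2 -> R) (U : set 'cV[R]_2).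
Hypotheses (oD : open D) (Fp : frontier D p).
Hypotheses (oU : open U) (Up : U p) (rhok : Ck_upto 1 U U U rho).
Hypothesis DU : forall x, U x -> (D x <-> rho x < 0).

Let r0 := 'D_e0 rho p.
Let r1 := 'D_e1 rho p.
Hypothesis rn0 : 0 < r0 ^+ 2 + r1 ^+ 2.

Let c := (r0 ^+ 2 + r1 ^+ 2) / 2.
(** Coordinates x along the tangent and y along the outward normal at p. *)
Definition normal_vec : 'cV[R]_2 := col2 r0 r1.
Definition tangent_vec : 'cV[R]_2 := col2 r1 (- r0).
Definition chart (x y : R) : 'cV[R]_2 := p + x *: tangent_vec + y *: normal_vec.

Let nu := normal_vec.
Let tau := tangent_vec.

Let c_gt0 : 0 < c. Proof. by rewrite divr_gt0. Qed.

Lemma chart00 : chart 0 0 = p.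
Proof. by rewrite /chart !scale0r !addr0. Qed.

Lemma chart_nu x y a : chart x y + a *: nu = chart x (y + a).
Proof. by rewrite /chart -addrA -scalerDl. Qed.

Lemma chart_tau x y a : chart x y + a *: tau = chart (x + a) y.
Proof. by rewrite /chart scalerDl; rewrite -!addrA; congr (_ + (_ + _)); rewrite addrC. Qed.

Lemma chart_dist x y x' y' :
  `|chart x y - chart x' y'| <= (`|tau| + `|nu|) * (`|x - x'| + `|y - y'|).
Proof.
have -> : chart x y - chart x' y' = (x - x') *: tau + (y - y') *: nu.
  by rewrite /chart; apply/matrixP => i j; rewrite !mxE; ring.
apply: le_trans (ler_normD _ _) _; rewrite !normrZ mulrDl !mulrDr.
have ? := normr_ge0 tau; have ? := normr_ge0 nu.
have ? := normr_ge0 (x - x'); have ? := normr_ge0 (y - y').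
by nra.
Qed.

Lemma chart_surj : exists2 C, 0 < C & forall z, exists x y,
  [/\ z = chart x y, `|x| <= C * `|z - p| & `|y| <= C * `|z - p|].
Proof.
pose n2 := r0 ^+ 2 + r1 ^+ 2.
exists ((`|r0| + `|r1|) / n2 + 1).
  by apply: ltr_wpDl => //; apply: divr_ge0; [exact: addr_ge0|exact: ltW].
move=> z; pose a := z 0 0 - p 0 0; pose b := z 1 0 - p 1 0.
have Ha : `|a| <= `|z - p|.
  by have := coord_le_norm (z - p) 0; rewrite !mxE.
have Hb : `|b| <= `|z - p|.
  by have := coord_le_norm (z - p) 1; rewrite !mxE.
have bd (u v : R) : `|(u * a + v * b) / n2| <= (`|u| + `|v|) / n2 * `|z - p|.
  rewrite normrM normfV (gtr0_norm rn0) mulrAC ler_wpM2r ?invr_ge0 ?(ltW rn0) //.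
  apply: le_trans (ler_normD _ _) _; rewrite !normrM mulrDl.
  by apply: lerD; rewrite ler_wpM2l.
exists ((r1 * a + - r0 * b) / n2), ((r0 * a + r1 * b) / n2); split.
- have n20 : n2 != 0 by exact: lt0r_neq0.
  rewrite /chart /tangent_vec /normal_vec; apply: cv2P; rewrite !mxE /=.
    rewrite [RHS](_ : _ = p 0 0 + a * n2 / n2); last by rewrite /n2; ring.
    by rewrite mulfK // /a; ring.
  rewrite [RHS](_ : _ = p 1 0 + b * n2 / n2); last by rewrite /n2; ring.
  by rewrite mulfK // /b; ring.
- apply: le_trans (bd _ _) _; rewrite normrN (addrC `|r1|).
  by rewrite [leRHS]mulrDl mul1r lerDl.
- by apply: le_trans (bd _ _) _; rewrite [leRHS]mulrDl mul1r lerDl.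
Qed.

Let drho z : U z -> differentiable rho z.
Proof. exact: (Ck_differentiable (cv_frame R 1) oU _ rhok). Qed.

(** By continuity of its gradient, rho increases along the normal at least at
    half the rate that it has at p, which is 2 c, and varies along the tangent
    as slowly as wished. *)
Lemma chart_box eps : 0 < eps -> exists2 dl, 0 < dl & forall x y,
  `|x| <= dl -> `|y| <= dl ->
  [/\ U (chart x y),
      forall y', `|y'| <= dl -> y <= y' ->
        c * (y' - y) <= rho (chart x y') - rho (chart x y) &
      forall x', `|x'| <= dl ->
        `|rho (chart x' y) - rho (chart x y)| <= eps * c * `|x' - x|].
Proof.
move=> eps0.
have cD w : {for p, continuous ('D_w rho)}.
  exact: (Ck_continuous oU _ _ (Ck_derive w rhok)).
have Dnu : 'D_nu rho p = 2 * c.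
  rewrite derive_plane; last exact: drho.
  by rewrite /nu /normal_vec col2E0 col2E1 -/r0 -/r1 /c; field.
have Dtau : 'D_tau rho p = 0.
  rewrite derive_plane; last exact: drho.
  by rewrite /tau /tangent_vec col2E0 col2E1 -/r0 -/r1; ring.
have H1 : \forall z \near p, c <= 'D_nu rho z.
  move/cvgrPdist_le : (cD nu) => /(_ c c_gt0); apply: filterS => z.
  by rewrite Dnu ler_norml; lra.
have H2 : \forall z \near p, `|'D_tau rho z - 0| <= eps * c.
  move/cvgrPdistC_le : (cD tau) => /(_ (eps * c) (mulr_gt0 eps0 c_gt0)).
  by rewrite Dtau.
have nU : nbhs p U by exact: open_nbhs_nbhs.
have [r /= r_gt0 pr] := (nbhs_ballP p _).1 (filterI nU (filterI H1 H2)).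
pose A := `|tau| + `|nu| + 1.
have A0 : 0 < A by rewrite ltr_wpDl // addr_ge0.
exists (r / (2 * A)); first by rewrite divr_gt0 // mulr_gt0.
set dl := r / (2 * A).
have inb x y : `|x| <= dl -> `|y| <= dl -> ball p r (chart x y).
  move=> Hx Hy; rewrite -ball_normE /= -{1}chart00 distrC.
  apply: le_lt_trans (chart_dist _ _ _ _) _; rewrite !subr0.
  have dA : dl * (2 * A) = r by rewrite /dl divfK // lt0r_neq0 // mulr_gt0.
  have dl0 : 0 < dl by rewrite divr_gt0 // mulr_gt0.
  apply: (@le_lt_trans _ _ ((`|tau| + `|nu|) * (2 * dl))).
    by rewrite ler_wpM2l ?addr_ge0 // mulr2n mulrDl mul1r lerD.
  by rewrite -dA /A; nra.
move=> x y Hx Hy; split.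
- by have [] := pr _ (inb x y Hx Hy).
- move=> y' Hy' yy'.
  have [s s01|s s01] := @mean_value_line R _ rho (chart x y) nu (y' - y).
    rewrite chart_nu; apply: diff_derivable; apply: drho.
    by have [] := pr _ (inb x _ Hx (norm_segment s01 Hy Hy')).
  rewrite !chart_nu (addrC y) subrK (addrC y) => ->; rewrite mulrC ler_wpM2l ?subr_ge0 //.
  by have [_ []] := pr _ (inb x _ Hx (norm_segment s01 Hy Hy')); rewrite (addrC y).
move=> x' Hx'.
have := @increment_bound R _ rho (chart x y) tau (x' - x) 0 (eps * c).
rewrite mulr0 subr0 chart_tau [x + (x' - x)]addrC subrK; apply => s s01.
rewrite chart_tau; have [Uz [_ Hz]] := pr _ (inb _ y (norm_segment s01 Hx Hx') Hy).
by split => //; exact/diff_derivable/drho.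
Qed.

Lemma rho_frontier z : U z -> frontier D z -> rho z = 0.
Proof.
by move=> Uz; apply: (defining_frontier oD oU Uz _ DU); exact: (Ck_continuous oU _ _ rhok).
Qed.

Let rhop : rho p = 0. Proof. exact: rho_frontier. Qed.

(** As rho increases upward and changes little sideways, near p the set D
    contains a cone below p and, below each of its points, the vertical line. *)
Lemma chart_domain : exists2 dl, 0 < dl & forall x y, `|x| <= dl -> `|y| <= dl ->
  [/\ forall y', `|y'| <= dl -> y' <= y -> D (chart x y) -> D (chart x y') &
      y <= - `|x| -> y < 0 -> D (chart x y)].
Proof.
have [dl dl0 H] := chart_box (divr_gt0 ltr01 (ltr0n R 2)).
exists dl => // x y Hx Hy; have [Uxy _ _] := H x y Hx Hy; split.
- move=> y' Hy' y'y /(DU Uxy) rxy; have [Uxy' mono _] := H x y' Hx Hy'.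
  apply/(DU Uxy'); have := mono y Hy y'y.
  have : 0 <= c * (y - y') by rewrite mulr_ge0 ?subr_ge0 // ltW.
  lra.
- move=> yx y0; apply/(DU Uxy).
  have z0 : `|0 : R| <= dl by rewrite normr0 ltW.
  have [_ mono _] := H x y Hx Hy; have [_ _ lip] := H 0 0 z0 z0.
  have := mono 0 z0 (ltW y0); have := lip x Hx.
  rewrite chart00 rhop !subr0 sub0r => /ler_normlP [_] L M.
  have C1 : c * `|x| <= c * (- y) by rewrite ler_wpM2l ?(ltW c_gt0) // lerNr.
  have C2 : c * y < 0 by rewrite pmulr_rlt0.
  lra.
Qed.

(** On each vertical line rho changes sign, hence vanishes; between two
    boundary points the change of rho along the normal makes up for the one
    along the tangent, which is small. *)
Lemma chart_boundary eps : 0 < eps -> exists2 dl, 0 < dl &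
  (forall x, `|x| <= dl -> exists2 y, `|y| <= eps * `|x| /\ `|y| <= dl &
     frontier D (chart x y)) /\
  (forall x y x' y', `|x| <= dl -> `|y| <= dl -> `|x'| <= dl -> `|y'| <= dl ->
     frontier D (chart x y) -> frontier D (chart x' y') ->
     `|y - y'| <= eps * `|x - x'|).
Proof.
move=> eps0.
pose eps1 := Num.min eps 1.
have eps1_0 : 0 < eps1 by rewrite lt_min eps0 ltr01.
have eps1_1 : eps1 <= 1 by rewrite ge_min lexx orbT.
have eps1_e : eps1 <= eps by rewrite ge_min lexx.
have [dl dl0 H] := chart_box eps1_0.
have z0 : `|0 : R| <= dl / 2 by rewrite normr0 divr_ge0 // ltW.
have w (a : R) : `|a| <= dl / 2 -> `|a| <= dl by lra.
exists (dl / 2); first by rewrite divr_gt0.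
split.
- move=> x Hx; pose t := eps1 * `|x|.
  have t0 : 0 <= t by rewrite mulr_ge0 // ltW.
  have tx : t <= `|x| by rewrite ler_piMl.
  have tdl : `|t| <= dl / 2 by rewrite ger0_norm //; exact: le_trans Hx.
  have ntdl : `|- t| <= dl / 2 by rewrite normrN.
  have [_ _ lip] := H 0 0 (w _ z0) (w _ z0).
  have Lx := lip x (w _ Hx); rewrite chart00 rhop !subr0 -/t in Lx.
  have {}Lx : `|rho (chart x 0)| <= c * t by rewrite mulrC /t mulrAC.
  have [_ m1 _] := H x 0 (w _ Hx) (w _ z0).
  have {m1} := m1 t (w _ tdl) t0; rewrite subr0 => m1.
  have [_ m2 _] := H x (- t) (w _ Hx) (w _ ntdl).
  have {m2} := m2 0 (w _ z0); rewrite oppr_le0 opprK add0r => /(_ t0) m2.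
  have cont : {within `[- t, t], continuous (fun y => rho (chart x y))}.
    apply: continuous_in_subspaceT => y /set_mem /=; rewrite in_itv /= => Hy.
    have Hy' : `|y| <= dl by apply: w; apply: le_trans tdl; rewrite (ger0_norm t0) ler_norml.
    have [Uxy _ _] := H x y (w _ Hx) Hy'.
    apply: (@continuous_comp _ _ _ (chart x) rho).
      by apply: cvgD; [exact: cvg_cst|apply: cvgZr_tmp; exact: cvg_id].
    exact: (Ck_continuous oU _ _ rhok).
  have ntt : - t <= t by lra.
  have [|y Hy ry] := IVT (v := 0) ntt cont.
    move/ler_normlP : Lx => [L1 L2].
    by rewrite ge_min le_max; apply/andP; split; apply/orP; [left|right]; clear H lip cont; lra.
  rewrite in_itv /= in Hy; have yt : `|y| <= t by rewrite ler_norml.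
  have ydl : `|y| <= dl / 2 by rewrite (le_trans yt) // -(ger0_norm t0).
  exists y; first by split => //; rewrite (le_trans yt) // ler_wpM2r.
  have [Uxy _ _] := H x y (w _ Hx) (w _ ydl).
  apply/(frontierE _ oD); split; last by move=> /(DU Uxy); rewrite ry ltxx.
  move=> B nB.
  have cx : {for y, continuous (chart x)}.
    by apply: cvgD; [exact: cvg_cst|apply: cvgZr_tmp; exact: cvg_id].
  have [r /= r_gt0 yr] := (nbhs_ballP y _).1 (near_continuous cx nB).
  pose m := Num.min (r / 2) (dl / 2).
  have m0 : 0 < m by rewrite lt_min !divr_gt0.
  have mr : m <= r / 2 by rewrite ge_min lexx.
  have md : m <= dl / 2 by rewrite ge_min lexx orbT.
  have Hym : `|y - m| <= dl by move: ydl; rewrite !ler_norml; clear H lip cont cx yr; lra.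
  exists (chart x (y - m)); split; last first.
    by apply: yr; rewrite /ball /= (_ : y - (y - m) = m) ?gtr0_norm //; [clear H lip cont cx; lra|ring].
  have [Uym mono _] := H x (y - m) (w _ Hx) Hym.
  apply/(DU Uym); have := mono y (w _ ydl); rewrite ry.
  rewrite gerBl (ltW m0) => /(_ isT).
  have : 0 < c * (y - (y - m)) by rewrite mulr_gt0 //; clear H lip cont cx yr mono; lra.
  clear H lip cont cx yr mono; lra.
- move=> x y x' y' Hx Hy Hx' Hy' F F'.
  have [Uxy _ _] := H x y (w _ Hx) (w _ Hy).
  have [Uxy' _ lip] := H x' y' (w _ Hx') (w _ Hy').
  have R1 := rho_frontier Uxy F; have R2 := rho_frontier Uxy' F'.
  have Lx := lip x (w _ Hx); rewrite R2 subr0 in Lx.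
  have [_ m1 _] := H x y' (w _ Hx) (w _ Hy').
  have [_ m2 _] := H x y (w _ Hx) (w _ Hy).
  have Y : c * `|y - y'| <= `|rho (chart x y')|.
    have [yy'|/ltW y'y] := leP y y'.
      have := m2 y' (w _ Hy') yy'; rewrite R1 subr0 distrC ger0_norm ?subr_ge0 //.
      by move=> /le_trans; apply; exact: ler_norm.
    have := m1 y (w _ Hy) y'y; rewrite R1 sub0r ger0_norm ?subr_ge0 //.
    by move=> /le_trans; apply; rewrite -normrN; exact: ler_norm.
  rewrite -(ler_pM2l c_gt0); apply: le_trans Y _; apply: le_trans Lx _.
  by rewrite (mulrC eps1) -mulrA ler_wpM2l ?(ltW c_gt0) // ler_wpM2r.
Qed.

Variables (phi g0 g1 : 'cV[R]_2 -> R) (G0 G1 : R).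
Hypothesis dphi : forall z, D z -> is_derive z e0 phi (g0 z) /\ is_derive z e1 phi (g1 z).
Hypothesis cg : forall z, D z -> {for z, continuous g0} /\ {for z, continuous g1}.
Hypothesis lim0 : g0 @ within D (nbhs p) --> G0.
Hypothesis lim1 : g1 @ within D (nbhs p) --> G1.

(** The first order part that phi should have at p; without it, the gradient
    of phi tends to 0 at p. *)
Let lin (z : 'cV[R]_2) := G0 * (z 0 0 - p 0 0) + G1 * (z 1 0 - p 1 0).
Let psi (z : 'cV[R]_2) := phi z - lin z.

Let dlin z : is_derive z e0 lin G0 /\ is_derive z e1 lin G1.
Proof.
rewrite (col2_coord z); split.
  apply/is_derive_col0.
  have -> : (fun r => lin (col2 r (z 1 0))) =
      cst (G1 * (z 1 0 - p 1 0)) + G0 \*: (id - cst (p 0 0)).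
    by apply/funext => r; rewrite /lin col2E0 col2E1 addrC.
  by apply: is_derive_eq; rewrite subr0 add0r -[_ *: _]/(_ * _) mulr1.
apply/is_derive_col1.
have -> : (fun r => lin (col2 (z 0 0) r)) =
    cst (G0 * (z 0 0 - p 0 0)) + G1 \*: (id - cst (p 1 0)).
  by apply/funext => r; rewrite /lin col2E0 col2E1.
by apply: is_derive_eq; rewrite subr0 add0r -[_ *: _]/(_ * _) mulr1.
Qed.

Let dpsi z w : D z ->
  is_derive z w psi (w 0 0 * (g0 z - G0) + w 1 0 * (g1 z - G1)).
Proof.
move=> Dz; have d y : D y -> is_derive y e0 psi (g0 y - G0) /\
                             is_derive y e1 psi (g1 y - G1).
  move=> Dy; have [A0 A1] := dphi Dy; have [B0 B1] := dlin y.
  by split; exact: is_deriveB.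
have dd : differentiable psi z.
  apply: (@plane_differentiable _ _ (fun y => g0 y - G0) (fun y => g1 y - G1)).
  - by have : nbhs z D by [exact: open_nbhs_nbhs]; apply: filterS => y /d.
  - by have [c0 _] := cg Dz; apply: (cvgB c0); exact: cvg_cst.
  - by have [_ c1] := cg Dz; apply: (cvgB c1); exact: cvg_cst.
apply: DeriveDef; first exact: diff_derivable.
by rewrite derive_plane //; have [[_ ->] [_ ->]] := d z Dz.
Qed.

Let near_slope eps w : 0 < eps -> \forall z \near p, D z ->
  `|'D_w psi z| <= eps.
Proof.
move=> eps0; pose K := `|w 0 0| + `|w 1 0| + 1.
have K0 : 0 < K by rewrite ltr_wpDl // addr_ge0.
have eK : 0 < eps / K by rewrite divr_gt0.
have H0 := near_within lim0 (nbhsx_ballx G0 _ eK).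
have H1 := near_within lim1 (nbhsx_ballx G1 _ eK).
apply: filterS2 H0 H1 => z H0 H1 Dz; have [_ ->] := dpsi w Dz.
apply: le_trans (ler_normD _ _) _; rewrite !normrM.
have {}H0 : `|g0 z - G0| <= eps / K by rewrite distrC; exact/ltW/H0.
have {}H1 : `|g1 z - G1| <= eps / K by rewrite distrC; exact/ltW/H1.
apply: (@le_trans _ _ ((`|w 0 0| + `|w 1 0|) * (eps / K))).
  by rewrite mulrDl; apply: lerD; rewrite ler_wpM2l.
rewrite mulrCA ler_piMr ?(ltW eps0) // ler_pdivrMr // mul1r.
by rewrite lerDl.
Qed.

(** From chart x y the path goes down to the height - (|x| + |y|), across to
    the normal line through the tip of the cone, and along this line. *)
Let psi_step eps : 0 < eps -> exists2 dl, 0 < dl & forall x y s,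
  `|x| + `|y| <= dl -> 0 < s <= dl -> D (chart x y) ->
  `|psi (chart x y) - psi (chart 0 (- s))| <= eps * (4 * (`|x| + `|y|) + s).
Proof.
move=> eps0; have [d1 d10 H1] := chart_domain.
have H2 : \forall z \near p, (D z -> `|'D_tau psi z| <= eps) /\
                            (D z -> `|'D_nu psi z| <= eps).
  by apply: filterS2 (near_slope tau eps0) (near_slope nu eps0).
have [r /= r_gt0 pr] := (nbhs_ballP p _).1 H2.
pose A := `|tau| + `|nu| + 1.
have A0 : 0 < A by rewrite ltr_wpDl // addr_ge0.
pose dl := Num.min d1 (r / (2 * A)).
have dl0 : 0 < dl by rewrite lt_min d10 divr_gt0 // mulr_gt0.
have dl1 : dl <= d1 by rewrite ge_min lexx.
have dlA : dl * (2 * A) <= r.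
  by rewrite -ler_pdivlMr ?mulr_gt0 // ge_min lexx orbT.
have inb x y : `|x| <= dl -> `|y| <= dl -> ball p r (chart x y).
  move=> Hx Hy; rewrite -ball_normE /= -{1}chart00 distrC.
  apply: le_lt_trans (chart_dist _ _ _ _) _; rewrite !subr0.
  apply: (@le_lt_trans _ _ ((`|tau| + `|nu|) * (2 * dl))).
    by rewrite ler_wpM2l ?addr_ge0 // mulr2n mulrDl mul1r lerD.
  by apply: lt_le_trans dlA; rewrite /A; nra.
have stepnu x y y' : `|x| <= dl -> `|y| <= dl -> `|y'| <= dl ->
    (forall s : R, 0 <= s <= 1 -> D (chart x (y + s * (y' - y)))) ->
    `|psi (chart x y') - psi (chart x y)| <= eps * `|y' - y|.
  move=> Hx Hy Hy' HD.
  have := @increment_bound R _ psi (chart x y) nu (y' - y) 0 eps.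
  rewrite mulr0 subr0 chart_nu (addrC y) subrK; apply => s s01.
  rewrite chart_nu; have Ds := HD s s01; split; first by have [] := dpsi nu Ds.
  rewrite subr0; have [|_ Ht] := pr (chart x (y + s * (y' - y))); last exact: Ht.
  exact: inb Hx (norm_segment s01 Hy Hy').
have steptau x x' y : `|x| <= dl -> `|x'| <= dl -> `|y| <= dl ->
    (forall s : R, 0 <= s <= 1 -> D (chart (x + s * (x' - x)) y)) ->
    `|psi (chart x' y) - psi (chart x y)| <= eps * `|x' - x|.
  move=> Hx Hx' Hy HD.
  have := @increment_bound R _ psi (chart x y) tau (x' - x) 0 eps.
  rewrite mulr0 subr0 chart_tau (addrC x) subrK; apply => s s01.
  rewrite chart_tau; have Ds := HD s s01; split; first by have [] := dpsi tau Ds.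
  rewrite subr0; have [|Ht _] := pr (chart (x + s * (x' - x)) y); last exact: Ht.
  exact: inb (norm_segment s01 Hx Hx') Hy.
exists dl => // x y s xy /andP[s0 sdl] Dxy.
have x_ge0 := normr_ge0 x; have y_ge0 := normr_ge0 y.
have Hx : `|x| <= dl by lra.
have Hy : `|y| <= dl by lra.
(* The height at which the horizontal segment from x to 0 lies in the cone. *)
pose y1 := - (`|x| + `|y|).
have ny1 : `|y1| = `|x| + `|y| by rewrite normrN ger0_norm // addr_ge0.
have Hy1 : `|y1| <= dl by rewrite ny1.
have y1_0 : y1 < 0.
  rewrite oppr_lt0 lt_neqAle addr_ge0 // andbT eq_sym; apply/eqP => xy0.
  have [x0 yy0] : x = 0 /\ y = 0 by move/eqP: xy0; rewrite paddr_eq0 // => /andP[/eqP/normr0_eq0 ? /eqP/normr0_eq0].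
  have [_ nDp] := (frontierE _ oD).1 Fp.
  by apply: nDp; rewrite -chart00 -{1}x0 -yy0.
have y1y : y1 <= y by have := ler_norm (- y); rewrite normrN /y1; clear H1 H2 pr inb stepnu steptau; lra.
have z0 : `|0 : R| <= dl by rewrite normr0 ltW.
have Hs : `|- s| <= dl by rewrite normrN gtr0_norm.
have S1 : `|psi (chart x y1) - psi (chart x y)| <= eps * `|y1 - y|.
  apply: stepnu => // t t01.
  have [down _] := H1 x y (le_trans Hx dl1) (le_trans Hy dl1).
  apply: down => //; first exact: le_trans (norm_segment t01 Hy Hy1) dl1.
  by move/andP: t01 => [t0 _]; rewrite gerDl mulr_ge0_le0 // subr_le0.
have S2 : `|psi (chart 0 y1) - psi (chart x y1)| <= eps * `|0 - x|.
  apply: steptau => // t /andP[t0 t1].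
  have E : x + t * (0 - x) = (1 - t) * x by ring.
  have nE : `|(1 - t) * x| <= `|x|.
    by rewrite normrM ger0_norm ?subr_ge0 // ler_piMl // lerBlDr lerDl.
  have [_ cone] := H1 ((1 - t) * x) y1 (le_trans (le_trans nE Hx) dl1) (le_trans Hy1 dl1).
  by rewrite E; apply: cone => //; rewrite /y1; clear H1 H2 pr inb S1; lra.
have S3 : `|psi (chart 0 (- s)) - psi (chart 0 y1)| <= eps * `|- s - y1|.
  apply: stepnu => // t t01.
  have neg : y1 + t * (- s - y1) < 0.
    have /andP[t0 t1] := t01.
    have -> : y1 + t * (- s - y1) = - ((1 - t) * (- y1) + t * s) by ring.
    rewrite oppr_lt0; have [->|tn0] := eqVneq t 0.
      by rewrite subr0 mul1r mul0r addr0 oppr_gt0.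
    apply: ltr_wpDl; first by rewrite mulr_ge0 ?subr_ge0 // oppr_ge0 ltW.
    by rewrite mulr_gt0 // lt_neqAle eq_sym tn0.
  have Ht := norm_segment t01 Hy1 Hs.
  have [_ cone] := H1 0 (y1 + t * (- s - y1)) (le_trans z0 dl1) (le_trans Ht dl1).
  by apply: cone => //; rewrite normr0 oppr0 ltW.
have -> : psi (chart x y) - psi (chart 0 (- s)) =
  - (psi (chart x y1) - psi (chart x y)) - (psi (chart 0 y1) - psi (chart x y1))
  - (psi (chart 0 (- s)) - psi (chart 0 y1)) by ring.
apply: le_trans (ler_normB _ _) _.
apply: (@le_trans _ _ (eps * `|y1 - y| + eps * `|0 - x| + eps * `|- s - y1|)).
  apply: lerD => //; apply: le_trans (ler_normB _ _) _; rewrite normrN.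
  exact: lerD.
rewrite -!mulrDr ler_wpM2l ?(ltW eps0) // sub0r normrN.
have B1 : `|y1 - y| <= `|y1| + `|y| by exact: ler_normB.
have B2 : `|- s - y1| <= s + `|y1|.
  by rewrite (le_trans (ler_normB _ _)) // normrN gtr0_norm.
clear H1 H2 pr inb S1 S2 S3; lra.
Qed.

(** Along the paths of psi_step, psi varies by little compared with their
    length.  So psi has a limit along the normal line, by the Cauchy criterion,
    and near p it differs from this limit by a small multiple of the distance
    to p. *)
Theorem boundary_expansion : exists c0 : R, forall eps, 0 < eps ->
  \forall z \near p, D z ->
    `|phi z - c0 - (G0 * (z 0 0 - p 0 0) + G1 * (z 1 0 - p 1 0))| <= eps * `|z - p|.
Proof.
pose k s := psi (chart 0 (- s)).
have [d1 d10 H1] := psi_step ltr01.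
have [d2 d20 H2] := chart_domain.
have DS s : 0 < s <= d2 -> D (chart 0 (- s)).
  move=> /andP[s0 sd]; have [||_ cone] := H2 0 (- s).
  - by rewrite normr0 ltW.
  - by rewrite normrN gtr0_norm.
  - by apply: cone; rewrite ?normr0 ?oppr0 ?oppr_le0 ?oppr_lt0 // ltW.
have kc : cvg (k @ (0 : R)^'+).
  apply: cauchy_cvg; apply/cauchy_exP => e e_gt0.
  pose s0 := Num.min (Num.min d1 d2) (e / 8).
  have s00 : 0 < s0 by rewrite !lt_min d10 d20 divr_gt0.
  have s01 : s0 <= d1 by rewrite !ge_min lexx.
  have s02 : s0 <= d2 by rewrite !ge_min lexx orbT.
  have s03 : s0 <= e / 8 by rewrite !ge_min lexx !orbT.
  exists (k s0); rewrite /= ; near=> s.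
  have s_gt0 : 0 < s by near: s; exact: nbhs_right_gt.
  have ss0 : s <= s0 by near: s; exact: nbhs_right_le.
  have := H1 0 (- s0) s; rewrite normr0 add0r normrN (gtr0_norm s00) mul1r.
  rewrite -ball_normE /= => /(_ s01) /(_ _) K.
  apply: le_lt_trans (K _ _) _; first by rewrite s_gt0 (le_trans ss0).
    by apply: DS; rewrite s00.
  lra.
pose c0 := lim (k @ (0 : R)^'+).
have kl : k @ (0 : R)^'+ --> c0 by [].
have [C C0 HC] := chart_surj.
exists c0 => eps eps0.
pose eps' := eps / (8 * C).
have C8 : 0 < 8 * C by rewrite mulr_gt0.
have eps'0 : 0 < eps' by rewrite divr_gt0.
have [dl dl0 H] := psi_step eps'0.
have nz : \forall z \near p, `|z - p| <= dl / (2 * C).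
  have : 0 < dl / (2 * C) by rewrite divr_gt0 // mulr_gt0.
  by move=> Hd; near=> z; rewrite distrC; near: z; exact: cvgr_dist_le.
apply: filterS nz => z Hz Dz.
have [x [y [zE Hx Hy]]] := HC z.
have Cz : C * `|z - p| <= dl / 2.
  move: Hz; rewrite ler_pdivlMr ?mulr_gt0 //; lra.
have -> : phi z - c0 - (G0 * (z 0 0 - p 0 0) + G1 * (z 1 0 - p 1 0)) = psi z - c0.
  by rewrite /psi /lin; ring.
apply/ler_addgt0Pr => eta eta0.
have eta2 : 0 < eta / 2 by rewrite divr_gt0.
have [s [[Ks s1] s2]] : exists s, (`|c0 - k s| <= eta / 2 /\ s <= Num.min dl (eta / (2 * eps'))) /\ 0 < s.
  have m0 : 0 < Num.min dl (eta / (2 * eps')) by rewrite lt_min dl0 divr_gt0 // mulr_gt0.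
  have N1 : \forall s \near (0 : R)^'+, `|c0 - k s| <= eta / 2.
    by move/cvgrPdist_le : kl; apply.
  have [s [[? ?] ?]] := filter_ex (filterI (filterI N1 (nbhs_right_le m0)) (nbhs_right_gt (0 : R))).
  by exists s.
have {s1} [s1 s3] : s <= dl /\ s <= eta / (2 * eps').
  by move: s1; rewrite le_min => /andP[].
have e3 : eps' * s <= eta / 2.
  have e2 : 0 < 2 * eps' by rewrite mulr_gt0.
  move: s3; rewrite ler_pdivlMr // => s3.
  have E : s * (2 * eps') = 2 * (eps' * s) by ring.
  lra.
have := H x y s; rewrite -zE s2 s1 => /(_ _ isT Dz) Hs.
have {}Hs : `|psi z - k s| <= eps' * (4 * (`|x| + `|y|) + s) by apply: Hs; lra.
have -> : psi z - c0 = (psi z - k s) - (c0 - k s) by ring.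
apply: le_trans (ler_normB _ _) _.
apply: (@le_trans _ _ (eps' * (4 * (`|x| + `|y|) + s) + eta / 2)); first exact: lerD.
have E1 : eps' * (`|x| + `|y|) <= eps' * (2 * (C * `|z - p|)).
  by rewrite ler_wpM2l ?(ltW eps'0) //; lra.
have E2 : eps' * (8 * C) = eps by rewrite /eps' divfK // lt0r_neq0.
rewrite -E2; clear HC H H1 H2 DS kl Hs zE; lra.
Unshelve. all: by end_near. Qed.

End chart.
End boundary.

(** * Boundary values of a function with normal gradient *)

Section trace.
Variables (R : realType) (D : set 'cV[R]_2) (phi : 'cV[R]_2 -> R).
Hypothesis oD : open D.
Notation e0 := (e0 R).
Notation e1 := (e1 R).

Definition trace (q : 'cV[R]_2) (c : R) := phi @ within D (nbhs q) --> c.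

Lemma trace_unique q c c' : closure D q -> trace q c -> trace q c' -> c = c'.
Proof.
move=> cq H H'; apply/eqP; rewrite -subr_eq0 -normr_le0.
apply/ler_addgt0Pr => eps eps0; rewrite add0r.
have e2 : 0 < eps / 2 by rewrite divr_gt0.
have N := near_within H (nbhsx_ballx c _ e2).
have N' := near_within H' (nbhsx_ballx c' _ e2).
have [|z _ [B B']] := @closure_near _ D q
    (fun z => ball c (eps / 2) (phi z) /\ ball c' (eps / 2) (phi z)) cq.
  by apply: filterS2 N N' => z Hz Hz' Dz; split; [exact: Hz|exact: Hz'].
have -> : c - c' = (c - phi z) - (c' - phi z) by ring.
apply: le_trans (ler_normB _ _) _; rewrite (splitr eps).
by apply: lerD; apply: ltW.
Qed.

Definition expansion (p : 'cV[R]_2) (c0 G0 G1 : R) := forall eps, 0 < eps ->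
  \forall z \near p, D z ->
    `|phi z - c0 - (G0 * (z 0 0 - p 0 0) + G1 * (z 1 0 - p 1 0))| <= eps * `|z - p|.

Lemma lin_bound (G0 G1 : R) (w : 'cV[R]_2) :
  `|G0 * w 0 0 + G1 * w 1 0| <= (`|G0| + `|G1|) * `|w|.
Proof.
apply: le_trans (ler_normD _ _) _; rewrite !normrM mulrDl.
by apply: lerD; rewrite ler_wpM2l // coord_le_norm.
Qed.

Lemma expansion_trace p c0 G0 G1 : expansion p c0 G0 G1 -> trace p c0.
Proof.
move=> E; apply/cvgrPdistC_le => eps eps0.
pose K := 1 + (`|G0| + `|G1|).
have K0 : 0 < K by rewrite ltr_pwDl // addr_ge0.
have H := E 1 ltr01.
have nz : \forall z \near p, `|z - p| <= eps / K.
  have eK : 0 < eps / K by rewrite divr_gt0.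
  apply: filterS (nbhsx_ballx p _ eK) => z.
  by rewrite -ball_normE /= distrC => /ltW.
rewrite /within /=; apply: filterS2 H nz => z Hz Hzp Dz.
have {}Hz := Hz Dz.
have L := lin_bound G0 G1 (z - p); rewrite !mxE in L.
set l := G0 * (z 0 0 - p 0 0) + G1 * (z 1 0 - p 1 0) in Hz L *.
have -> : phi z - c0 = (phi z - c0 - l) + l by ring.
apply: le_trans (ler_normD _ _) _; apply: le_trans (lerD Hz L) _.
by rewrite -mulrDl -/K mulrC -ler_pdivlMr.
Qed.

(** The estimate at the points of D near q passes to the limit at q. *)
Lemma expansion_boundary p c0 G0 G1 : expansion p c0 G0 G1 -> forall eps, 0 < eps ->
  \forall q \near p, frontier D q -> forall cq, trace q cq ->
    `|cq - c0 - (G0 * (q 0 0 - p 0 0) + G1 * (q 1 0 - p 1 0))| <= eps * `|q - p|.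
Proof.
move=> E eps eps0; apply: filterS (near_near (E eps eps0)) => q Hq.
move=> /(frontierE _ oD)[clq _] cq Tq.
apply/ler_addgt0Pr => eta eta0.
pose K := 1 + (`|G0| + `|G1|) + eps.
have K0 : 0 < K by rewrite addr_gt0 // ltr_pwDl // addr_ge0.
have eK : 0 < eta / K by rewrite divr_gt0.
have [|z Dz [[H1 H2] H3]] := @closure_near _ D q (fun z =>
    (ball cq (eta / K) (phi z) /\ ball q (eta / K) z) /\
    `|phi z - c0 - (G0 * (z 0 0 - p 0 0) + G1 * (z 1 0 - p 1 0))| <= eps * `|z - p|) clq.
  apply: filterS3 (near_within Tq (nbhsx_ballx cq _ eK)) (nbhsx_ballx q _ eK) Hq.
  by move=> z A B C Dz; split; [split => //; exact: A|exact: C].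
rewrite /ball /= in H1; rewrite -ball_normE /= in H2.
have L := lin_bound G0 G1 (q - z); rewrite !mxE in L.
set lz := G0 * (z 0 0 - p 0 0) + G1 * (z 1 0 - p 1 0) in H3.
have -> : cq - c0 - (G0 * (q 0 0 - p 0 0) + G1 * (q 1 0 - p 1 0)) =
  (cq - phi z) + (phi z - c0 - lz) - (G0 * (q 0 0 - z 0 0) + G1 * (q 1 0 - z 1 0)).
  by rewrite /lz; ring.
have zp : `|z - p| <= `|q - p| + `|q - z|.
  have -> : z - p = (q - p) - (q - z) by apply/matrixP => i j; rewrite !mxE; ring.
  exact: ler_normB.
apply: le_trans (ler_normB _ _) _.
apply: le_trans (lerD (ler_normD _ _) L) _.
have A1 : eps * `|z - p| <= eps * `|q - p| + eps * (eta / K).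
  rewrite -mulrDr ler_wpM2l ?(ltW eps0) //; lra.
have A2 : (`|G0| + `|G1|) * `|q - z| <= (`|G0| + `|G1|) * (eta / K).
  by rewrite ler_wpM2l ?addr_ge0 // ltW.
have A3 : eta = eta / K + (`|G0| + `|G1|) * (eta / K) + eps * (eta / K).
  rewrite -[in LHS](divfK (lt0r_neq0 K0) eta) {2}/K; ring.
lra.
Qed.

Section at_point.
Variables (p : 'cV[R]_2) (rho : 'cV[R]_2 -> R) (U : set 'cV[R]_2).
Hypotheses (Fp : frontier D p) (oU : open U) (Up : U p).
Hypotheses (rhok : Ck_upto 1 U U U rho) (DU : forall x, U x -> (D x <-> rho x < 0)).
Hypothesis rn0 : 0 < ('D_e0 rho p) ^+ 2 + ('D_e1 rho p) ^+ 2.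

Let r0 := 'D_e0 rho p.
Let r1 := 'D_e1 rho p.
Let ch := chart p rho.
Let K := `|tangent_vec p rho| + `|normal_vec p rho|.

Let K0 : 0 <= K. Proof. by rewrite addr_ge0. Qed.

Let ch_dist x y x' y' : `|ch x y - ch x' y'| <= K * (`|x - x'| + `|y - y'|).
Proof. exact: chart_dist. Qed.

Let ch00 : ch 0 0 = p. Proof. exact: chart00. Qed.

Let lin_ch (G0 G1 : R) x y : G0 * (ch x y 0 0 - p 0 0) + G1 * (ch x y 1 0 - p 1 0) =
  x * (G0 * r1 - G1 * r0) + y * (G0 * r0 + G1 * r1).
Proof. by rewrite /ch /chart /tangent_vec /normal_vec !mxE /= -/r0 -/r1; ring. Qed.

(** At boundary points near p the expansion of phi, which is zero there, reduces
    up to small terms to its tangential part. *)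
Lemma tangential_derivative_zero c0 G0 G1 : expansion p c0 G0 G1 ->
  (forall q, frontier D q -> trace q 0) -> G0 * r1 - G1 * r0 = 0.
Proof.
move=> E T0.
have [clp _] := (frontierE _ oD).1 Fp.
have c00 : c0 = 0 by apply: trace_unique clp (expansion_trace E) (T0 p Fp).
apply/eqP; rewrite -normr_le0; apply/ler_addgt0Pr => eta eta0; rewrite add0r.
set t := G0 * r1 - G1 * r0; set n := G0 * r0 + G1 * r1.
pose M := `|n| + 2 * K + 1.
have M0 : 0 < M by rewrite ltr_wpDl // addr_ge0 // mulr_ge0.
pose eps := Num.min 1 (eta / M).
have eps0 : 0 < eps by rewrite lt_min ltr01 divr_gt0.
have eps1 : eps <= 1 by rewrite ge_min lexx.
have epsM : eps * M <= eta by rewrite -ler_pdivlMr // ge_min lexx orbT.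
have [dl dl0 [ex _]] := chart_boundary oD Fp oU Up rhok DU rn0 eps0.
have [r /= r_gt0 pr] := (nbhs_ballP p _).1 (expansion_boundary E eps0).
pose x := Num.min dl (r / (2 * (K + 1))).
have K1 : 0 < 2 * (K + 1) by rewrite mulr_gt0 // ltr_wpDl.
have x0 : 0 < x by rewrite lt_min dl0 divr_gt0.
have xdl : x <= dl by rewrite ge_min lexx.
have xr : x * (2 * (K + 1)) <= r by rewrite -ler_pdivlMr // ge_min lexx orbT.
have nx : `|x| = x by rewrite gtr0_norm.
have [|y [yx _] Fq] := ex x; first by rewrite nx.
rewrite -/ch nx in yx Fq.
have yx' : `|y| <= x by apply: le_trans yx _; rewrite ler_piMl // ltW.
have dq : `|ch x y - p| <= K * (2 * x).
  rewrite -ch00; apply: le_trans (ch_dist _ _ _ _) _; rewrite !subr0 nx.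
  by rewrite ler_wpM2l //; lra.
have bq : ball p r (ch x y).
  rewrite -ball_normE /= distrC; apply: le_lt_trans dq _; apply: lt_le_trans xr.
  have -> : x * (2 * (K + 1)) = K * (2 * x) + 2 * x by ring.
  by rewrite ltrDl mulr_gt0.
have := pr _ bq Fq 0 (T0 _ Fq).
rewrite c00 !sub0r oppr0 add0r normrN lin_ch -/t -/n => B.
have B2 : `|x * t| <= eps * (K * (2 * x)) + eps * x * `|n|.
  have -> : x * t = (x * t + y * n) - y * n by ring.
  apply: le_trans (ler_normB _ _) _; apply: lerD.
    by apply: le_trans B _; rewrite ler_wpM2l // ltW.
  by rewrite normrM ler_wpM2r.
rewrite -(ler_pM2l x0) -[in leLHS]nx -normrM; apply: le_trans B2 _.
apply: (@le_trans _ _ (x * (eps * M))); last by rewrite ler_wpM2l // ltW.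
have -> : x * (eps * M) = eps * (K * (2 * x)) + eps * x * `|n| + eps * x.
  by rewrite /M; ring.
by rewrite lerDl mulr_ge0 ?ltW.
Qed.

(** The first order part is then a multiple of the normal coordinate, and along
    the boundary this coordinate is small compared with the distance to p. *)
Lemma boundary_values_flat c0 G0 G1 : expansion p c0 G0 G1 ->
  G0 * r1 - G1 * r0 = 0 -> forall eps, 0 < eps ->
  \forall q \near p, frontier D q -> forall cq, trace q cq ->
    `|cq - c0| <= eps * `|q - p|.
Proof.
move=> E t0 eps eps0; set n := G0 * r0 + G1 * r1.
have e2 : 0 < eps / 2 by rewrite divr_gt0.
have [C C0 HC] := chart_surj rn0.
pose e3 := eps / (2 * C * (`|n| + 1)).
have n1 : 0 < `|n| + 1 by rewrite ltr_wpDl.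
have Cn : 0 < 2 * C * (`|n| + 1) by rewrite !mulr_gt0.
have e30 : 0 < e3 by rewrite divr_gt0.
have [dl dl0 [_ lip]] := chart_boundary oD Fp oU Up rhok DU rn0 e30.
have nq : \forall q \near p, `|q - p| <= dl / C.
  have dC : 0 < dl / C by rewrite divr_gt0.
  apply: filterS (nbhsx_ballx p _ dC) => z.
  by rewrite -ball_normE /= distrC => /ltW.
apply: filterS2 nq (expansion_boundary E e2) => q Hq H Fq cq Tq.
have [x [y [qE Hx Hy]]] := HC q.
have Cq : C * `|q - p| <= dl by move: Hq; rewrite ler_pdivlMr // mulrC.
have {}H := H Fq cq Tq.
have yx : `|y| <= e3 * `|x|.
  have := lip x y 0 0; rewrite -qE -/(ch 0 0) ch00 !subr0 normr0; apply => //.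
  - exact: le_trans Cq.
  - exact: le_trans Cq.
  - exact: ltW.
  - exact: ltW.
rewrite {1}qE {1}qE lin_ch t0 mulr0 add0r -/n in H.
have -> : cq - c0 = (cq - c0 - y * n) + y * n by ring.
apply: le_trans (ler_normD _ _) _; rewrite normrM.
have B : `|y| * `|n| <= eps / 2 * `|q - p|.
  apply: (@le_trans _ _ (e3 * (C * `|q - p|) * (`|n| + 1))).
    apply: ler_pM => //; last by rewrite lerDl.
    by apply: le_trans yx _; rewrite ler_wpM2l // ltW.
  have -> : e3 * (C * `|q - p|) * (`|n| + 1) = e3 * (2 * C * (`|n| + 1)) * `|q - p| / 2.
    by field.
  by rewrite /e3 divfK ?lt0r_neq0 // mulrAC.
lra.
Qed.

(** The boundary is near p the graph of a Lipschitz function of the tangential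
    coordinate, and the boundary value has derivative zero with respect to it. *)
Lemma boundary_values_locally_constant (cb : 'cV[R]_2 -> R) :
  (forall q, frontier D q -> forall eps, 0 < eps ->
     \forall q' \near q, frontier D q' -> `|cb q' - cb q| <= eps * `|q' - q|) ->
  \forall q \near p, frontier D q -> cb q = cb p.
Proof.
move=> flat.
have [dl dl0 [ex lip]] := chart_boundary oD Fp oU Up rhok DU rn0 ltr01.
have /choice[gam gamP] : forall x : R, exists y : R, `|x| <= dl ->
    [/\ `|y| <= `|x|, `|y| <= dl & frontier D (ch x y)].
  move=> x; have [Hx|Hx] := leP `|x| dl; last by exists 0.
  by have [y [yx yd] F] := ex x Hx; exists y; rewrite mul1r in yx.
pose k (x : R) : R := cb (ch x (gam x)).
have dk (x : R) : `|x| < dl -> is_derive x 1 k 0.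
  move=> Hx; apply: is_derive_bound => eps eps0.
  have [gx gd Fx] := gamP x (ltW Hx).
  pose e := eps / (2 * (K + 1)).
  have K1 : 0 < 2 * (K + 1) by rewrite mulr_gt0 // ltr_wpDl.
  have e_gt0 : 0 < e by rewrite divr_gt0.
  have [r /= r_gt0 qr] := (nbhs_ballP _ _).1 (flat _ Fx e e_gt0).
  have na : \forall a \near (0 : R), `|a| < Num.min (dl - `|x|) (r / (2 * (K + 1))).
    by apply: nbhs0_lt; rewrite lt_min subr_gt0 Hx divr_gt0.
  apply: filterS na => a; rewrite lt_min => /andP[a1 a2].
  have xa : `|x + a| <= dl by apply: le_trans (ler_normD _ _) _; lra.
  have [ga gad Fa] := gamP (x + a) xa.
  have dg : `|gam (x + a) - gam x| <= `|a|.
    have := lip _ _ _ _ xa gad (ltW Hx) gd Fa Fx.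
    by rewrite mul1r addrAC subrr add0r.
  have dist : `|ch (x + a) (gam (x + a)) - ch x (gam x)| <= K * (2 * `|a|).
    apply: le_trans (ch_dist _ _ _ _) _; rewrite addrAC subrr add0r.
    by rewrite ler_wpM2l //; lra.
  rewrite mulr0 subr0 -[a *: 1]/(a * 1) mulr1.
  have a_ge0 := normr_ge0 a.
  have := qr (ch (x + a) (gam (x + a))) _ Fa; rewrite -/(k _) -/(k _) => B.
  apply: le_trans (B _) _.
    rewrite -ball_normE /= distrC; apply: le_lt_trans dist _.
    move: a2; rewrite ltr_pdivlMr // => a2; apply: le_lt_trans a2.
    have -> : `|a| * (2 * (K + 1)) = K * (2 * `|a|) + 2 * `|a| by ring.
    by rewrite lerDl mulr_ge0.
  apply: (@le_trans _ _ (e * (K * (2 * `|a|)))); first by rewrite ler_wpM2l // ltW.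
  apply: (@le_trans _ _ (e * (2 * (K + 1)) * `|a|)).
    have -> : e * (2 * (K + 1)) * `|a| = e * (K * (2 * `|a|)) + e * (2 * `|a|) by ring.
    rewrite lerDl; apply: mulr_ge0; [exact: ltW|exact: mulr_ge0].
  by rewrite /e divfK // lt0r_neq0.
have [C C0 HC] := chart_surj rn0.
have nq : \forall q \near p, `|q - p| < dl / C.
  have dC : 0 < dl / C by rewrite divr_gt0.
  apply: filterS (nbhsx_ballx p _ dC) => z.
  by rewrite -ball_normE /= distrC.
apply: filterS nq => q Hq Fq.
have [x [y [qE Hx Hy]]] := HC q.
have Cq : C * `|q - p| < dl by move: Hq; rewrite ltr_pdivlMr // mulrC.
have xdl : `|x| < dl by exact: le_lt_trans Cq.
have ydl : `|y| <= dl by apply/ltW; exact: le_lt_trans Cq.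
have [gx gd Fx] := gamP x (ltW xdl).
have yE : y = gam x.
  rewrite qE in Fq.
  have := lip x y x (gam x) (ltW xdl) ydl (ltW xdl) gd Fq Fx.
  by rewrite subrr normr0 mulr0 normr_le0 subr_eq0 => /eqP.
have z0 : `|0 : R| <= dl by rewrite normr0 ltW.
have [g0 _ _] := gamP 0 z0.
have g00 : gam 0 = 0 by apply/eqP; rewrite -normr_le0; move: g0; rewrite normr0.
have -> : cb p = k 0 by rewrite /k g00 ch00.
have -> : cb q = k x by rewrite /k -yE qE.
have D0 (s : R) : 0 <= s <= 1 -> is_derive (0 + (s * x) *: (1 : R)) 1 k 0.
  move=> /andP[s0 s1]; rewrite add0r -[_ *: _]/(_ * _) mulr1; apply: dk.
  by apply: le_lt_trans xdl; rewrite normrM ger0_norm // ler_piMl.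
have [s /D0 []//|s /D0 [_ ->]] := @mean_value_line R _ k 0 1 x.
rewrite mulr0 add0r -[_ *: _]/(_ * _) mulr1 => /eqP.
by rewrite subr_eq0 => /eqP.
Qed.

End at_point.

Lemma frontier_compact : bounded_set D -> compact (frontier D).
Proof.
move=> [M [Mr HM]].
have DM x : D x -> `|x| <= M + 1 by apply: HM; rewrite ltrDl.
pose f (z : R * R) := col2 z.1 z.2.
have cf : continuous f.
  have -> : f = (fun z => z.1 *: e0 + z.2 *: e1).
    by apply/funext => z; apply: cv2P; rewrite !mxE /= ?mulr1 ?mulr0 ?addr0 ?add0r.
  move=> z; apply: cvgD; apply: cvgZr_tmp; [exact: cvg_fst|exact: cvg_snd].
pose B := f @` (`[- (M + 1), M + 1]%classic `*` `[- (M + 1), M + 1]%classic).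
have cB : compact B.
  apply: continuous_compact; first exact: continuous_subspaceT.
  by apply: compact_setX; exact: segment_compact.
apply: (subclosed_compact _ cB).
  rewrite (_ : frontier D = closure D `&` ~` D); last first.
    by apply/seteqP; split => x /(frontierE _ oD).
  by apply: closedI; [exact: closed_closure|exact: open_closedC].
move=> x /(frontierE _ oD)[cx _].
have xM : `|x| <= M + 1.
  apply/ler_addgt0Pr => eps eps0.
  have [z [Dz]] := cx _ (nbhsx_ballx x eps eps0).
  rewrite -ball_normE /= => xz.
  have -> : x = z + (x - z) by rewrite addrC subrK.
  by apply: le_trans (ler_normD _ _) _; apply: lerD; [exact: DM|exact: ltW].
exists (x 0 0, x 1 0); last by rewrite /f -col2_coord.
have [c0 c1] : `|x 0 0| <= M + 1 /\ `|x 1 0| <= M + 1.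
  by split; apply: le_trans xM; exact: coord_le_norm.
by split => /=; rewrite in_itv /= -ler_norml.
Qed.

(** By compactness, the boundary values other than a given one, c, stay at a
    distance at least eta > 0 from it.  Then the truncation at 1 of
    |phi - c| / eta tends to 0 or to 1 at each boundary point, and
    boundary_dichotomy forbids that both occur. *)
Theorem boundary_values_constant (cb : 'cV[R]_2 -> R) :
  domain D -> bounded_set D -> simply_connected R D ->
  (forall x, D x -> {for x, continuous phi}) ->
  (forall q, frontier D q -> trace q (cb q)) ->
  (forall p, frontier D p -> \forall q \near p, frontier D q -> cb q = cb p) ->
  exists c, forall q, frontier D q -> trace q c.
Proof.
move=> dD bD scD cphi tr loc.
have [[p Fp]|noF] := pselect (exists p, frontier D p); last first.
  by exists 0 => q Fq; case: noF; exists q.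
exists (cb p) => q0 Fq0.
have [<-|neq] := pselect (cb q0 = cb p); first exact: tr.
exfalso.
pose Q := frontier D `&` [set q | cb q <> cb p].
have clF : closed (frontier D).
  rewrite (_ : frontier D = closure D `&` ~` D); last first.
    by apply/seteqP; split => x /(frontierE _ oD).
  by apply: closedI; [exact: closed_closure|exact: open_closedC].
have cQ : compact Q.
  apply: (subclosed_compact _ (frontier_compact bD)); last by move=> x [].
  move=> x clx.
  have Fx : frontier D x.
    by apply: clF; apply: closureS clx => z [].
  split => // cx; have [|z [Fz nz] Ez] := @closure_near _ Q x (fun z => cb z = cb p) clx.
    by apply: filterS (loc x Fx) => z Hz [Fz _]; rewrite Hz.
  exact: nz.
have wc : {within Q, continuous (fun q => `|cb q - cb p|)}.
  apply/subspace_continuousP => x [Fx _].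
  apply: (cvg_trans _ (cvg_cst (F := within Q (nbhs x)) `|cb x - cb p|)).
  apply: near_eq_cvg; rewrite /within /=.
  by apply: filterS (loc x Fx) => z Hz [Fz _]; congr `|_ - _|; rewrite Hz.
have [q1 /set_mem[F1 n1] min] := compact_EVT_min (ex_intro _ q0 (conj Fq0 neq)) cQ wc.
pose eta := `|cb q1 - cb p|.
have eta0 : 0 < eta by rewrite normr_gt0 subr_eq0; apply/eqP.
pose f z := clampI (`|phi z - cb p| / eta).
have cl (F : set_system 'cV[R]_2) (FF : Filter F) (c : R) : phi @ F --> c ->
    f @ F --> clampI (`|c - cb p| / eta).
  move=> H.
  have H1 : (fun z => `|phi z - cb p| / eta) @ F --> `|c - cb p| / eta.
    apply: cvgM; last exact: cvg_cst.
    by apply: cvg_norm; apply: cvgB => //; exact: cvg_cst.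
  exact: (cvg_comp (fun z => `|phi z - cb p| / eta) (@clampI R) H1
    (@clampI_continuous R (`|c - cb p| / eta))).
have to0 : f @ within D (nbhs p) --> (0 : R).
  have := cl _ (within_filter _ (nbhs_filter _)) _ (tr p Fp).
  by rewrite subrr normr0 mul0r clampI_le0.
have to1 q : frontier D q -> cb q <> cb p -> f @ within D (nbhs q) --> (1 : R).
  move=> Fq nq; have := cl _ (within_filter _ (nbhs_filter _)) _ (tr q Fq); rewrite clampI_ge1 //.
  by rewrite ler_pdivlMr // mul1r; apply: min; apply/mem_set; split.
apply: (@boundary_dichotomy R D f p q0) => //.
- by move=> x Dx; exact: (cl _ (nbhs_filter x) _ (cphi x Dx)).
- move=> x Fx; have [Ex|nx] := pselect (cb x = cb p); last by right; exact: to1.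
  by left; have := cl _ (within_filter _ (nbhs_filter _)) _ (tr x Fx); rewrite Ex subrr normr0 mul0r clampI_le0.
- exact: to1.
Qed.

End trace.

Lemma defining_chart (R : realType) (D : set 'cV[R]_2) (p : 'cV[R]_2) rho :
  defining_function D p rho -> exists U : set 'cV[R]_2,
  [/\ open U, U p, Ck_upto 1 U U U rho, (forall x, U x -> (D x <-> rho x < 0)) &
      0 < ('D_(e0 R) rho p) ^+ 2 + ('D_(e1 R) rho p) ^+ 2].
Proof.
move=> [U [oU Up sU gn0 HU]]; exists U.
have sU1 := sU 1%N; split; [exact: oU|exact: Up|exact: sU1|exact: HU|].
apply: sum_sqr_gt0 => -[E0 E1].
move/eqP: gn0; apply; apply: cv2P; rewrite !mxE; first exact: E0.
exact: E1.
Qed.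

(** * Helical geometry *)

Lemma scaleE (R : realType) (a b : R) : a *: b = a * b.
Proof. by []. Qed.

(** The rules in pointwise form, which unification recognises in any formula. *)
Section arith.
Variables (R : realType) (V : normedModType R) (z e : V) (f g : V -> R) (a b : R).
Hypotheses (df : is_derive z e f a) (dg : is_derive z e g b).

Lemma dD : is_derive z e (fun y : V => f y + g y) (a + b). Proof. exact: is_deriveD. Qed.
Lemma dB : is_derive z e (fun y : V => f y - g y) (a - b). Proof. exact: is_deriveB. Qed.
Lemma dN : is_derive z e (fun y : V => - f y) (- a). Proof. exact: is_deriveN. Qed.
Lemma dM : is_derive z e (fun y : V => f y * g y) (f z * b + g z * a).
Proof. exact: is_deriveM. Qed.
Lemma dcst (c : R) : is_derive z e (fun _ => c) 0. Proof. exact: is_derive_cst. Qed.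
Lemma dX2 : is_derive z e (fun y : V => f y ^+ 2) (2 * f z * a).
Proof.
have -> : 2 * f z * a = f z * a + f z * a by ring.
by under eq_fun do rewrite expr2; exact: is_deriveM.
Qed.
Lemma dV : f z != 0 -> is_derive z e (fun y : V => (f y)^-1) (- (f z ^+ 2)^-1 * a).
Proof.
move=> fz; apply: (is_derive_compl (g := GRing.inv) _ df).
apply: is_derive_eq; first exact: (is_deriveV (f := id) fz (is_derive_id (f z) 1)).
by rewrite -[LHS]/(_ * _) mulr1.
Qed.
End arith.

Ltac dtac := do ?[exact: dcst | eassumption
  | apply: dD | apply: dB | apply: dN | apply: dM | apply: dX2].

Section coordinates.
Variables (R : realType) (h : R).
Implicit Types (x u : 'cV[R]_3) (y : 'cV[R]_2).

Lemma cv3P x u : x 0 0 = u 0 0 -> x 1 0 = u 1 0 -> x 2 0 = u 2 0 -> x = u.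
Proof.
by move=> E0 E1 E2; apply/matrixP => i j; rewrite ord1; move: i; exact: ord3_ind.
Qed.

Lemma ord3_0 : (0 : 'I_3) = lshift 1 (0 : 'I_2). Proof. exact/val_inj. Qed.
Lemma ord3_1 : (1 : 'I_3) = lshift 1 (1 : 'I_2). Proof. exact/val_inj. Qed.
Lemma ord3_2 : (2 : 'I_3) = rshift 2 (0 : 'I_1). Proof. exact/val_inj. Qed.

Lemma pointE y (r : R) :
  (point y r 0 0 = y 0 0) * (point y r 1 0 = y 1 0) * (point y r 2 0 = r).
Proof.
split; [split|].
- by rewrite [in LHS]ord3_0; exact: col_mxEu.
- by rewrite [in LHS]ord3_1; exact: col_mxEu.
- by rewrite [in LHS]ord3_2; apply: etrans (col_mxEd _ _ _ _) _; rewrite mxE.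
Qed.

Lemma horE x : (hor x 0 0 = x 0 0) * (hor x 1 0 = x 1 0).
Proof. by rewrite /hor !mxE; split; congr (x _ _); exact/val_inj. Qed.

Lemma col3E (a b c : R) :
  (col3 a b c 0 0 = a) * (col3 a b c 1 0 = b) * (col3 a b c 2 0 = c).
Proof. by rewrite !mxE. Qed.

Lemma rotE (th : R) y :
  ((rot th *m y) 0 0 = cos th * y 0 0 + sin th * y 1 0) *
  ((rot th *m y) 1 0 = - sin th * y 0 0 + cos th * y 1 0).
Proof.
by rewrite !mxE !big_ord_recl !big_ord0 !mxE /= !addr0; split;
  rewrite (_ : lift ord0 ord0 = 1) //; exact/val_inj.
Qed.

Lemma rot3E (th : R) u :
  ((rot3 th *m u) 0 0 = cos th * u 0 0 + sin th * u 1 0) *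
  ((rot3 th *m u) 1 0 = - sin th * u 0 0 + cos th * u 1 0) *
  ((rot3 th *m u) 2 0 = u 2 0).
Proof.
have -> : u = point (hor u) (u 2 0) by apply: cv3P; rewrite pointE ?horE.
rewrite /rot3 /point (mul_block_col (rot th) 0 0 1%:M) !mul0mx addr0 add0r mul1mx.
rewrite -[col_mx _ _]/(point _ _) -[col_mx (hor u) _]/(point (hor u) (u 2 0)).
by rewrite !pointE !rotE.
Qed.

Lemma helixE (th : R) x :
  (helix h th x 0 0 = cos th * x 0 0 + sin th * x 1 0) *
  (helix h th x 1 0 = - sin th * x 0 0 + cos th * x 1 0) *
  (helix h th x 2 0 = x 2 0 + h * th).
Proof.
split; [split|]; rewrite /helix mxE rot3E mxE /= ?addr0 //.
Qed.

Lemma xiE y : (xi h y 0 0 = y 1 0) * (xi h y 1 0 = - y 0 0) * (xi h y 2 0 = h).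
Proof. by rewrite !mxE. Qed.

Lemma sum2E (W : zmodType) (F : 'I_2 -> W) : \sum_i F i = F 0 + F 1.
Proof.
rewrite !big_ord_recl big_ord0 addr0.
by rewrite (_ : lift ord0 ord0 = 1) //; exact/val_inj.
Qed.

Lemma mat2E (a b c d : R) (u : 'cV[R]_2) :
  ((mat2 a b c d *m u) 0 0 = a * u 0 0 + b * u 1 0) *
  ((mat2 a b c d *m u) 1 0 = c * u 0 0 + d * u 1 0).
Proof. by rewrite !mxE !sum2E !mxE. Qed.

Lemma dot2E (a b : 'cV[R]_2) : dot a b = a 0 0 * b 0 0 + a 1 0 * b 1 0.
Proof. exact: sum2E. Qed.

Lemma sum3E (W : zmodType) (F : 'I_3 -> W) : \sum_i F i = F 0 + F 1 + F 2.
Proof.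
rewrite !big_ord_recl big_ord0 addr0 addrA.
rewrite (_ : lift ord0 ord0 = 1); last exact/val_inj.
by rewrite (_ : lift ord0 (lift ord0 ord0) = 2) //; exact/val_inj.
Qed.

Lemma dot3E x u : dot x u = x 0 0 * u 0 0 + x 1 0 * u 1 0 + x 2 0 * u 2 0.
Proof. exact: sum3E. Qed.

(** The point where the helix through x meets the plane of the cross-section. *)
Definition foot x : 'cV[R]_2 := rot (- ht x / h) *m hor x.

Lemma footE x :
  (foot x 0 0 = cos (x 2 0 / h) * x 0 0 - sin (x 2 0 / h) * x 1 0) *
  (foot x 1 0 = sin (x 2 0 / h) * x 0 0 + cos (x 2 0 / h) * x 1 0).
Proof.
by rewrite /foot !rotE !horE /ht mulNr cosN sinN opprK mulNr.
Qed.

Lemma cos_sin2 (th : R) : sin th ^+ 2 = 1 - cos th ^+ 2.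
Proof. by rewrite -(cos2Dsin2 th) addrAC subrr add0r. Qed.

Lemma rot_foot x :
  (cos (x 2 0 / h) * foot x 0 0 + sin (x 2 0 / h) * foot x 1 0 = x 0 0) *
  (- sin (x 2 0 / h) * foot x 0 0 + cos (x 2 0 / h) * foot x 1 0 = x 1 0).
Proof.
have S := cos_sin2 (x 2 0 / h).
by rewrite !footE; split; ring: S.
Qed.

Lemma foot_point y : foot (point y 0) = y.
Proof. by apply: cv2P; rewrite footE !pointE mul0r cos0 sin0; ring. Qed.

Hypothesis h0 : h != 0.

Lemma helix_foot x : helix h (x 2 0 / h) (point (foot x) 0) = x.
Proof.
apply: cv3P; rewrite helixE !pointE ?rot_foot // add0r mulrC divfK //.
Qed.

Lemma foot_helix (th : R) x : foot (helix h th x) = foot x.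
Proof.
have S := cos_sin2 th.
have E : (x 2 0 + h * th) / h = x 2 0 / h + th by field.
by apply: cv2P; rewrite !footE !helixE E cosD sinD; ring: S.
Qed.

Lemma Sm_coord n (i : 'I_n) : Sm (fun x : 'cV[R]_n => x i 0).
Proof. exact: (Sm_lin (l := mkl (@coord_linear R n i)) (@coord_continuous _ _ _ i 0)). Qed.

Lemma Sm_angle : Sm (fun x => cos (x 2 0 / h)) /\ Sm (fun x => sin (x 2 0 / h)).
Proof. by apply: Sm_cos_sin; apply: Sm_mul; [exact: Sm_coord|exact: Sm_cst]. Qed.

Lemma Sm_foot : Sm (fun x => foot x 0 0) /\ Sm (fun x => foot x 1 0).
Proof.
have [C S] := Sm_angle.
split; under eq_fun do rewrite footE.
- by apply: Sm_sub; apply: Sm_mul => //; exact: Sm_coord.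
- by apply: Sm_add; apply: Sm_mul => //; exact: Sm_coord.
Qed.

Lemma plane_coords V (Phi : V -> 'cV[R]_2) (P : (V -> R) -> Prop) :
  P (fun z => Phi z 0 0) -> P (fun z => Phi z 1 0) ->
  forall j : 'I_2, P (fun z => cvl R 1 j (Phi z)).
Proof.
move=> P0 P1 [[|[|//]] p] /=.
- by rewrite (_ : inord 0 = 0) //; apply/val_inj; rewrite /= inordK.
- by rewrite (_ : inord 1 = 1) //; apply/val_inj; rewrite /= inordK.
Qed.

Lemma foot_continuous : continuous foot.
Proof.
have [S0 S1] := Sm_foot.
apply: (frame_continuous (cv_frame R 1)).
apply: (@plane_coords _ foot (fun f => continuous f)); exact: Sm_continuous.
Qed.

Lemma space_coords V (Phi : V -> 'cV[R]_3) (P : (V -> R) -> Prop) :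
  P (fun z => Phi z 0 0) -> P (fun z => Phi z 1 0) -> P (fun z => Phi z 2 0) ->
  forall j : 'I_3, P (fun z => cvl R 2 j (Phi z)).
Proof.
move=> P0 P1 P2 [[|[|[|//]]] p] /=.
- by rewrite (_ : inord 0 = 0) //; apply/val_inj; rewrite /= inordK.
- by rewrite (_ : inord 1 = 1) //; apply/val_inj; rewrite /= inordK.
- by rewrite (_ : inord 2 = 2) //; apply/val_inj; rewrite /= inordK.
Qed.

Lemma space_continuous (V : normedModType R) (Phi : V -> 'cV[R]_3) :
  continuous (fun z => Phi z 0 0) -> continuous (fun z => Phi z 1 0) ->
  continuous (fun z => Phi z 2 0) -> continuous Phi.
Proof.
move=> c0 c1 c2; apply: (frame_continuous (cv_frame R 2)).
exact: (@space_coords _ Phi (fun f => continuous f)).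
Qed.

Lemma Sm_point (r : R) : [/\ Sm (fun y => point y r 0 0),
  Sm (fun y => point y r 1 0) & Sm (fun y => point y r 2 0)].
Proof.
by split; under eq_fun do rewrite pointE; [exact: Sm_coord|exact: Sm_coord|exact: Sm_cst].
Qed.

Lemma point_continuous (r : R) : continuous (fun y => point y r).
Proof.
by have [S0 S1 S2] := Sm_point r; apply: space_continuous; exact: Sm_continuous.
Qed.

Lemma helix_continuous (th : R) : continuous (helix h th).
Proof.
have L (a b : R) : Sm (fun x : 'cV[R]_3 => a * x 0 0 + b * x 1 0).
  by apply: Sm_add; apply: Sm_mul; [exact: Sm_cst|exact: Sm_coord|exact: Sm_cst|exact: Sm_coord].
apply: space_continuous; apply: Sm_continuous; under eq_fun do rewrite helixE.
- exact: L.
- exact: L.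
- by apply: Sm_add; [exact: Sm_coord|exact: Sm_cst].
Qed.

Lemma is_derive_lin (V : normedModType R) (l : {linear V -> R}) (z u : V) :
  continuous l -> is_derive z u l (l u).
Proof.
move=> cl; apply: DeriveDef; first exact/diff_derivable/linear_differentiable.
by rewrite deriveE; [rewrite diff_lin|exact: linear_differentiable].
Qed.

Lemma is_derive_coord n (i : 'I_n) (x u : 'cV[R]_n) :
  is_derive x u (fun z => z i 0) (u i 0).
Proof.
exact: (is_derive_lin (l := mkl (@coord_linear R n i)) x u (@coord_continuous _ _ _ i 0)).
Qed.

(** When x moves along u, its foot moves by the horizontal part of u turned
    back, and it rotates as x rises. *)
Lemma is_derive_foot (f : 'cV[R]_2 -> R) x u : differentiable f (foot x) ->
  let c := cos (x 2 0 / h) in let s := sin (x 2 0 / h) in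
  is_derive x u (fun z => f (foot z))
    ((c * u 0 0 - s * u 1 0 - foot x 1 0 * (u 2 0 / h)) * 'D_(e0 R) f (foot x) +
     (s * u 0 0 + c * u 1 0 + foot x 0 0 * (u 2 0 / h)) * 'D_(e1 R) f (foot x)).
Proof.
move=> df c s.
have da : is_derive x u (fun z : 'cV[R]_3 => z 2 0 / h) (u 2 0 / h).
  apply: is_derive_eq; first by have dx := @is_derive_coord _ 2 x u; dtac.
  by rewrite mulr0 add0r mulrC.
have dc := is_derive_compl (f := fun z : 'cV[R]_3 => z 2 0 / h) (is_derive_cos (x 2 0 / h)) da.
have ds := is_derive_compl (f := fun z : 'cV[R]_3 => z 2 0 / h) (is_derive_sin (x 2 0 / h)) da.
pose dF (j : nat) := if j is 0%N then c * u 0 0 - s * u 1 0 - foot x 1 0 * (u 2 0 / h)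
  else s * u 0 0 + c * u 1 0 + foot x 0 0 * (u 2 0 / h).
apply: is_derive_eq.
  apply: (is_derive_comp (dPhi := dF) (cv_frame R 1) df) => -[[|[|//]] p] /=.
  - rewrite (_ : inord 0 = 0); last by apply/val_inj; rewrite /= inordK.
    under eq_fun do rewrite footE; apply: is_derive_eq.
      by have dx0 := is_derive_coord 0 x u; have dx1 := is_derive_coord 1 x u; dtac.
    by rewrite footE /c /s /= ?scaleE; ring.
  - rewrite (_ : inord 1 = 1); last by apply/val_inj; rewrite /= inordK.
    under eq_fun do rewrite footE; apply: is_derive_eq.
      by have dx0 := is_derive_coord 0 x u; have dx1 := is_derive_coord 1 x u; dtac.
    by rewrite footE /c /s /= ?scaleE; ring.
by rewrite !big_ord_recl big_ord0 addr0 /= -cve0 -cve1.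
Qed.

End coordinates.

Section helical_domain.
Variables (R : realType) (h : R) (Omega : set 'cV[R]_3).
Hypotheses (h_gt0 : 0 < h) (oO : open Omega) (helO : helical_set h Omega).
Let D := cross_section Omega.
Let h0 : h != 0. Proof. exact: lt0r_neq0. Qed.

Lemma helix_in (th : R) x : Omega x -> Omega (helix h th x).
Proof. by move=> Ox; rewrite -(helO th); exists x. Qed.

Lemma helical_domainE x : Omega x <-> D (foot h x).
Proof.
split=> [Ox|Dx]; last by rewrite -(helix_foot h0 x); exact: helix_in.
rewrite /D /cross_section /=.
have := helix_in (- (x 2 0 / h)) Ox.
rewrite (_ : helix _ _ _ = point (foot h x) 0) //.
apply: cv3P; rewrite helixE !pointE.
- by rewrite (footE h x) cosN sinN; ring.
- by rewrite (footE h x) cosN sinN; ring.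
- by rewrite mulrN mulrC divfK // subrr.
Qed.

Lemma closure_image (T U : topologicalType) (f : T -> U) (A : set T) (B : set U) x :
  {for x, continuous f} -> (forall z, A z -> B (f z)) -> closure A x -> closure B (f x).
Proof.
move=> cf AB cx P /cf nP; have [z [Az Pz]] := cx _ nP.
by exists (f z); split => //; exact: AB.
Qed.

Lemma closure_foot x : closure Omega x -> closure D (foot h x).
Proof.
apply: closure_image; first exact: foot_continuous.
by move=> z /helical_domainE.
Qed.

Lemma closure_point y : closure D y -> closure Omega (point y 0).
Proof. exact: (closure_image (@point_continuous R 0 y)). Qed.

Lemma open_cross_section : open D.
Proof. exact: (open_comp (fun y _ => @point_continuous R 0 y) oO). Qed.

Lemma frontier_foot x : frontier Omega x -> frontier D (foot h x).
Proof.
move=> /(frontierE _ oO)[cx nx]; apply/(frontierE _ open_cross_section).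
by split; [exact: closure_foot|move=> Df; apply: nx; exact/helical_domainE].
Qed.

Lemma frontier_point y : frontier D y -> frontier Omega (point y 0).
Proof.
move=> /(frontierE _ open_cross_section)[cy ny]; apply/(frontierE _ oO).
by split; first exact: closure_point.
Qed.

Lemma frontier_helix (th : R) x : frontier Omega x -> frontier Omega (helix h th x).
Proof.
move=> /(frontierE _ oO)[cx nx]; apply/(frontierE _ oO); split.
  by apply: (closure_image (@helix_continuous _ h th x)) cx => z; exact: helix_in.
by move=> /helical_domainE Ox; apply: nx; apply/helical_domainE; rewrite foot_helix in Ox.
Qed.

End helical_domain.

(** * Vector fields and their helical extension *)

(** Derivatives and coordinates become variables, so that ring and field meet a
    polynomial identity. *)
Ltac atoms := repeat match goal with
  | |- context [partial ?i ?f ?x] => generalize (partial i f x); intro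
  end; repeat match goal with
  | |- context [fun_of_matrix ?A ?i ?j] => generalize (fun_of_matrix A i j); intro
  end.

Section components.
Variable R : realType.

Lemma cvg_col (T : Type) (F : set_system T) n (f : T -> 'cV[R]_n) (l : 'cV[R]_n) :
  Filter F -> (forall i, f x i 0 @[x --> F] --> l i 0) -> f @ F --> l.
Proof.
move=> FF fl.
have E (v : 'cV[R]_n) : v = \sum_i v i 0 *: delta_mx i 0.
  by rewrite [LHS]matrix_sum_delta; apply: eq_bigr => i _; rewrite big_ord1.
rewrite (E l) (_ : f = fun x => \sum_i f x i 0 *: delta_mx i 0); last first.
  by apply/funext => x; exact: E.
by apply: cvg_big => [|i _]; [exact: add_continuous|apply: cvgZr_tmp; exact: fl].
Qed.

Lemma Ck_coord k (V : normedModType R) n (U M K : set V) (f : V -> 'cV[R]_n) i :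
  open U -> U `<=` M -> Ck_upto k U M K f -> Ck_upto k U M K (fun x => f x i 0).
Proof.
move=> oU; elim: k M f => [|k IH] M f UM [[g [cg fg]] df].
all: have C : exists g : V -> R, {within K, continuous g} /\ (forall x, M x -> f x i 0 = g x).
1,3: exists (fun x => g x i 0); split=> [|x Mx]; last by rewrite fg.
1,2: apply/subspace_continuousP => x Kx; have /subspace_continuousP/(_ x Kx) cgx := cg;
  apply: (cvg_comp g (fun v : 'cV[R]_n => v i 0) cgx); exact: coord_continuous.
- by split.
split; first exact: C.
move=> e; have [d1 d2] := df e; split=> [x Ux|].
  by have /derivable_mxP := d1 x Ux.
apply: (@Ck_eq _ _ _ _ U U K (fun x => 'D_e f x i 0)) => // [x Ux|]; last exact: IH.
by rewrite derive_mx ?mxE //; exact: d1.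
Qed.

Lemma Ck_col k (V : normedModType R) n (U M K : set V) (f : V -> 'cV[R]_n) :
  open U -> U `<=` M -> (forall i, Ck_upto k U M K (fun x => f x i 0)) ->
  Ck_upto k U M K f.
Proof.
move=> oU; elim: k M f => [|k IH] M f UM df.
all: have /choice[g gP] : forall i, exists g : V -> R, {within K, continuous g} /\
    (forall x, M x -> f x i 0 = g x) by [move=> i; have [] := df i].
all: have C : exists g : V -> 'cV[R]_n, {within K, continuous g} /\
    (forall x, M x -> f x = g x).
1,3: exists (fun x => \col_i g i x); split=> [|x Mx]; last
  by [apply/matrixP => i j; rewrite ord1 mxE; apply: (gP i).2].
1,2: apply/subspace_continuousP => x Kx; apply: cvg_col => i; rewrite mxE;
  under eq_fun do rewrite mxE; have [/subspace_continuousP cg _] := gP i; exact: cg.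
- by split.
split; first exact: C.
have de e x : U x -> derivable f x e.
  move=> Ux; apply/derivable_mxP => i j; rewrite ord1.
  exact: (@Ck_derivable R k V R U M K (fun y => f y i 0) x e (df i) Ux).
move=> e; split=> [x Ux|]; first exact: de.
apply: IH => // i.
apply: (@Ck_eq _ _ _ _ U U K (fun x => 'D_e (fun y => f y i 0) x)) => // [x Ux|].
  by rewrite derive_mx ?mxE //; exact: de.
exact: Ck_derive (df i).
Qed.

Lemma partial_coord n (f : 'cV[R]_n -> 'cV[R]_3) x i j :
  derivable f x (delta_mx i 0) ->
  partial i f x j 0 = partial i (fun z => f z j 0) x.
Proof. by move=> df; rewrite /partial derive_mx // mxE. Qed.

Lemma adv_coord (u f : 'cV[R]_3 -> 'cV[R]_3) x j :
  (forall i, derivable f x (delta_mx i 0)) ->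
  adv u f x j 0 = u x 0 0 * partial 0 (fun z => f z j 0) x +
    u x 1 0 * partial 1 (fun z => f z j 0) x + u x 2 0 * partial 2 (fun z => f z j 0) x.
Proof.
have E (a b c : R) (v w z : 'cV[R]_3) : (a *: v + b *: w + c *: z) j 0 =
    a * v j 0 + b * w j 0 + c * z j 0 by rewrite !mxE.
move=> df; rewrite /adv sum3E E.
by congr (_ * _ + _ * _ + _ * _); exact: partial_coord.
Qed.

Lemma dt_coord n m (f : R -> 'cV[R]_n -> 'cV[R]_m) t x j :
  derivable (fun s => f s x) t 1 ->
  dt f t x j 0 = dt (fun s z => f s z j 0) t x.
Proof. by move=> df; rewrite /dt !derive1E derive_mx // mxE. Qed.

End components.

Section extension.
Variables (R : realType) (h : R).
Hypothesis h0 : h != 0.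
Implicit Types (x u : 'cV[R]_3) (y : 'cV[R]_2) (a b : 'cV[R]_2 -> 'cV[R]_3).

(** The field that agrees with a on the plane of the cross-section and turns
    along the helices. *)
Definition ext a x : 'cV[R]_3 := rot3 (ht x / h) *m a (foot h x).

Lemma ext_helix a (th : R) x : ext a (helix h th x) = rot3 th *m ext a x.
Proof.
have E : (ht x + h * th) / h = ht x / h + th by field.
rewrite /ext foot_helix // {1}/ht helixE E.
by apply: cv3P; rewrite !rot3E ?cosD ?sinD; ring.
Qed.

(** The derivative in the direction of rotations about the origin. *)
Definition turn y (f : 'cV[R]_2 -> R) := y 0 0 * partial 1 f y - y 1 0 * partial 0 f y.

Lemma is_derive_ext a x u :
  (forall j, differentiable (fun y => a y j 0) (foot h x)) ->
  let y := foot h x in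
  let c := cos (x 2 0 / h) in let s := sin (x 2 0 / h) in
  let k0 := c * u 0 0 - s * u 1 0 - y 1 0 * (u 2 0 / h) in
  let k1 := s * u 0 0 + c * u 1 0 + y 0 0 * (u 2 0 / h) in
  let d j := k0 * partial 0 (fun z => a z j 0) y + k1 * partial 1 (fun z => a z j 0) y in
  [/\ is_derive x u (fun z => ext a z 0 0)
        (c * d 0 + s * d 1 + u 2 0 / h * (- s * a y 0 0 + c * a y 1 0)),
      is_derive x u (fun z => ext a z 1 0)
        (- s * d 0 + c * d 1 + u 2 0 / h * (- c * a y 0 0 - s * a y 1 0)) &
      is_derive x u (fun z => ext a z 2 0) (d 2)].
Proof.
move=> da y c s k0 k1 d.
have dx : is_derive x u (fun z : 'cV[R]_3 => z 2 0 / h) (u 2 0 / h).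
  apply: is_derive_eq; first by have dx := is_derive_coord 2 x u; dtac.
  by rewrite /= ?scaleE; ring.
have dc := is_derive_compl (f := fun z : 'cV[R]_3 => z 2 0 / h) (is_derive_cos (x 2 0 / h)) dx.
have ds := is_derive_compl (f := fun z : 'cV[R]_3 => z 2 0 / h) (is_derive_sin (x 2 0 / h)) dx.
have dj j : is_derive x u (fun z => a (foot h z) j 0) (d j).
  exact: (is_derive_foot u (da j)).
have d0 := dj 0; have d1 := dj 1; have d2 := dj 2; rewrite /ext /ht; split.
- under eq_fun do rewrite rot3E; apply: is_derive_eq; dtac.
  by rewrite /= ?scaleE /c /s /y; ring.
- under eq_fun do rewrite rot3E; apply: is_derive_eq; dtac.
  by rewrite /= ?scaleE /c /s /y; ring.
- by under eq_fun do rewrite rot3E; exact: d2.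
Qed.

Lemma derivable_ext a x u :
  (forall j, differentiable (fun y => a y j 0) (foot h x)) -> derivable (ext a) x u.
Proof.
move=> da; apply/derivable_mxP => i j; rewrite ord1.
have [[d0 _] [d1 _] [d2 _]] := is_derive_ext u da.
by move: i; apply: ord3_ind; [exact: d0|exact: d1|exact: d2].
Qed.

(** The velocity of the foot of a point that moves with velocity b: rising turns
    the foot. *)
Definition flow_comp b y : 'cV[R]_2 :=
  col2 (b y 0 0 - y 1 0 * b y 2 0 / h) (b y 1 0 + y 0 0 * b y 2 0 / h).

(** Advection and curl in the plane of the cross-section; the undifferentiated
    terms come from the turning of the frame along the helices. *)
Definition plane_adv b a y : 'cV[R]_3 :=
  let d j := flow_comp b y 0 0 * partial 0 (fun z => a z j 0) y +
             flow_comp b y 1 0 * partial 1 (fun z => a z j 0) y in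
  col3 (d 0 + b y 2 0 / h * a y 1 0) (d 1 - b y 2 0 / h * a y 0 0) (d 2).

Definition plane_curl a y : 'cV[R]_3 :=
  let d i j := partial i (fun z => a z j 0) y in
  col3 (d 1 2 + (a y 0 0 - turn y (fun z => a z 1 0)) / h)
       ((a y 1 0 + turn y (fun z => a z 0 0)) / h - d 0 2) (d 0 1 - d 1 0).

Lemma delta3E (i : 'I_3) :
  ((delta_mx i 0 : 'cV[R]_3) 0 0 = (0 == i)%:R) *
  ((delta_mx i 0 : 'cV[R]_3) 1 0 = (1 == i)%:R) *
  ((delta_mx i 0 : 'cV[R]_3) 2 0 = (2 == i)%:R).
Proof. by rewrite !mxE !eqxx !andbT. Qed.

Lemma partial_ext a x :
  (forall j, differentiable (fun y => a y j 0) (foot h x)) ->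
  let y := foot h x in let p i j := partial i (fun z => a z j 0) y in
  let c := cos (x 2 0 / h) in let s := sin (x 2 0 / h) in
  let t j := (y 0 0 * p 1 j - y 1 0 * p 0 j) / h in
  let e j (z : 'cV[R]_3) := ext a z j 0 in
  [/\ [/\ partial 0 (e 0) x = c * (c * p 0 0 + s * p 1 0) + s * (c * p 0 1 + s * p 1 1),
          partial 0 (e 1) x = - s * (c * p 0 0 + s * p 1 0) + c * (c * p 0 1 + s * p 1 1) &
          partial 0 (e 2) x = c * p 0 2 + s * p 1 2],
      [/\ partial 1 (e 0) x = c * (- s * p 0 0 + c * p 1 0) + s * (- s * p 0 1 + c * p 1 1),
          partial 1 (e 1) x = - s * (- s * p 0 0 + c * p 1 0) + c * (- s * p 0 1 + c * p 1 1) &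
          partial 1 (e 2) x = - s * p 0 2 + c * p 1 2] &
      [/\ partial 2 (e 0) x = c * t 0 + s * t 1 + (- s * a y 0 0 + c * a y 1 0) / h,
          partial 2 (e 1) x = - s * t 0 + c * t 1 - (c * a y 0 0 + s * a y 1 0) / h &
          partial 2 (e 2) x = t 2]].
Proof.
move=> da y p c s t e; split.
- have [[_ E0] [_ E1] [_ E2]] := is_derive_ext (delta_mx 0 0) da.
  rewrite !delta3E /= -/y -/c -/s in E0 E1 E2.
  split; [rewrite [LHS]E0|rewrite [LHS]E1|rewrite [LHS]E2]; rewrite /p {E0 E1 E2}; atoms; ring.
- have [[_ E0] [_ E1] [_ E2]] := is_derive_ext (delta_mx 1 0) da.
  rewrite !delta3E /= -/y -/c -/s in E0 E1 E2.
  split; [rewrite [LHS]E0|rewrite [LHS]E1|rewrite [LHS]E2]; rewrite /p {E0 E1 E2}; atoms; ring.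
- have [[_ E0] [_ E1] [_ E2]] := is_derive_ext (delta_mx 2 0) da.
  rewrite !delta3E /= -/y -/c -/s in E0 E1 E2.
  split; [rewrite [LHS]E0|rewrite [LHS]E1|rewrite [LHS]E2]; rewrite /t /p {E0 E1 E2}; atoms; ring.
Qed.

(** The foot of the moving point has the velocity flow_comp b, and the frame
    turns at the rate b y 2 0 / h. *)
Lemma adv_ext a b x :
  (forall j, differentiable (fun y => a y j 0) (foot h x)) ->
  adv (ext b) (ext a) x = rot3 (x 2 0 / h) *m plane_adv b a (foot h x).
Proof.
move=> da.
have dv i : derivable (ext a) x (delta_mx i 0) by exact: derivable_ext.
have [[A0 A1 A2] [B0 B1 B2] [C0 C1 C2]] := partial_ext da.
have S := cos_sin2 (x 2 0 / h).
apply: cv3P; rewrite rot3E adv_coord // /plane_adv /flow_comp !col3E !col2E0 !col2E1.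
- rewrite A0 B0 C0 {A0 B0 C0 A1 B1 C1 A2 B2 C2} /ext !rot3E /ht.
  by move: (cos _) (sin _) S; atoms => co si SS; ring: SS.
- rewrite A1 B1 C1 {A0 B0 C0 A1 B1 C1 A2 B2 C2} /ext !rot3E /ht.
  by move: (cos _) (sin _) S; atoms => co si SS; ring: SS.
- rewrite A2 B2 C2 {A0 B0 C0 A1 B1 C1 A2 B2 C2} /ext !rot3E /ht.
  by move: (cos _) (sin _) S; atoms => co si SS; ring: SS.
Qed.

Lemma curl_ext a x : (forall j, differentiable (fun y => a y j 0) (foot h x)) ->
  curl (ext a) x = rot3 (x 2 0 / h) *m plane_curl a (foot h x).
Proof.
move=> da; have [[A0 A1 A2] [B0 B1 B2] [C0 C1 C2]] := partial_ext da.
have S := cos_sin2 (x 2 0 / h).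
apply: cv3P; rewrite rot3E /curl /plane_curl /turn !col3E.
- by rewrite B2 C1 {A0 B0 C0 A1 B1 C1 A2 B2 C2}; move: (cos _) (sin _) S; atoms => co si SS; ring: SS.
- by rewrite C0 A2 {A0 B0 C0 A1 B1 C1 A2 B2 C2}; move: (cos _) (sin _) S; atoms => co si SS; ring: SS.
- by rewrite A1 B0 {A0 B0 C0 A1 B1 C1 A2 B2 C2}; move: (cos _) (sin _) S; atoms => co si SS; ring: SS.
Qed.

Lemma div_ext a x : (forall j, differentiable (fun y => a y j 0) (foot h x)) ->
  let y := foot h x in div (ext a) x =
  partial 0 (fun z => a z 0 0) y + partial 1 (fun z => a z 1 0) y +
  turn y (fun z => a z 2 0) / h.
Proof.
move=> da y; have [[A0 A1 A2] [B0 B1 B2] [C0 C1 C2]] := partial_ext da.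
have S := cos_sin2 (x 2 0 / h).
rewrite /div sum3E A0 B1 C2 /turn -/y {A0 B0 C0 A1 B1 C1 A2 B2 C2}.
by move: (cos _) (sin _) S; atoms => co si SS; ring: SS.
Qed.

Lemma grad_foot (p : 'cV[R]_2 -> R) x : differentiable p (foot h x) ->
  grad (fun z => p (foot h z)) x =
  rot3 (x 2 0 / h) *m col3 (partial 0 p (foot h x)) (partial 1 p (foot h x))
                           (turn (foot h x) p / h).
Proof.
move=> dp.
have E i := @derive_val _ _ _ _ _ _ _ (is_derive_foot (delta_mx i 0) dp).
have H i : grad (fun z => p (foot h z)) x i 0 = partial i (fun z => p (foot h z)) x.
  by rewrite mxE.
apply: cv3P; rewrite H [LHS]E rot3E !col3E !delta3E /= /turn /partial -/(e0 R) -/(e1 R) {E H}.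
all: by move: ('D_(e0 R) _ _) ('D_(e1 R) _ _) (cos _) (sin _); atoms => D0 D1 co si; ring.
Qed.

End extension.

(** * Stream functions and the planar system *)

Section stream_field.
Variables (R : realType) (h : R).
Hypothesis h_gt0 : 0 < h.
Let h0 : h != 0. Proof. exact: lt0r_neq0. Qed.
Implicit Types (y z : 'cV[R]_2).

Lemma xi2_gt0 y : 0 < xi2 h y.
Proof. by rewrite /xi2 -addrA ltr_pwDl ?exprn_gt0 // addr_ge0 // sqr_ge0. Qed.

Lemma xi2_neq0 y : xi2 h y != 0. Proof. exact: lt0r_neq0 (xi2_gt0 y). Qed.

Lemma is_derive_partial n (f : 'cV[R]_n -> R) x i : differentiable f x ->
  is_derive x (delta_mx i 0) f (partial i f x).
Proof. by move=> df; apply: DeriveDef; first exact: diff_derivable. Qed.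

Lemma partial_val n (f : 'cV[R]_n -> R) x i d :
  is_derive x (delta_mx i 0) f d -> partial i f x = d.
Proof. by rewrite /partial => -[_ ->]. Qed.

Section static.
Variables (F0 F1 Q : 'cV[R]_2 -> R).

(** The velocity on the plane whose horizontal flow is the turned gradient
    (F1, -F0) and which moves with the speed Q along xi. *)
Definition stream_field y : 'cV[R]_3 :=
  col3 (F1 y + y 1 0 * Q y) (- F0 y - y 0 0 * Q y) (h * Q y).

Definition stream_swirl y : R := xi2 h y * Q y + (y 0 0 * F0 y + y 1 0 * F1 y).

Definition stream_vorticity y : R :=
  - partial 0 F0 y - partial 1 F1 y - 2 * Q y - radial Q y.

Definition plane_vorticity (v w : 'cV[R]_2 -> R) y : 'cV[R]_3 :=
  col3 ((w y * y 1 0 + partial 1 v y) / h) (- (w y * y 0 0 + partial 0 v y) / h) (w y).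

Lemma flow_stream_field y : flow_comp h stream_field y = col2 (F1 y) (- F0 y).
Proof.
by rewrite /flow_comp /stream_field !col3E; apply: cv2P; rewrite ?col2E0 ?col2E1; field.
Qed.

Lemma swirl_stream_field y : dot (stream_field y) (xi h y) = stream_swirl y.
Proof. by rewrite dot3E /stream_field !col3E /stream_swirl /xi2; ring. Qed.

Variable y : 'cV[R]_2.
Hypotheses (d0 : differentiable F0 y) (d1 : differentiable F1 y) (dQ : differentiable Q y).
Hypothesis sym : partial 0 F1 y = partial 1 F0 y.

Let D0 i := is_derive_partial i d0.
Let D1 i := is_derive_partial i d1.
Let DQ i := is_derive_partial i dQ.
Let dy i j := is_derive_coord i y (delta_mx j 0).

Lemma delta2E (i : 'I_2) :
  ((delta_mx i 0 : 'cV[R]_2) 0 0 = (0 == i)%:R) *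
  ((delta_mx i 0 : 'cV[R]_2) 1 0 = (1 == i)%:R).
Proof. by rewrite !mxE !eqxx !andbT. Qed.

Lemma is_derive_xi2 i :
  is_derive y (delta_mx i 0) (xi2 h) (2 * y 0 0 * (0 == i)%:R + 2 * y 1 0 * (1 == i)%:R).
Proof.
have a0 := dy 0 i; have a1 := dy 1 i; rewrite !delta2E in a0 a1.
rewrite /xi2; apply: is_derive_eq; dtac.
by rewrite /= ?scaleE; ring.
Qed.

Lemma partial_stream_field i :
  [/\ partial i (fun z => stream_field z 0 0) y =
        partial i F1 y + y 1 0 * partial i Q y + Q y * (1 == i)%:R,
      partial i (fun z => stream_field z 1 0) y =
        - partial i F0 y - y 0 0 * partial i Q y - Q y * (0 == i)%:R &
      partial i (fun z => stream_field z 2 0) y = h * partial i Q y].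
Proof.
have a0 := dy 0 i; have a1 := dy 1 i; rewrite !delta2E in a0 a1.
have b0 := D0 i; have b1 := D1 i; have b2 := DQ i.
split; apply: partial_val; rewrite /stream_field; under eq_fun do rewrite col3E.
- by apply: is_derive_eq; dtac; rewrite /= ?scaleE; ring.
- by apply: is_derive_eq; dtac; rewrite /= ?scaleE; ring.
- by apply: is_derive_eq; dtac; rewrite /= ?scaleE; ring.
Qed.

Lemma partial_stream_swirl i : partial i stream_swirl y =
  xi2 h y * partial i Q y + Q y * (2 * y 0 0 * (0 == i)%:R + 2 * y 1 0 * (1 == i)%:R) +
  y 0 0 * partial i F0 y + F0 y * (0 == i)%:R + y 1 0 * partial i F1 y + F1 y * (1 == i)%:R.
Proof.
have a0 := dy 0 i; have a1 := dy 1 i; rewrite !delta2E in a0 a1.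
have b0 := D0 i; have b1 := D1 i; have b2 := DQ i; have b3 := is_derive_xi2 i.
apply: partial_val; rewrite /stream_swirl.
by apply: is_derive_eq; dtac; rewrite /= ?scaleE; ring.
Qed.

Lemma curl_stream_field :
  plane_curl h stream_field y = plane_vorticity stream_swirl stream_vorticity y.
Proof.
have [A0 A1 A2] := partial_stream_field 0; have [B0 B1 B2] := partial_stream_field 1.
have S0 := partial_stream_swirl 0; have S1 := partial_stream_swirl 1.
rewrite !eqxx /= in A0 A1 B0 B1 S0 S1.
rewrite /plane_curl /plane_vorticity /turn A0 A1 A2 B0 B1 B2 S0 S1 sym.
rewrite /stream_vorticity /radial /xi2 /stream_field !col3E.
by apply: cv3P; rewrite !col3E; atoms; field.
Qed.

(** K grad f is grad f minus (y . grad f / xi2) y, and y . grad f / xi2 is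
    v / xi2 - Q for the swirl v. *)
Lemma LK_stream (f : 'cV[R]_2 -> R) :
  (\forall z \near y, partial 0 f z = F0 z /\ partial 1 f z = F1 z) ->
  LK h f y = stream_vorticity y + 2 * h ^+ 2 * stream_swirl y / xi2 h y ^+ 2
    + radial stream_swirl y / xi2 h y.
Proof.
move=> near_f.
pose r z := (z 0 0 * F0 z + z 1 0 * F1 z) * (xi2 h z)^-1.
have S0 := partial_stream_swirl 0; have S1 := partial_stream_swirl 1.
have b00 := D0 0; have b10 := D1 0; have b01 := D0 1; have b11 := D1 1.
have a00 := dy 0 0; have a10 := dy 1 0; have a01 := dy 0 1; have a11 := dy 1 1.
have x0 := is_derive_xi2 0; have x1 := is_derive_xi2 1.
rewrite !delta2E !eqxx /= in a00 a10 a01 a11 x0 x1 S0 S1.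
have i0 := dV x0 (xi2_neq0 y); have i1 := dV x1 (xi2_neq0 y).
have c0 : is_derive y (delta_mx 0 0) (fun z => F0 z - z 0 0 * r z) (partial 0 F0 y - (r y +
  y 0 0 * ((F0 y + y 0 0 * partial 0 F0 y + y 1 0 * partial 0 F1 y) / xi2 h y -
     (y 0 0 * F0 y + y 1 0 * F1 y) * (2 * y 0 0) / xi2 h y ^+ 2))).
  rewrite /r; apply: is_derive_eq; dtac.
  by rewrite /= ?scaleE; atoms; ring.
have c1 : is_derive y (delta_mx 1 0) (fun z => F1 z - z 1 0 * r z) (partial 1 F1 y - (r y +
  y 1 0 * ((y 0 0 * partial 1 F0 y + F1 y + y 1 0 * partial 1 F1 y) / xi2 h y -
     (y 0 0 * F0 y + y 1 0 * F1 y) * (2 * y 1 0) / xi2 h y ^+ 2))).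
  rewrite /r; apply: is_derive_eq; dtac.
  by rewrite /= ?scaleE; atoms; ring.
have E : \forall z \near y, (Kmat h z *m grad f z) 0 0 = F0 z - z 0 0 * r z /\
    (Kmat h z *m grad f z) 1 0 = F1 z - z 1 0 * r z.
  apply: filterS near_f => z [E0 E1].
  have xz := xi2_neq0 z.
  have M (a b c d : R) (u : 'cV[R]_2) : (((xi2 h z)^-1 *: mat2 a b c d) *m u) 0 0 =
      (a * u 0 0 + b * u 1 0) / xi2 h z /\
      (((xi2 h z)^-1 *: mat2 a b c d) *m u) 1 0 = (c * u 0 0 + d * u 1 0) / xi2 h z.
    have scE (k : R) (A : 'cV[R]_2) i : (k *: A) i 0 = k * A i 0 by rewrite mxE.
    by rewrite -scalemxAl !scE !mat2E; split; rewrite mulrC.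
  have [M0 M1] := M (h ^+ 2 + z 1 0 ^+ 2) (- (z 0 0 * z 1 0)) (- (z 0 0 * z 1 0))
    (h ^+ 2 + z 0 0 ^+ 2) (grad f z).
  rewrite /Kmat M0 M1 {M0 M1} ![grad f z _ _]mxE E0 E1 /r.
  by move: xz; rewrite /xi2; atoms => xz; split; field.
have E0 : \forall z \near y, F0 z - z 0 0 * r z = (Kmat h z *m grad f z) 0 0.
  by apply: filterS E => z [-> _].
have E1 : \forall z \near y, F1 z - z 1 0 * r z = (Kmat h z *m grad f z) 1 0.
  by apply: filterS E => z [_ ->].
have P0 := partial_val (near_eq_is_derive E0 c0).
have P1 := partial_val (near_eq_is_derive E1 c1).
rewrite /LK /div sum2E P0 P1 /radial S0 S1 /stream_vorticity /radial /stream_swirl /r sym.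
move: (xi2_neq0 y); rewrite /xi2.
by atoms => xy; field; rewrite xy.
Qed.

End static.

End stream_field.

(** * The vorticity equation in the plane *)

Lemma plane_adv_val (R : realType) (h : R) (b a : 'cV[R]_2 -> 'cV[R]_3) y
    (u0 u1 p00 p01 p02 p10 p11 p12 : R) : flow_comp h b y = col2 u0 u1 ->
  partial 0 (fun z => a z 0 0) y = p00 -> partial 0 (fun z => a z 1 0) y = p01 ->
  partial 0 (fun z => a z 2 0) y = p02 -> partial 1 (fun z => a z 0 0) y = p10 ->
  partial 1 (fun z => a z 1 0) y = p11 -> partial 1 (fun z => a z 2 0) y = p12 ->
  plane_adv h b a y = col3 (u0 * p00 + u1 * p10 + b y 2 0 / h * a y 1 0)
    (u0 * p01 + u1 * p11 - b y 2 0 / h * a y 0 0) (u0 * p02 + u1 * p12).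
Proof.
by move=> fl <- <- <- <- <- <-; rewrite /plane_adv fl col2E0 col2E1.
Qed.

Section vorticity_transport.
Variables (R : realType) (h : R).
Hypothesis h_gt0 : 0 < h.
Let h0 : h != 0. Proof. exact: lt0r_neq0. Qed.
Variables (F0 F1 Q w : 'cV[R]_2 -> R) (y : 'cV[R]_2).
Hypotheses (d0 : differentiable F0 y) (d1 : differentiable F1 y) (dQ : differentiable Q y).
Hypothesis sym : partial 0 F1 y = partial 1 F0 y.
Let v := stream_swirl h F0 F1 Q.

(** The stretching of vorticity in the planar system is the Jacobian of v and
    Q; the other terms come from writing Q through v and the stream function. *)
Lemma stretching_term :
  let r (z : 'cV[R]_2) := (z 0 0 * F0 z + z 1 0 * F1 z) / xi2 h z in
  partial 0 v y * partial 1 r y - partial 1 v y * partial 0 r y +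
    2 * v y * (y 1 0 * partial 0 v y - y 0 0 * partial 1 v y) / xi2 h y ^+ 2 =
  partial 1 v y * partial 0 Q y - partial 0 v y * partial 1 Q y.
Proof.
move=> r.
have P i : partial i r y = (partial i v y - xi2 h y * partial i Q y) / xi2 h y -
   (v y - xi2 h y * Q y) * (2 * y 0 0 * (0 == i)%:R + 2 * y 1 0 * (1 == i)%:R) /
     xi2 h y ^+ 2 - Q y * (2 * y 0 0 * (0 == i)%:R + 2 * y 1 0 * (1 == i)%:R) / xi2 h y.
  have a0 := is_derive_coord 0 y (delta_mx i 0).
  have a1 := is_derive_coord 1 y (delta_mx i 0); rewrite !delta2E in a0 a1.
  have b0 := is_derive_partial i d0; have b1 := is_derive_partial i d1.
  have b2 := dV (is_derive_xi2 h y i) (xi2_neq0 h_gt0 y).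
  rewrite partial_stream_swirl //.
  apply: partial_val; rewrite /r; apply: is_derive_eq; dtac; rewrite /= ?scaleE.
  rewrite /v /stream_swirl; move: (xi2 h y) (xi2_neq0 h_gt0 y) => X.
  by atoms => X0; field; rewrite X0.
rewrite !P !eqxx /=; move: (xi2 h y) (xi2_neq0 h_gt0 y) => X.
by atoms => X0; field; rewrite X0.
Qed.

Hypotheses (dw : differentiable w y).
Hypotheses (dv0 : differentiable (partial 0 v) y) (dv1 : differentiable (partial 1 v) y).
Hypothesis vsym : partial 0 (partial 1 v) y = partial 1 (partial 0 v) y.

Lemma partial_plane_vorticity i :
  let b := plane_vorticity h v w in
  [/\ partial i (fun z => b z 0 0) y =
        (partial i w y * y 1 0 + w y * (1 == i)%:R + partial i (partial 1 v) y) / h,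
      partial i (fun z => b z 1 0) y =
        - (partial i w y * y 0 0 + w y * (0 == i)%:R + partial i (partial 0 v) y) / h &
      partial i (fun z => b z 2 0) y = partial i w y].
Proof.
move=> b.
have a0 := is_derive_coord 0 y (delta_mx i 0).
have a1 := is_derive_coord 1 y (delta_mx i 0); rewrite !delta2E in a0 a1.
have b0 := is_derive_partial i dv0; have b1 := is_derive_partial i dv1.
have b2 := is_derive_partial i dw.
split; rewrite /b /plane_vorticity; under eq_fun do rewrite col3E.
- by apply: partial_val; apply: is_derive_eq; dtac; rewrite /= ?scaleE; ring.
- by apply: partial_val; apply: is_derive_eq; dtac; rewrite /= ?scaleE; ring.
- by [].
Qed.

(** The horizontal components of the vorticity equation are the gradient of
    the transport equation of v, turned and combined with the third one. *)
Lemma plane_vorticity_equation (wt vt0 vt1 : R) :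
  wt + F1 y * partial 0 w y - F0 y * partial 1 w y =
    partial 1 v y * partial 0 Q y - partial 0 v y * partial 1 Q y ->
  vt0 + (F1 y * partial 0 (partial 0 v) y + partial 0 F1 y * partial 0 v y -
         (F0 y * partial 0 (partial 1 v) y + partial 0 F0 y * partial 1 v y)) = 0 ->
  vt1 + (F1 y * partial 1 (partial 0 v) y + partial 1 F1 y * partial 0 v y -
         (F0 y * partial 1 (partial 1 v) y + partial 1 F0 y * partial 1 v y)) = 0 ->
  let a := stream_field h F0 F1 Q in let b := plane_vorticity h v w in
  col3 ((wt * y 1 0 + vt1) / h) (- (wt * y 0 0 + vt0) / h) wt + plane_adv h a b y =
  plane_adv h b a y.
Proof.
move=> Hw H0 H1 a b.
have [A0 A1 A2] := partial_stream_field h d0 d1 dQ 0.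
have [B0 B1 B2] := partial_stream_field h d0 d1 dQ 1.
have [C0 C1 C2] := partial_plane_vorticity 0; have [E0 E1 E2] := partial_plane_vorticity 1.
rewrite !eqxx /= in A0 A1 B0 B1 C0 C1 E0 E1.
have {}Hw : wt = partial 1 v y * partial 0 Q y - partial 0 v y * partial 1 Q y -
  F1 y * partial 0 w y + F0 y * partial 1 w y by rewrite -Hw; ring.
have {}H0 : vt0 = - (F1 y * partial 0 (partial 0 v) y + partial 0 F1 y * partial 0 v y -
         (F0 y * partial 0 (partial 1 v) y + partial 0 F0 y * partial 1 v y)).
  by apply/eqP; rewrite -addr_eq0 H0.
have {}H1 : vt1 = - (F1 y * partial 1 (partial 0 v) y + partial 1 F1 y * partial 0 v y -
         (F0 y * partial 1 (partial 1 v) y + partial 1 F0 y * partial 1 v y)).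
  by apply/eqP; rewrite -addr_eq0 H1.
have fa : flow_comp h a y = col2 (F1 y) (- F0 y) by exact: flow_stream_field.
have fb : flow_comp h b y = col2 (partial 1 v y / h) (- partial 0 v y / h).
  rewrite /flow_comp /b /plane_vorticity !col3E.
  by apply: cv2P; rewrite ?col2E0 ?col2E1; atoms; field.
rewrite (plane_adv_val fa C0 C1 C2 E0 E1 E2) (plane_adv_val fb A0 A1 A2 B0 B1 B2).
rewrite {A0 A1 A2 B0 B1 B2 C0 C1 C2 E0 E1 E2 fa fb} Hw H0 H1 sym vsym {Hw H0 H1}.
have addE (A B : 'cV[R]_3) i : (A + B) i 0 = A i 0 + B i 0 by rewrite mxE.
rewrite /a /b /stream_field /plane_vorticity !col3E.
by apply: cv3P; rewrite addE !col3E; atoms; field.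
Qed.

End vorticity_transport.

(** * Regularity in time and space *)

Section spacetime.
Variables (R : realType) (T : \bar R).

Section field.
Variables (n : nat) (A : set 'cV[R]_n.+1).
Hypothesis oA : open A.
Implicit Types f : R -> 'cV[R]_n.+1 -> R.

Lemma open_cylinder : open (time_oo T `*` A).
Proof.
rewrite openE => -[t x] [/= tT Ax]; exists (time_oo T, A) => //.
by split; apply: open_nbhs_nbhs; [split; first exact: (@open_time_oo R T)|].
Qed.

Lemma Sm_time : Sm (fun z : R * 'cV[R]_n.+1 => z.1).
Proof. exact: (Sm_lin (l := mkl (@st0_linear R n.+1)) (fun z => @cvg_fst _ _ _ _ _)). Qed.

Lemma Sm_space i : Sm (fun z : R * 'cV[R]_n.+1 => z.2 i 0).
Proof.
apply: (Sm_lin (l := mkl (@stS_linear R n.+1 i))) => z.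
apply: (@continuous_comp _ _ _ snd (fun x : 'cV[R]_n.+1 => x i 0)); first exact: cvg_snd.
exact: coord_continuous.
Qed.

Lemma Ck_snd k (U : set (R * 'cV[R]_n.+1)) M K (g : 'cV[R]_n.+1 -> R) :
  Sm g -> open U -> U `<=` M -> Ck_upto k U M K (fun z => g z.2).
Proof.
move=> gS oU UM.
apply: (@Ck_comp R k _ _ _ _ _ g snd U M K setT setT setT (cv_frame R n)) => //.
- exact: openT.
- by move=> j; exact: Sm_space.
Qed.

Lemma Ck_slice k f t : Ck_field k T (time_oo T) A f -> time_oo T t ->
  Ck_upto k A A (closure A) (f t).
Proof.
move=> fk tT.
apply: (@Ck_comp R k _ _ _ _ _ (fun z : R * 'cV[R]_n.+1 => f z.1 z.2) (fun y => (t, y)) A A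
   (closure A) (time_oo T `*` A) (time_oo T `*` A) (time_oo T `*` closure A)
   (st_frame R n)) => //.
- exact: open_cylinder.
- by move=> [s x] [? ?]; split => //; exact: subset_closure.
- by move=> [[|j] jp] /=; [exact: Sm_cst|exact: Sm_coord].
Qed.

Lemma field_differentiable k f t y : Ck_field k.+1 T (time_oo T) A f -> time_oo T t ->
  A y -> differentiable (f t) y.
Proof.
move=> fk tT Ay.
exact: (Ck_differentiable (cv_frame R n) oA (@subset_closure _ A) (Ck_slice fk tT) Ay).
Qed.

Lemma field_partial k f i : Ck_field k.+1 T (time_oo T) A f ->
  Ck_field k T (time_oo T) A (fun t => partial i (f t)).
Proof.
move=> fk; apply: (@Ck_eq _ _ _ _ _ _ _ ('D_(space_dir R i) (fun z => f z.1 z.2))) => //.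
- exact: open_cylinder.
- by move=> [t x] _; rewrite partial_unc.
- exact: Ck_derive fk.
Qed.

Lemma field_dt k f : Ck_field k.+1 T (time_oo T) A f -> Ck_field k T (time_oo T) A (dt f).
Proof.
move=> fk; apply: (@Ck_eq _ _ _ _ _ _ _ ('D_(time_dir R n.+1) (fun z => f z.1 z.2))) => //.
- exact: open_cylinder.
- by move=> [t x] _; rewrite dt_unc.
- exact: Ck_derive fk.
Qed.

Lemma field_derivable_dt k f t y : Ck_field k.+1 T (time_oo T) A f -> time_oo T t ->
  A y -> is_derive t 1 (fun s => f s y) (dt f t y).
Proof.
move=> fk tT Ay; apply: DeriveDef; last by rewrite /dt derive1E.
apply/(derivable_dt_unc f).
exact: (@Ck_derivable R k _ _ _ _ _ (fun z => f z.1 z.2) (t, y) (time_dir R n.+1) fk).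
Qed.

Lemma dt_partial f i t y : Ck_field 2 T (time_oo T) A f -> time_oo T t -> A y ->
  dt (fun s => partial i (f s)) t y = partial i (dt f t) y.
Proof.
move=> fk tT Ay; have oU := open_cylinder.
pose u := fun z : R * 'cV[R]_n.+1 => f z.1 z.2.
have {}fk : Ck_upto 2 (time_oo T `*` A) (time_oo T `*` A) (time_oo T `*` closure A) u by [].
have UK : time_oo T `*` A `<=` time_oo T `*` closure A.
  by move=> [s x] [? ?]; split => //; exact: subset_closure.
have Uz : (time_oo T `*` A) (t, y) by [].
have c e e' := Ck_continuous oU (@subset_refl _ _) UK (Ck_derive e' (Ck_derive e fk)) Uz.
have d (e : (R * 'cV[R]_n.+1)%type) : \forall z \near (t, y), derivable u z e.
  exact: (Ck_near_derivable e oU fk Uz).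
have d2 (e e' : (R * 'cV[R]_n.+1)%type) : \forall z \near (t, y), derivable ('D_e u) z e'.
  exact: (Ck_near_derivable e' oU (Ck_derive e fk) Uz).
rewrite dt_unc partial_unc.
rewrite (_ : (fun z => partial i (f z.1) z.2) = 'D_(space_dir R i) u); last first.
  by apply/funext => -[s x]; rewrite partial_unc.
rewrite (_ : (fun z => dt f z.1 z.2) = 'D_(time_dir R n.+1) u); last first.
  by apply/funext => -[s x]; rewrite dt_unc.
exact: schwarz.
Qed.

Lemma field_near_dt (W : normedModType R) (f g : R -> 'cV[R]_n.+1 -> W) t y :
  time_oo T t -> (forall s, time_oo T s -> f s y = g s y) -> dt f t y = dt g t y.
Proof.
move=> tT fg; rewrite /dt !derive1E; apply: near_eq_derive.
have : nbhs t (time_oo T) by exact/open_nbhs_nbhs/(conj (@open_time_oo R T)).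
by apply: filterS => s; exact: fg.
Qed.

Lemma partial_eq (W : normedModType R) (f g : 'cV[R]_n.+1 -> W) i y :
  A y -> (forall z, A z -> f z = g z) -> partial i f y = partial i g y.
Proof.
move=> Ay fg; apply: near_eq_derive.
have : nbhs y A by exact: open_nbhs_nbhs.
by apply: filterS => s; exact: fg.
Qed.

Lemma partial_sym f i j t y : Ck_field 2 T (time_oo T) A f -> time_oo T t -> A y ->
  partial i (partial j (f t)) y = partial j (partial i (f t)) y.
Proof.
move=> fk tT Ay; have gk := Ck_slice fk tT.
have c (e e' : 'cV[R]_n.+1) : {for y, continuous ('D_e' ('D_e (f t)))}.
  by apply: (Ck_continuous oA (@subset_refl _ _) (@subset_closure _ A)
    (Ck_derive e' (Ck_derive e gk)) Ay).
apply: schwarz; [exact: (Ck_near_derivable _ oA gk Ay)|exact: (Ck_near_derivable _ oA gk Ay)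
  |exact: (Ck_near_derivable _ oA (Ck_derive _ gk) Ay)
  |exact: (Ck_near_derivable _ oA (Ck_derive _ gk) Ay)|exact: c|exact: c].
Qed.

End field.

End spacetime.

Section extension_regularity.
Variables (R : realType) (h : R) (T : \bar R) (Omega : set 'cV[R]_3).
Hypotheses (h_gt0 : 0 < h) (oO : open Omega) (helO : helical_set h Omega).
Let D := cross_section Omega.
Let h0 : h != 0. Proof. exact: lt0r_neq0. Qed.

Lemma Ck_foot k (f : R -> 'cV[R]_2 -> R) : Ck_field k T (time_oo T) D f ->
  Ck_field k T (time_oo T) Omega (fun t x => f t (foot h x)).
Proof.
move=> fk; have oD : open D by exact: open_cross_section.
apply: (@Ck_comp R k _ _ _ _ _ (fun z : R * 'cV[R]_2 => f z.1 z.2)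
   (fun z : R * 'cV[R]_3 => (z.1, foot h z.2)) (time_oo T `*` Omega) (time_oo T `*` Omega)
   (time_oo T `*` closure Omega) (time_oo T `*` D) (time_oo T `*` D)
   (time_oo T `*` closure D) (st_frame R 1)).
- exact: open_cylinder.
- exact: open_cylinder.
- by [].
- by move=> [s x] [? ?]; split => //; exact: subset_closure.
- by move=> [s x] [? ?]; split => //; apply: (helical_domainE h_gt0 helO _).1.
- by move=> [s x] [? ?]; split => //; apply: (helical_domainE h_gt0 helO _).1.
- by move=> [s x] [? ?]; split => //; exact: closure_foot.
- have [S0 S1] := Sm_foot h.
  have St (g : 'cV[R]_3 -> R) : Sm g -> Sm (fun z : R * 'cV[R]_3 => g z.2).
    by move=> gS m; apply: Ck_snd => //; exact: openT.
  move=> [[|[|[|//]]] jp] /=; first exact: Sm_time.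
  + rewrite (_ : inord 0 = 0); last by apply/val_inj; rewrite /= inordK.
    exact: (St _ S0).
  + rewrite (_ : inord 1 = 1); last by apply/val_inj; rewrite /= inordK.
    exact: (St _ S1).
- exact: fk.
Qed.

Lemma Ck_ext k (a : R -> 'cV[R]_2 -> 'cV[R]_3) :
  (forall j, Ck_field k T (time_oo T) D (fun t y => a t y j 0)) ->
  Ck_field k T (time_oo T) Omega (fun t => ext h (a t)).
Proof.
move=> ak; have oU : open (time_oo T `*` Omega) by exact: open_cylinder.
rewrite /Ck_field /=.
have [C S] := @Sm_angle R h.
have fk j := Ck_foot (ak j).
have Ck := Ck_snd k (time_oo T `*` closure Omega) C oU (@subset_refl _ _).
have Sk := Ck_snd k (time_oo T `*` closure Omega) S oU (@subset_refl _ _).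
apply: Ck_col => //.
have H0 : Ck_upto k (time_oo T `*` Omega) (time_oo T `*` Omega) (time_oo T `*` closure Omega)
    (fun z : R * 'cV[R]_3 => ext h (a z.1) z.2 0 0).
  rewrite /ext /ht; under eq_fun do rewrite rot3E.
  by apply: Ck_add => //; apply: Ck_mul => //; [exact: (fk 0)|exact: (fk 1)].
have H1 : Ck_upto k (time_oo T `*` Omega) (time_oo T `*` Omega) (time_oo T `*` closure Omega)
    (fun z : R * 'cV[R]_3 => ext h (a z.1) z.2 1 0).
  rewrite /ext /ht; under eq_fun do rewrite rot3E.
  apply: Ck_add => //; apply: Ck_mul => //; [exact: Ck_opp|exact: (fk 0)|exact: (fk 1)].
have H2 : Ck_upto k (time_oo T `*` Omega) (time_oo T `*` Omega) (time_oo T `*` closure Omega)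
    (fun z : R * 'cV[R]_3 => ext h (a z.1) z.2 2 0).
  by rewrite /ext /ht; under eq_fun do rewrite rot3E; exact: (fk 2).
by apply: ord3_ind; [exact: H0|exact: H1|exact: H2].
Qed.

Lemma dt_ext (a : R -> 'cV[R]_2 -> 'cV[R]_3) (b : 'cV[R]_3) (t : R) (x : 'cV[R]_3) :
  (forall j, is_derive t 1 (fun s => a s (foot h x) j 0) (b j 0)) ->
  dt (fun s => ext h (a s)) t x = rot3 (x 2 0 / h) *m b.
Proof.
move=> da; have d0 := da 0; have d1 := da 1; have d2 := da 2.
set c := cos (x 2 0 / h); set s := sin (x 2 0 / h).
have e0 : is_derive t 1 (fun r => ext h (a r) x 0 0) (c * b 0 0 + s * b 1 0).
  rewrite /ext /ht; under eq_fun do rewrite rot3E; apply: is_derive_eq; dtac.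
  by rewrite /= ?scaleE /c /s; ring.
have e1 : is_derive t 1 (fun r => ext h (a r) x 1 0) (- s * b 0 0 + c * b 1 0).
  rewrite /ext /ht; under eq_fun do rewrite rot3E; apply: is_derive_eq; dtac.
  by rewrite /= ?scaleE /c /s; ring.
have e2 : is_derive t 1 (fun r => ext h (a r) x 2 0) (b 2 0).
  by rewrite /ext /ht; under eq_fun do rewrite rot3E; exact: d2.
have de : derivable (fun r => ext h (a r) x) t 1.
  apply/derivable_mxP => i j; rewrite ord1.
  by move: i; apply: ord3_ind; [case: e0|case: e1|case: e2].
have E j (v : R) : is_derive t 1 (fun r => ext h (a r) x j 0) v ->
    dt (fun s => ext h (a s)) t x j 0 = v.
  by move=> [_ <-]; rewrite dt_coord // /dt derive1E.
by apply: cv3P; rewrite rot3E; apply: E.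
Qed.

End extension_regularity.

(** * Tangency at the boundary *)

Section frontier.
Variable R : realType.

Lemma Ck_limit k (V : normedModType R) (A : set V) (f : V -> R) p :
  Ck_upto k A A (closure A) f -> closure A p ->
  exists l : R, f x @[x --> within A (nbhs p)] --> l.
Proof.
move=> fk cp; have [[g [/subspace_continuousP/(_ p cp) cg fg]] _] : Ck_upto 0 A A (closure A) f.
  exact: Ck_le fk.
exists (g p); have W : g @ within A (nbhs p) --> g p.
  apply: cvg_trans cg; apply: cvg_app; apply: within_subset.
  exact: subset_closure.
apply: cvg_trans W; apply: near_eq_cvg.
have T : nbhs p (setT : set V) by exact: filterT.
by apply: filterS T => z _ Az; rewrite /from_subspace fg.
Qed.

Lemma is_derive_comp2 (V : normedModType R) (f : 'cV[R]_2 -> R) (Phi : V -> 'cV[R]_2)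
    x u a b : differentiable f (Phi x) ->
  is_derive x u (fun z => Phi z 0 0) a -> is_derive x u (fun z => Phi z 1 0) b ->
  is_derive x u (fun z => f (Phi z)) (a * partial 0 f (Phi x) + b * partial 1 f (Phi x)).
Proof.
move=> df da db; pose dF (j : nat) := if j is 0%N then a else b.
apply: is_derive_eq.
  apply: (is_derive_comp (dPhi := dF) (cv_frame R 1) df) => -[[|[|//]] p] /=.
  - by rewrite (_ : inord 0 = 0); last by apply/val_inj; rewrite /= inordK.
  - by rewrite (_ : inord 1 = 1); last by apply/val_inj; rewrite /= inordK.
have c0 : cve R 1 (0%R : 'I_2) = delta_mx 0 0 by congr delta_mx; apply/val_inj; rewrite /= inordK.
have c1 : cve R 1 (1%R : 'I_2) = delta_mx 1 0 by congr delta_mx; apply/val_inj; rewrite /= inordK.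
by rewrite sum2E c0 c1.
Qed.

Lemma is_derive_comp3 (V : normedModType R) (f : 'cV[R]_3 -> R) (Phi : V -> 'cV[R]_3)
    x u a b c : differentiable f (Phi x) ->
  is_derive x u (fun z => Phi z 0 0) a -> is_derive x u (fun z => Phi z 1 0) b ->
  is_derive x u (fun z => Phi z 2 0) c ->
  is_derive x u (fun z => f (Phi z))
    (a * partial 0 f (Phi x) + b * partial 1 f (Phi x) + c * partial 2 f (Phi x)).
Proof.
move=> df da db dc; pose dF (j : nat) := match j with 0%N => a | 1%N => b | _ => c end.
apply: is_derive_eq.
  apply: (is_derive_comp (dPhi := dF) (cv_frame R 2) df) => -[[|[|[|//]]] p] /=.
  - by rewrite (_ : inord 0 = 0); last by apply/val_inj; rewrite /= inordK.
  - by rewrite (_ : inord 1 = 1); last by apply/val_inj; rewrite /= inordK.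
  - by rewrite (_ : inord 2 = 2); last by apply/val_inj; rewrite /= inordK.
have c0 : cve R 2 (0%R : 'I_3) = delta_mx 0 0 by congr delta_mx; apply/val_inj; rewrite /= inordK.
have c1 : cve R 2 (1%R : 'I_3) = delta_mx 1 0 by congr delta_mx; apply/val_inj; rewrite /= inordK.
have c2 : cve R 2 (2%R : 'I_3) = delta_mx 2 0 by congr delta_mx; apply/val_inj; rewrite /= inordK.
by rewrite sum3E c0 c1 c2.
Qed.

Lemma partial_rot (th : R) (f : 'cV[R]_2 -> R) z : differentiable f (rot th *m z) ->
  partial 0 (fun y => f (rot th *m y)) z =
    cos th * partial 0 f (rot th *m z) - sin th * partial 1 f (rot th *m z) /\
  partial 1 (fun y => f (rot th *m y)) z =
    sin th * partial 0 f (rot th *m z) + cos th * partial 1 f (rot th *m z).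
Proof.
move=> df.
have D i : is_derive z (delta_mx i 0) (fun y => (rot th *m y) 0 0)
     (cos th * (0 == i)%:R + sin th * (1 == i)%:R) /\
   is_derive z (delta_mx i 0) (fun y => (rot th *m y) 1 0)
     (- sin th * (0 == i)%:R + cos th * (1 == i)%:R).
  have a0 := is_derive_coord 0 z (delta_mx i 0).
  have a1 := is_derive_coord 1 z (delta_mx i 0); rewrite !delta2E in a0 a1.
  by split; under eq_fun do rewrite rotE; apply: is_derive_eq; dtac;
    rewrite /= ?scaleE; ring.
have [D00 D01] := D 0; have [D10 D11] := D 1.
split; apply: partial_val.
- by apply: is_derive_eq; first exact: (is_derive_comp2 df D00 D01);
  rewrite !eqxx /=; atoms; ring.
- by apply: is_derive_eq; first exact: (is_derive_comp2 df D10 D11);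
  rewrite !eqxx /=; atoms; ring.
Qed.

End frontier.

Section tangency.
Variables (R : realType) (h : R) (Omega : set 'cV[R]_3).
Hypotheses (h_gt0 : 0 < h) (oO : open Omega) (helO : helical_set h Omega).
Let D := cross_section Omega.
Let h0 : h != 0. Proof. exact: lt0r_neq0. Qed.
Let oD : open D. Proof. exact: open_cross_section. Qed.

Lemma foot_near p : foot h @ within Omega (nbhs p) --> within D (nbhs (foot h p)).
Proof.
move=> P nP; have H : \forall z \near p, D (foot h z) -> P (foot h z).
  exact: (@foot_continuous R h p _ nP).
rewrite /= /within /=; apply: filterS H => z H Oz.
by apply: H; exact: (helical_domainE h_gt0 helO z).1.
Qed.

Lemma point_near (y : 'cV[R]_2) :
  (fun z => point z 0) @ within D (nbhs y) --> within Omega (nbhs (point y 0)).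
Proof.
by move=> P nP; exact: (@point_continuous R 0 y _ nP).
Qed.

Section at_frontier.
Variables (p : 'cV[R]_3) (rho : 'cV[R]_3 -> R) (U : set 'cV[R]_3).
Hypotheses (Fp : frontier Omega p) (oU : open U) (Up : U p) (rhok : smooth_on U rho).
Hypothesis DU : forall x, U x -> (Omega x <-> rho x < 0).
Let th := p 2 0 / h.
Let y := foot h p.

Let rho1 : Ck_upto 1 U U U rho. Proof. exact: (rhok 1%N). Qed.

Let crho z : U z -> {for z, continuous rho}.
Proof. exact: (Ck_continuous oU (@subset_refl _ _) (@subset_refl _ _) rho1). Qed.

Let drho : differentiable rho p.
Proof. exact: (Ck_differentiable (cv_frame R 2) oU (@subset_refl _ _) rho1 Up). Qed.

(** rho vanishes along the helix through p, whose direction is xi. *)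
Lemma grad_rho_xi : p 1 0 * partial 0 rho p - p 0 0 * partial 1 rho p +
  h * partial 2 rho p = 0.
Proof.
pose c (r : R) := helix h r p.
have c0 : c 0 = p.
  by apply: cv3P; rewrite helixE ?cos0 ?sin0; ring.
have dc := is_derive_cos (0 : R); have ds := is_derive_sin (0 : R).
have d0 : is_derive (0 : R) 1 (fun r => c r 0 0) (p 1 0).
  rewrite /c; under eq_fun do rewrite helixE; apply: is_derive_eq; dtac.
  by rewrite /= ?scaleE cos0 sin0; ring.
have d1 : is_derive (0 : R) 1 (fun r => c r 1 0) (- p 0 0).
  rewrite /c; under eq_fun do rewrite helixE; apply: is_derive_eq; dtac.
  by rewrite /= ?scaleE cos0 sin0; ring.
have d2 : is_derive (0 : R) 1 (fun r => c r 2 0) h.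
  have di := is_derive_id (0 : R) (1 : R).
  rewrite /c; under eq_fun do rewrite helixE; apply: is_derive_eq; dtac.
  by rewrite /= ?scaleE; ring.
have drc : differentiable rho (c 0) by rewrite c0.
have := is_derive_comp3 drc d0 d1 d2.
rewrite c0 mulNr => -[_ E]; rewrite -E.
have cc : {for 0, continuous c}.
  have Si : Sm (fun r : R => r).
    have lid : linear (fun r : R => r) by [].
    by apply: (Sm_lin (l := mkl lid)) => r; exact: (@cvg_id _ (nbhs r)).
  have [Sc Ss] := Sm_cos_sin Si.
  apply: space_continuous; apply: Sm_continuous; rewrite /c; under eq_fun do rewrite helixE.
  - by apply: Sm_add; apply: Sm_mul => //; exact: Sm_cst.
  - by apply: Sm_add; apply: Sm_mul => //; [exact: Sm_opp|exact: Sm_cst|exact: Sm_cst].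
  - by apply: Sm_add; [exact: Sm_cst|apply: Sm_mul => //; exact: Sm_cst].
have nU : \forall r \near (0 : R), U (c r).
  by apply: cc; rewrite c0; exact: open_nbhs_nbhs.
rewrite (@near_eq_derive _ _ _ _ (fun _ : R => 0)); first exact: derive_cst.
apply: filterS nU => r Ur.
apply: (defining_frontier oO oU Ur (crho Ur) DU).
exact: frontier_helix.
Qed.

(** By foot_rho_chart and foot_rho_regular this defines the cross-section near
    the foot of p. *)
Definition foot_rho (z : 'cV[R]_2) : R := rho (helix h th (point z 0)).
Definition foot_nbhs : set 'cV[R]_2 := [set z | U (helix h th (point z 0))].

Let Phi z : 'cV[R]_3 := helix h th (point z 0).

Let Phiy : Phi y = p. Proof. exact: helix_foot. Qed.

Let SmPhi : [/\ Sm (fun z => Phi z 0 0), Sm (fun z => Phi z 1 0) & Sm (fun z => Phi z 2 0)].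
Proof.
have [S0 S1 S2] := @Sm_point R 0.
split; rewrite /Phi; under eq_fun do rewrite helixE.
- by apply: Sm_add; apply: Sm_mul => //; exact: Sm_cst.
- by apply: Sm_add; apply: Sm_mul => //; exact: Sm_cst.
- by apply: Sm_add => //; exact: Sm_cst.
Qed.

Lemma foot_rho_chart : [/\ open foot_nbhs, foot_nbhs y,
  Ck_upto 1 foot_nbhs foot_nbhs foot_nbhs foot_rho &
  forall z, foot_nbhs z -> (D z <-> foot_rho z < 0)].
Proof.
have [S0 S1 S2] := SmPhi.
have cPhi : continuous Phi by apply: space_continuous; exact: Sm_continuous.
have oN : open foot_nbhs by apply: open_comp => // z _; exact: cPhi.
split => //.
- by rewrite /foot_nbhs /= -/(Phi y) Phiy.
- apply: (@Ck_comp R 1 _ _ _ _ _ rho Phi foot_nbhs foot_nbhs foot_nbhs U U U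
    (cv_frame R 2)) => //.
  exact: (@space_coords R _ Phi (fun f => Sm f)).
- move=> z Uz; have <- := DU Uz; rewrite -[X in X <-> _]/(Omega (point z 0)); split.
    exact: helix_in.
  move=> /(helical_domainE h_gt0 helO _).1; rewrite foot_helix // => ?.
  exact/(helical_domainE h_gt0 helO _).2.
Qed.

Let c := cos th.
Let s := sin th.

Lemma partial_foot_rho :
  partial 0 foot_rho y = c * partial 0 rho p - s * partial 1 rho p /\
  partial 1 foot_rho y = s * partial 0 rho p + c * partial 1 rho p.
Proof.
have drP : differentiable rho (Phi y) by rewrite Phiy.
have E z : (Phi z 0 0 = c * z 0 0 + s * z 1 0) * (Phi z 1 0 = - s * z 0 0 + c * z 1 0) *
    (Phi z 2 0 = h * th) by rewrite /Phi !helixE !pointE add0r.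
have G i : partial i foot_rho y =
  (c * (0 == i)%:R + s * (1 == i)%:R) * partial 0 rho p +
  (- s * (0 == i)%:R + c * (1 == i)%:R) * partial 1 rho p + 0 * partial 2 rho p.
  have a0 := is_derive_coord 0 y (delta_mx i 0).
  have a1 := is_derive_coord 1 y (delta_mx i 0); rewrite !delta2E in a0 a1.
  apply: partial_val; rewrite -[in partial 0 rho p]Phiy -[in partial 1 rho p]Phiy.
  rewrite -[in partial 2 rho p]Phiy.
  apply: is_derive_comp3 => //; under eq_fun do rewrite E.
  - by apply: is_derive_eq; dtac; rewrite /= ?scaleE; ring.
  - by apply: is_derive_eq; dtac; rewrite /= ?scaleE; ring.
  - exact: dcst.
by rewrite !G !eqxx /=; atoms; split; ring.
Qed.

(** By grad_rho_xi, the gradient of rho at p cannot be vertical. *)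
Lemma foot_rho_regular : grad rho p != 0 ->
  0 < ('D_(e0 R) foot_rho y) ^+ 2 + ('D_(e1 R) foot_rho y) ^+ 2.
Proof.
have [E0 E1] := partial_foot_rho.
move=> gn; apply: sum_sqr_gt0; rewrite -/(partial 0 foot_rho y) -/(partial 1 foot_rho y).
rewrite E0 E1 => -[Z0 Z1].
have S := cos_sin2 th; rewrite -/c -/s in S.
have r0 : partial 0 rho p = 0.
  have -> : partial 0 rho p = c * (c * partial 0 rho p - s * partial 1 rho p) +
    s * (s * partial 0 rho p + c * partial 1 rho p) by ring: S.
  by rewrite Z0 Z1; ring.
have r1 : partial 1 rho p = 0.
  have -> : partial 1 rho p = c * (s * partial 0 rho p + c * partial 1 rho p) -
    s * (c * partial 0 rho p - s * partial 1 rho p) by ring: S.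
  by rewrite Z0 Z1; ring.
have := grad_rho_xi; rewrite r0 r1 !mulr0 subr0 add0r => /eqP.
rewrite mulf_eq0 (negbTE h0) /= => /eqP r2.
by move/eqP: gn; apply; apply: cv3P; rewrite mxE [RHS]mxE; [exact: r0|exact: r1|exact: r2].
Qed.

(** The part of the velocity along xi is tangent because rho is constant on
    helices; the rest is the turned gradient of the stream function. *)
Lemma ext_tangent (F0 F1 Q : 'cV[R]_2 -> R) (G0 G1 q l : R) :
  F0 @ within D (nbhs y) --> G0 -> F1 @ within D (nbhs y) --> G1 ->
  Q @ within D (nbhs y) --> q ->
  G0 * partial 1 foot_rho y - G1 * partial 0 foot_rho y = 0 ->
  (fun x => dot (ext h (stream_field h F0 F1 Q) x) (l *: grad rho p))
    @ within Omega (nbhs p) --> (0 : R).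
Proof.
have alg (k co si g0 g1 u z0 z1 a0 a1 a2 : R) :
    (co * (g1 + z1 * u) + si * (- g0 - z0 * u)) * (k * a0) +
    (- si * (g1 + z1 * u) + co * (- g0 - z0 * u)) * (k * a1) + (h * u) * (k * a2) =
    k * (u * ((- si * z0 + co * z1) * a0 - (co * z0 + si * z1) * a1 + h * a2) -
         (g0 * (si * a0 + co * a1) - g1 * (co * a0 - si * a1))) by ring.
move=> l0 l1 lq Z.
have [P0 P1] := partial_foot_rho.
have lim (g : 'cV[R]_2 -> R) (v : R) : g @ within D (nbhs y) --> v ->
    (fun x => g (foot h x)) @ within Omega (nbhs p) --> v.
  by move=> gv; apply: cvg_trans gv => P /foot_near.
have L0 := lim _ _ l0; have L1 := lim _ _ l1; have Lq := lim _ _ lq.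
have smooth (g : 'cV[R]_3 -> R) : Sm g ->
    g x @[x --> within Omega (nbhs p)] --> (g p : R).
  move=> gS P /(@Sm_continuous R _ g gS p) nP.
  have {}nP : \forall z \near p, P (g z) by [].
  have : \forall z \near p, Omega z -> P (g z) by apply: filterS nP.
  by [].
have [SC SS] := @Sm_angle R h; have [Sf0 Sf1] := @Sm_foot R h.
have LC := smooth _ SC; have LS := smooth _ SS.
have Lf0 := smooth _ Sf0; have Lf1 := smooth _ Sf1.
pose A0 x := F1 (foot h x) + foot h x 1 0 * Q (foot h x).
pose A1 x := - F0 (foot h x) - foot h x 0 0 * Q (foot h x).
have LA0 : A0 @ within Omega (nbhs p) --> G1 + y 1 0 * q.
  by apply: cvgD => //; apply: cvgM.
have LA1 : A1 @ within Omega (nbhs p) --> - G0 - y 0 0 * q.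
  by apply: cvgB; [exact: cvgN|exact: cvgM].
rewrite (_ : (fun x : 'cV[R]_3 => dot _ _) = fun x : 'cV[R]_3 =>
    (cos (x 2 0 / h) * A0 x + sin (x 2 0 / h) * A1 x) * (l * partial 0 rho p) +
    (- sin (x 2 0 / h) * A0 x + cos (x 2 0 / h) * A1 x) * (l * partial 1 rho p) +
    (h * Q (foot h x)) * (l * partial 2 rho p)); last first.
  apply/funext => x; rewrite dot3E /ext /ht !rot3E /stream_field !col3E.
  have E i : (l *: grad rho p) i 0 = l * partial i rho p by rewrite 2!mxE.
  by rewrite !E.
rewrite (_ : 0 = (c * (G1 + y 1 0 * q) + s * (- G0 - y 0 0 * q)) * (l * partial 0 rho p) +
   (- s * (G1 + y 1 0 * q) + c * (- G0 - y 0 0 * q)) * (l * partial 1 rho p) +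
   (h * q) * (l * partial 2 rho p)).
  apply: cvgD; [apply: cvgD|]; apply: cvgM; try exact: cvg_cst.
  - by apply: cvgD; apply: cvgM.
  - by apply: cvgD; apply: cvgM => //; exact: cvgN.
  - by apply: cvgM => //; exact: cvg_cst.
have X := grad_rho_xi.
have [Y0 Y1] := rot_foot h p; rewrite -/th -/c -/s -/y in Y0 Y1.
rewrite -Y0 -Y1 in X; rewrite P0 P1 in Z.
by rewrite alg X Z; ring.
Qed.

End at_frontier.

End tangency.

(** * From the planar system to helical flows *)

Section reconstruction.
Variables (R : realType) (h : R).
Hypothesis h_gt0 : 0 < h.
Let h0 : h != 0. Proof. exact: lt0r_neq0. Qed.

(** The speed along xi that gives the swirl v. *)
Definition stream_speed (f v : 'cV[R]_2 -> R) y : R := (v y - radial f y) * (xi2 h y)^-1.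

Lemma swirl_of_speed (f v : 'cV[R]_2 -> R) :
  stream_swirl h (partial 0 f) (partial 1 f) (stream_speed f v) = v.
Proof.
apply/funext => y; rewrite /stream_swirl /stream_speed /radial.
by rewrite mulrC mulfVK ?subrK // xi2_neq0.
Qed.

Lemma vtildeE (f v : 'cV[R]_2 -> R) :
  vtilde h f v = stream_field h (partial 0 f) (partial 1 f) (stream_speed f v).
Proof.
apply/funext => y; have X0 := xi2_neq0 h_gt0 y.
have E i : grad f y i 0 = partial i f y by rewrite mxE.
have addE (A B : 'cV[R]_3) i : (A + B) i 0 = A i 0 + B i 0 by rewrite mxE.
have scE (n : nat) (k : R) (A : 'cV[R]_n) i : (k *: A) i 0 = k * A i 0 by rewrite mxE.
rewrite /vtilde /utilde /stream_field /stream_speed /radial.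
apply: cv3P; rewrite addE !col3E pointE !scE !mat2E !E ?xiE.
all: by move: X0; rewrite /xi2; atoms => X0; field; rewrite ?X0 ?h0.
Qed.

Lemma velocity_ext (f v : 'cV[R]_2 -> R) : helical_velocity h f v =
  ext h (stream_field h (partial 0 f) (partial 1 f) (stream_speed f v)).
Proof. by rewrite -vtildeE. Qed.

Lemma vorticity_ext (v w : 'cV[R]_2 -> R) x : differentiable v (foot h x) ->
  helical_vorticity h v w x = ext h (plane_vorticity h v w) x.
Proof.
move=> dv; rewrite /foot in dv.
have [E0 E1] := partial_rot dv.
have [Y0 Y1] := rot_foot h x.
have addE (A B : 'cV[R]_3) i : (A + B) i 0 = A i 0 + B i 0 by rewrite mxE.
have scE (k : R) (A : 'cV[R]_3) i : (k *: A) i 0 = k * A i 0 by rewrite mxE.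
have ct : cos (- ht x / h) = cos (ht x / h) by rewrite mulNr cosN.
have st : sin (- ht x / h) = - sin (ht x / h) by rewrite mulNr sinN.
rewrite -/(foot h x) ct st in E0 E1.
rewrite /helical_vorticity /ext /plane_vorticity /= E0 E1 -/(foot h x) /ht.
by apply: cv3P; rewrite addE !scE rot3E !col3E ?xiE ?horE -?Y0 -?Y1; atoms; field.
Qed.

End reconstruction.

Lemma is_derive_jacobian (R : realType) (V : normedModType R) (x e : V)
    (f g k l : V -> R) (f' g' k' l' : R) :
  is_derive x e f f' -> is_derive x e g g' -> is_derive x e k k' -> is_derive x e l l' ->
  is_derive x e (fun z => - (f z * g z - k z * l z))
    (- (f x * g' + g x * f' - (k x * l' + l x * k'))).
Proof. by move=> df dg dk dl; apply: is_derive_eq; dtac. Qed.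

Lemma Sm_xi2V (R : realType) (h : R) : 0 < h -> Sm (fun y => (xi2 h y)^-1).
Proof.
move=> h_gt0; apply: Sm_inv => [|y]; last exact: xi2_neq0.
rewrite /xi2; apply: Sm_add; last by apply: Sm_exp; exact: Sm_coord.
by apply: Sm_add; [exact: Sm_cst|apply: Sm_exp; exact: Sm_coord].
Qed.

Section planar_to_space.
Variables (R : realType) (h : R) (T : \bar R) (Omega : set 'cV[R]_3).
Hypotheses (h_gt0 : 0 < h) (oO : open Omega) (helO : helical_set h Omega).
Let D := cross_section Omega.
Let h0 : h != 0. Proof. exact: lt0r_neq0. Qed.
Let oD : open D. Proof. exact: open_cross_section. Qed.

Variables (v0 w0 : 'cV[R]_2 -> R) (phi v w : R -> 'cV[R]_2 -> R).
Hypothesis sol : planar_solution T h D v0 w0 phi v w.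

Let F0 t := partial 0 (phi t).
Let F1 t := partial 1 (phi t).
Let Q t := stream_speed h (phi t) (v t).
Let a t := stream_field h (F0 t) (F1 t) (Q t).
Let b t := plane_vorticity h (v t) (w t).

Let C := time_oo T `*` D.
Let K := time_oo T `*` closure D.
Let oC : open C. Proof. exact: open_cylinder. Qed.

Let sC : C `<=` C. Proof. exact: subset_refl. Qed.

Let spatial k (g : 'cV[R]_2 -> R) : Sm g -> Ck_upto k C C K (fun z => g z.2).
Proof. by move=> gS; exact: (Ck_snd k K gS oC sC). Qed.

Let F0k : Ck_field 2 T (time_oo T) D F0.
Proof. by have [[_ _ reg] _ _ _] := sol; have [_ H] := reg 0; exact: H. Qed.

Let F1k : Ck_field 2 T (time_oo T) D F1.
Proof. by have [[_ _ reg] _ _ _] := sol; have [_ H] := reg 1; exact: H. Qed.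

Let positive_times : time_oo T `<=` time_co T.
Proof. by move=> t [/ltW]. Qed.

Let interior_field k (f : R -> 'cV[R]_2 -> R) :
  Ck_field k T (time_co T) D f -> Ck_field k T (time_oo T) D f.
Proof.
by apply: Ck_mono => // z [/positive_times ? ?].
Qed.

Let vk : Ck_field 2 T (time_oo T) D v.
Proof. by have [[vk _ _] _ _ _] := sol; exact: interior_field. Qed.

Let wk : Ck_field 1 T (time_oo T) D w.
Proof. by have [[_ wk _] _ _ _] := sol; exact: interior_field. Qed.

Let Qk : Ck_field 2 T (time_oo T) D Q.
Proof.
have y0 := spatial 2 (Sm_coord R (0 : 'I_2)); have y1 := spatial 2 (Sm_coord R (1 : 'I_2)).
apply: (Ck_mul oC sC); last exact: (spatial 2 (Sm_xi2V h_gt0)).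
apply: (Ck_sub oC sC); first exact: vk.
by apply: (Ck_add oC sC); apply: (Ck_mul oC sC); [exact: y0|exact: F0k|exact: y1|exact: F1k].
Qed.

Let ak j : Ck_field 2 T (time_oo T) D (fun t y => a t y j 0).
Proof.
have y0 := spatial 2 (Sm_coord R (0 : 'I_2)); have y1 := spatial 2 (Sm_coord R (1 : 'I_2)).
move: j; apply: ord3_ind; rewrite /Ck_field /a /stream_field; under eq_fun do rewrite col3E.
- apply: (Ck_add oC sC); first exact: F1k.
  by apply: (Ck_mul oC sC); [exact: y1|exact: Qk].
- apply: (Ck_sub oC sC); first by apply: (Ck_opp oC sC); exact: F0k.
  by apply: (Ck_mul oC sC); [exact: y0|exact: Qk].
- by apply: (Ck_scale _ oC sC); exact: Qk.
Qed.

Let bk j : Ck_field 1 T (time_oo T) D (fun t y => b t y j 0).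
Proof.
have y0 := spatial 1 (Sm_coord R (0 : 'I_2)); have y1 := spatial 1 (Sm_coord R (1 : 'I_2)).
have cst := spatial 1 (@Sm_cst _ _ h^-1).
have vi i := field_partial oD i vk.
move: j; apply: ord3_ind; rewrite /Ck_field /b /plane_vorticity; under eq_fun do rewrite col3E.
- apply: (Ck_mul oC sC); last exact: cst.
  apply: (Ck_add oC sC); last exact: (vi 1).
  by apply: (Ck_mul oC sC); [exact: wk|exact: y1].
- apply: (Ck_mul oC sC); last exact: cst.
  apply: (Ck_opp oC sC); apply: (Ck_add oC sC); last exact: (vi 0).
  by apply: (Ck_mul oC sC); [exact: wk|exact: y0].
- exact: wk.
Qed.

Let velE t : helical_velocity h (phi t) (v t) = ext h (a t).
Proof. exact: velocity_ext. Qed.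

Let vortE t x : time_oo T t -> Omega x ->
  helical_vorticity h (v t) (w t) x = ext h (b t) x.
Proof.
move=> tT Ox; apply: vorticity_ext => //.
exact: (field_differentiable oD vk tT ((helical_domainE h_gt0 helO x).1 Ox)).
Qed.

Section at_time.
Variables (t : R) (y : 'cV[R]_2).
Hypotheses (tT : time_oo T t) (Dy : D y).

Let swE : stream_swirl h (F0 t) (F1 t) (Q t) = v t.
Proof. exact: swirl_of_speed. Qed.

Let d0 := field_differentiable oD F0k tT Dy.
Let d1 := field_differentiable oD F1k tT Dy.
Let dQ := field_differentiable oD Qk tT Dy.

Lemma stream_sym : partial 0 (F1 t) y = partial 1 (F0 t) y.
Proof.
have g0 := Ck_slice oD F0k tT; have g1 := Ck_slice oD F1k tT.
have [[_ _ reg] _ _ _] := sol.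
have nD : \forall z \near y, D z by exact: open_nbhs_nbhs.
apply: schwarz.
- by apply: filterS nD => z Dz; have [d _] := reg 1; exact: d.
- by apply: filterS nD => z Dz; have [d _] := reg 0; exact: d.
- exact: (Ck_near_derivable _ oD g1 Dy).
- exact: (Ck_near_derivable _ oD g0 Dy).
- exact: (Ck_continuous oD (@subset_refl _ _) (@subset_closure _ D) (Ck_derive _ g1) Dy).
- exact: (Ck_continuous oD (@subset_refl _ _) (@subset_closure _ D) (Ck_derive _ g0) Dy).
Qed.

Lemma stream_vorticityE : stream_vorticity (F0 t) (F1 t) (Q t) y = w t y.
Proof.
have [_ eqs _ _] := sol; have [_ _ E3] := eqs t y tT Dy.
have nE : \forall z \near y, partial 0 (phi t) z = F0 t z /\ partial 1 (phi t) z = F1 t z.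
  have nD : nbhs y D by exact: open_nbhs_nbhs.
  by apply: filterS nD => z _; split.
have := LK_stream h_gt0 d0 d1 dQ stream_sym nE.
rewrite E3 swE => L; apply/esym.
apply: (addIr (2 * h ^+ 2 * v t y / xi2 h y ^+ 2 + radial (v t) y / xi2 h y)).
by rewrite !addrA.
Qed.

(** The horizontal components use the transport equation of v differentiated in
    space, where the time and space derivatives of v are exchanged. *)
Lemma plane_equation : 
  col3 ((dt w t y * y 1 0 + dt (fun s => partial 1 (v s)) t y) / h)
    (- (dt w t y * y 0 0 + dt (fun s => partial 0 (v s)) t y) / h) (dt w t y) +
  plane_adv h (a t) (b t) y = plane_adv h (b t) (a t) y.
Proof.
have [_ eqs _ _] := sol; have [_ E2 _] := eqs t y tT Dy.
have dv i := field_differentiable oD (field_partial oD i vk) tT Dy.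
have gradE (f : 'cV[R]_2 -> R) z i : grad f z i 0 = partial i f z by rewrite mxE.
have E1 z : D z -> dt v t z = - (F1 t z * partial 0 (v t) z - F0 t z * partial 1 (v t) z).
  move=> Dz; have [E1 _ _] := eqs t z tT Dz.
  move/eqP: E1; rewrite addr_eq0 => /eqP ->.
  by rewrite dot2E /perp col2E0 col2E1 !gradE mulNr.
have V i : dt (fun s => partial i (v s)) t y +
    (F1 t y * partial i (partial 0 (v t)) y + partial i (F1 t) y * partial 0 (v t) y -
    (F0 t y * partial i (partial 1 (v t)) y + partial i (F0 t) y * partial 1 (v t) y)) = 0.
  rewrite (dt_partial oD i vk tT Dy).
  rewrite (partial_eq oD i Dy E1).
  have a0 := is_derive_partial i d0; have a1 := is_derive_partial i d1.
  have b0 := is_derive_partial i (dv 0); have b1 := is_derive_partial i (dv 1).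
  have -> : partial i (fun z => - (F1 t z * partial 0 (v t) z - F0 t z * partial 1 (v t) z)) y =
    - (F1 t y * partial i (partial 0 (v t)) y + partial 0 (v t) y * partial i (F1 t) y -
    (F0 t y * partial i (partial 1 (v t)) y + partial 1 (v t) y * partial i (F0 t) y)).
    exact: (partial_val (is_derive_jacobian a1 b0 a0 b1)).
  by move: (F0 t y) (F1 t y) => f0 f1; atoms; ring.
have S := stretching_term h_gt0 d0 d1 dQ; rewrite swE in S.
have P := plane_vorticity_equation h_gt0 d0 d1 dQ stream_sym (w := w t).
rewrite swE in P; apply: P.
- exact: (field_differentiable oD wk tT Dy).
- exact: dv.
- exact: dv.
- exact: (partial_sym oD 0 1 vk tT Dy).
- rewrite -S -E2 dot2E /perp col2E0 col2E1 !gradE mulNr addrA.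
  by [].
- exact: V.
- exact: V.
Qed.

End at_time.

(** Each equation is the extension of its plane form.  On the boundary, phi has
    an expansion whose tangential part is zero, which is the tangency. *)
Lemma vorticity_solution_of_planar :
  vorticity_solution T Omega (fun t => helical_velocity h (phi t) (v t))
    (fun t => helical_vorticity h (v t) (w t)).
Proof.
split.
- split.
    have E : (fun t => helical_velocity h (phi t) (v t)) = fun t => ext h (a t).
      by apply/funext => t; exact: velE.
    by rewrite E; exact: (Ck_ext h_gt0 oO helO ak).
  apply: (@Ck_eq _ _ _ _ _ _ _ (fun z : R * 'cV[R]_3 => ext h (b z.1) z.2)) => //.
  + exact: open_cylinder.
  + by move=> [t x] [tT Ox]; rewrite vortE.
  + exact: (Ck_ext h_gt0 oO helO bk).
- move=> t x tT Ox; have Dy := (helical_domainE h_gt0 helO x).1 Ox.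
  rewrite vortE // velE curl_ext // => [|j]; last exact: (field_differentiable oD (ak j) tT Dy).
  have c0 := field_differentiable oD F0k tT Dy.
  have c1 := field_differentiable oD F1k tT Dy.
  have cQ := field_differentiable oD Qk tT Dy.
  rewrite (curl_stream_field h_gt0 c0 c1 cQ (stream_sym tT Dy)).
  rewrite swirl_of_speed // /ext; congr (_ *m _).
  by rewrite /b /plane_vorticity (stream_vorticityE tT Dy).
- move=> t x tT Ox; have Dy := (helical_domainE h_gt0 helO x).1 Ox.
  have -> : dt (fun s => helical_vorticity h (v s) (w s)) t x =
      dt (fun s => ext h (b s)) t x.
    by apply: (field_near_dt tT) => s sT; exact: vortE.
  have -> : adv (helical_velocity h (phi t) (v t)) (helical_vorticity h (v t) (w t)) x =
      adv (ext h (a t)) (ext h (b t)) x.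
    rewrite velE /adv; apply: eq_bigr => i _; congr (_ *: _).
    by apply: (partial_eq oO i Ox) => z Oz; exact: vortE.
  have -> : adv (helical_vorticity h (v t) (w t)) (helical_velocity h (phi t) (v t)) x =
      adv (ext h (b t)) (ext h (a t)) x.
    by rewrite velE /adv; apply: eq_bigr => i _; rewrite vortE.
  rewrite !adv_ext // => [|j|j]; last exact: (field_differentiable oD (bk j) tT Dy).
    rewrite -(plane_equation tT Dy) mulmxDr; congr (_ + _).
    have dw := field_derivable_dt wk tT Dy.
    have dv i := field_derivable_dt (field_partial oD i vk) tT Dy.
    have dv0 := dv 0; have dv1 := dv 1.
    apply: dt_ext; apply: ord3_ind; rewrite col3E; under eq_fun do rewrite col3E.
    + by apply: is_derive_eq; dtac; rewrite /= ?scaleE; atoms; ring.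
    + by apply: is_derive_eq; dtac; rewrite /= ?scaleE; atoms; ring.
    + exact: dw.
  exact: (field_differentiable oD (ak j) tT Dy).
- move=> t tT p m Fp [rho [U [oU Up rhok gn DU]] ->].
  have Fy := frontier_foot h_gt0 oO helO Fp.
  have [cy _] := (frontierE _ oD).1 Fy.
  have [G0 l0] := Ck_limit (Ck_slice oD F0k tT) cy.
  have [G1 l1] := Ck_limit (Ck_slice oD F1k tT) cy.
  have [q lq] := Ck_limit (Ck_slice oD Qk tT) cy.
  have [oN Ny rN DN] := foot_rho_chart h_gt0 helO oU Up rhok DU.
  have rn := foot_rho_regular h_gt0 oO helO Fp oU Up rhok DU gn.
  have [[_ _ reg] _ bnd _] := sol.
  have dphi z : D z -> is_derive z (e0 R) (phi t) (F0 t z) /\ is_derive z (e1 R) (phi t) (F1 t z).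
    move=> Dz; split; apply: DeriveDef => //.
    + by have [d _] := reg 0; exact: d.
    + by have [d _] := reg 1; exact: d.
  have cF (F : R -> 'cV[R]_2 -> R) z : Ck_field 2 T (time_oo T) D F -> D z ->
      {for z, continuous (F t)}.
    move=> Fk Dz.
    exact: (Ck_continuous oD (@subset_refl _ _) (@subset_closure _ D) (Ck_slice oD Fk tT) Dz).
  have [|c0 E] := boundary_expansion oD Fy oN Ny rN DN rn dphi _ l0 l1.
    by move=> z Dz; split; exact: cF.
  have Z := tangential_derivative_zero oD Fy oN Ny rN DN rn E (bnd t tT).
  rewrite velE.
  exact: (ext_tangent h_gt0 oO helO Fp oU Up rhok DU _ l0 l1 lq Z).
Qed.

Lemma reconstruction_helical t : time_oo T t ->
  helical_field h Omega (helical_velocity h (phi t) (v t)) /\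
  helical_field h Omega (helical_vorticity h (v t) (w t)).
Proof.
move=> tT; split=> th x Ox; first by rewrite velE ext_helix.
by rewrite !vortE ?ext_helix //; exact: helix_in.
Qed.

End planar_to_space.

(** * From helical flows to the planar system *)

Section euler_plane.
Variables (R : realType) (h : R).
Hypothesis h_gt0 : 0 < h.
Let h0 : h != 0. Proof. exact: lt0r_neq0. Qed.

(** For p the pressure: its derivatives A0 and A1 are of class C^1 by the Euler
    equations, and then schwarz applies. *)
Lemma mixed_partials (D K : set 'cV[R]_2) (p A0 A1 : 'cV[R]_2 -> R) y :
  open D -> D `<=` K -> Ck_upto 1 D D K A0 -> Ck_upto 1 D D K A1 ->
  (forall z, D z -> is_derive z (delta_mx 0 0) p (A0 z) /\
                    is_derive z (delta_mx 1 0) p (A1 z)) ->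
  D y -> partial 1 A0 y = partial 0 A1 y.
Proof.
move=> oD DK A0k A1k dp Dy.
have nD : nbhs y D by exact: open_nbhs_nbhs.
have E0 z : D z -> A0 z = 'D_(delta_mx 0 0) p z by move=> /dp[[_ ->]].
have E1 z : D z -> A1 z = 'D_(delta_mx 1 0) p z by move=> /dp[_ [_ ->]].
have p0k := Ck_eq oD (@subset_refl _ D) E0 A0k.
have p1k := Ck_eq oD (@subset_refl _ D) E1 A1k.
rewrite (partial_eq oD 1 Dy E0) (partial_eq oD 0 Dy E1).
apply: schwarz.
- by apply: filterS nD => z /dp[[]].
- by apply: filterS nD => z /dp[_ []].
- exact: (Ck_near_derivable _ oD p0k Dy).
- exact: (Ck_near_derivable _ oD p1k Dy).
- exact: (Ck_continuous oD (@subset_refl _ _) DK (Ck_derive _ p0k) Dy).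
- exact: (Ck_continuous oD (@subset_refl _ _) DK (Ck_derive _ p1k) Dy).
Qed.

Lemma rot3_0 (u : 'cV[R]_3) : rot3 0 *m u = u.
Proof. by apply: cv3P; rewrite !rot3E ?cos0 ?sin0; ring. Qed.

(** The components of a are recovered from its flow and its speed along xi. *)
Lemma stream_of_field (a : 'cV[R]_2 -> 'cV[R]_3) :
  stream_field h (fun y => - flow_comp h a y 1 0) (fun y => flow_comp h a y 0 0)
    (fun y => a y 2 0 / h) = a.
Proof.
apply/funext => y; rewrite /stream_field /flow_comp col2E0 col2E1.
by apply: cv3P; rewrite !col3E; atoms; field.
Qed.

Variables (F0 F1 Q : 'cV[R]_2 -> R) (y : 'cV[R]_2).
Hypotheses (d0 : differentiable F0 y) (d1 : differentiable F1 y) (dQ : differentiable Q y).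
Let a := stream_field h F0 F1 Q.
Let v := stream_swirl h F0 F1 Q.

(** The pressure has no derivative along xi, and along the flow xi turns with
    the frame. *)
Lemma swirl_transport (b0 b1 b2 p0 p1 : R) :
  b0 + plane_adv h a a y 0 0 = - p0 -> b1 + plane_adv h a a y 1 0 = - p1 ->
  b2 + plane_adv h a a y 2 0 = - ((y 0 0 * p1 - y 1 0 * p0) / h) ->
  y 1 0 * b0 - y 0 0 * b1 + h * b2 + (F1 y * partial 0 v y - F0 y * partial 1 v y) = 0.
Proof.
have [A0 A1 A2] := partial_stream_field h d0 d1 dQ 0.
have [B0 B1 B2] := partial_stream_field h d0 d1 dQ 1.
have S0 := partial_stream_swirl h d0 d1 dQ 0; have S1 := partial_stream_swirl h d0 d1 dQ 1.
rewrite !eqxx /= in A0 A1 B0 B1 S0 S1.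
have fa := flow_stream_field h_gt0 F0 F1 Q y.
rewrite (plane_adv_val fa A0 A1 A2 B0 B1 B2) S0 S1 !col3E.
rewrite /xi2 {A0 A1 A2 B0 B1 B2 S0 S1 fa}; atoms.
move=> /(canRL (addrK _)) -> /(canRL (addrK _)) -> /(canRL (addrK _)) ->.
by field.
Qed.

End euler_plane.

Lemma is_derive_transport (R : realType) (V : normedModType R) (x e : V)
    (d f g k l q r : V -> R) (d' f' g' k' l' q' r' : R) :
  is_derive x e d d' -> is_derive x e f f' -> is_derive x e g g' -> is_derive x e k k' ->
  is_derive x e l l' -> is_derive x e q q' -> is_derive x e r r' ->
  is_derive x e (fun z => d z + (f z * g z - k z * l z) + q z * r z)
    (d' + (f x * g' + g x * f' - (k x * l' + l x * k')) + (q x * r' + r x * q')).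
Proof. by move=> dd df dg dk dl dq dr; apply: is_derive_eq; dtac. Qed.

Section space_to_plane.
Variables (R : realType) (h : R) (T : \bar R) (Omega : set 'cV[R]_3).
Hypotheses (h_gt0 : 0 < h) (T_gt0 : (0 < T)%E) (oO : open Omega).
Hypothesis helO : helical_set h Omega.
Let D := cross_section Omega.
Let h0 : h != 0. Proof. exact: lt0r_neq0. Qed.
Let oD : open D. Proof. exact: open_cross_section. Qed.
Hypotheses (domD : domain D) (bndD : bounded_set D) (scD : simply_connected R D).
Hypothesis smoothD : smooth_boundary D.

Variables (v0 : 'cV[R]_3 -> 'cV[R]_3) (v : R -> 'cV[R]_3 -> 'cV[R]_3).
Variable P : R -> 'cV[R]_3 -> R.
Hypothesis euler : euler_solution T Omega v0 v P.
Hypothesis helical : forall t, time_oo T t ->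
  helical_field h Omega (v t) /\ helical_function h Omega (P t).

Let a t y : 'cV[R]_3 := v t (point y 0).
Let F0 t y := - flow_comp h (a t) y 1 0.
Let F1 t y := flow_comp h (a t) y 0 0.
Let Q t y := a t y 2 0 / h.

Let aE t : stream_field h (F0 t) (F1 t) (Q t) = a t.
Proof. exact: stream_of_field. Qed.

Let swE t : (fun y => swirl h (v t) (point y 0)) = stream_swirl h (F0 t) (F1 t) (Q t).
Proof.
apply/funext => y; rewrite -swirl_stream_field aE /swirl; congr (dot _ (xi h _)).
by apply: cv2P; rewrite horE pointE.
Qed.

Let positive_times : time_oo T `<=` time_co T.
Proof. by move=> t [/ltW]. Qed.

Let Uo := time_oo T `*` Omega.
Let C := time_oo T `*` D.
Let M := time_co T `*` D.
Let K := time_co T `*` closure D.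
Let oC : open C. Proof. exact: open_cylinder. Qed.
Let CM : C `<=` M. Proof. by move=> z [/positive_times ? ?]. Qed.

Let interior_field k (f : R -> 'cV[R]_2 -> R) :
  Ck_field k T (time_co T) D f -> Ck_field k T (time_oo T) D f.
Proof. by apply: Ck_mono => // z [/positive_times ? ?]. Qed.

Let spatial k (g : 'cV[R]_2 -> R) : Sm g -> Ck_upto k C M K (fun z => g z.2).
Proof. by move=> gS; exact: (Ck_snd k K gS oC CM). Qed.

Let Ck_plane k (f : R -> 'cV[R]_3 -> R) : Ck_field k T (time_co T) Omega f ->
  Ck_field k T (time_co T) D (fun t y => f t (point y 0)).
Proof.
move=> fk.
apply: (@Ck_comp R k _ _ _ _ _ (fun z : R * 'cV[R]_3 => f z.1 z.2)
   (fun z : R * 'cV[R]_2 => (z.1, point z.2 0)) C M K Uo (time_co T `*` Omega)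
   (time_co T `*` closure Omega) (st_frame R 2)).
- exact: oC.
- exact: open_cylinder.
- exact: CM.
- by move=> [s x] [/positive_times ? ?]; split => //; exact: subset_closure.
- by move=> [s x] [? ?].
- by move=> [s x] [? ?].
- by move=> [s x] [? ?]; split => //; exact: closure_point.
- have [S0 S1 S2] := @Sm_point R 0.
  have St (g : 'cV[R]_2 -> R) : Sm g -> Sm (fun z : R * 'cV[R]_2 => g z.2).
    by move=> gS m; exact: (Ck_snd m setT gS openT (@subset_refl _ _)).
  move=> [[|[|[|[|//]]]] jp] /=; first exact: Sm_time.
  + rewrite (_ : inord 0 = 0); last by apply/val_inj; rewrite /= inordK.
    exact: (St _ S0).
  + rewrite (_ : inord 1 = 1); last by apply/val_inj; rewrite /= inordK.
    exact: (St _ S1).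
  + rewrite (_ : inord 2 = 2); last by apply/val_inj; rewrite /= inordK.
    exact: (St _ S2).
- exact: fk.
Qed.

Let vk j : Ck_field 2 T (time_co T) Omega (fun t x => v t x j 0).
Proof.
have [[vk _] _ _ _ _] := euler.
apply: (Ck_coord j _ _ vk); first exact: open_cylinder.
by move=> z [/positive_times ? ?].
Qed.

Let ak j : Ck_field 2 T (time_co T) D (fun t y => a t y j 0).
Proof. exact: (Ck_plane (vk j)). Qed.

Let Qk : Ck_field 2 T (time_co T) D Q.
Proof.
apply: (Ck_mul oC CM); first exact: (ak 2).
exact: (spatial 2 (@Sm_cst _ _ h^-1)).
Qed.

Let F0k : Ck_field 2 T (time_co T) D F0.
Proof.
rewrite /Ck_field /F0 /flow_comp; under eq_fun do rewrite col2E1.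
have y0 := spatial 2 (Sm_coord R (0 : 'I_2)); have c := spatial 2 (@Sm_cst _ _ h^-1).
apply: (Ck_opp oC CM); apply: (Ck_add oC CM); first exact: (ak 1).
by apply: (Ck_mul oC CM); [apply: (Ck_mul oC CM); [exact: y0|exact: (ak 2)]|exact: c].
Qed.

Let F1k : Ck_field 2 T (time_co T) D F1.
Proof.
rewrite /Ck_field /F1 /flow_comp; under eq_fun do rewrite col2E0.
have y1 := spatial 2 (Sm_coord R (1 : 'I_2)); have c := spatial 2 (@Sm_cst _ _ h^-1).
apply: (Ck_sub oC CM); first exact: (ak 0).
by apply: (Ck_mul oC CM); [apply: (Ck_mul oC CM); [exact: y1|exact: (ak 2)]|exact: c].
Qed.

Let swk : Ck_field 2 T (time_co T) D (fun t y => swirl h (v t) (point y 0)).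
Proof.
have E (z : R * 'cV[R]_2) : M z -> stream_swirl h (F0 z.1) (F1 z.1) (Q z.1) z.2 =
    swirl h (v z.1) (point z.2 0) by move=> _; rewrite -(swE z.1).
apply: (Ck_eq oC CM E).
have y0 := spatial 2 (Sm_coord R (0 : 'I_2)); have y1 := spatial 2 (Sm_coord R (1 : 'I_2)).
have x2 : Ck_upto 2 C M K (fun z => xi2 h z.2).
  apply: (spatial 2); rewrite /xi2; apply: Sm_add; last by apply: Sm_exp; exact: Sm_coord.
  by apply: Sm_add; [exact: Sm_cst|apply: Sm_exp; exact: Sm_coord].
apply: (Ck_add oC CM); first by apply: (Ck_mul oC CM); [exact: x2|exact: Qk].
by apply: (Ck_add oC CM); apply: (Ck_mul oC CM); [exact: y0|exact: F0k|exact: y1|exact: F1k].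
Qed.

Let wk : Ck_field 1 T (time_co T) D (fun t y => curl (v t) (point y 0) 2 0).
Proof.
have d (i j : 'I_3) := Ck_plane (Ck_field_partial i T_gt0 oO (vk j)).
rewrite /Ck_field /curl; under eq_fun do rewrite col3E.
by apply: (Ck_sub oC CM); [exact: (d 0 1)|exact: (d 1 0)].
Qed.

Let ako j := interior_field (ak j).
Let F0ko := interior_field F0k.
Let F1ko := interior_field F1k.
Let Qko := interior_field Qk.

Section at_time.
Variable t : R.
Hypothesis tT : time_oo T t.

Lemma velocity_ext_plane x : Omega x -> v t x = ext h (a t) x.
Proof.
have [hv _] := helical tT; move=> Ox.
rewrite -[in LHS](helix_foot h0 x) hv //.
exact: (helical_domainE h_gt0 helO x).1.
Qed.

Let press y := P t (point y 0).

Lemma pressure_plane x : Omega x -> P t x = press (foot h x).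
Proof.
have [_ hP] := helical tT; move=> Ox.
rewrite -[in LHS](helix_foot h0 x) hP //.
exact: (helical_domainE h_gt0 helO x).1.
Qed.

Lemma differentiable_pressure y : D y -> differentiable press y.
Proof.
move=> Dy; have [[_ Pk] _ _ _ _] := euler.
have Ptk : Ck_upto 1 Omega Omega Omega (P t) := Pk t tT.
have [S0 S1 S2] := @Sm_point R 0.
have pk : Ck_upto 1 D D D press.
  apply: (@Ck_comp R 1 _ _ _ _ _ (P t) (fun y => point y 0) D D D Omega Omega Omega
    (cv_frame R 2)) => //.
  exact: (@space_coords R _ (fun y => point y 0) (fun f => Sm f)).
exact: (Ck_differentiable (cv_frame R 1) oD (@subset_refl _ D) pk Dy).
Qed.

Let point_foot y : foot h (point y 0) = y. Proof. exact: foot_point. Qed.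
Let no_turn y : point y 0 2 0 / h = 0. Proof. by rewrite pointE mul0r. Qed.

Let da y : D y -> forall j, differentiable (fun z => a t z j 0) (foot h (point y 0)).
Proof. by move=> Dy j; rewrite point_foot; exact: (field_differentiable oD (ako j) tT Dy). Qed.

Lemma plane_euler y : D y -> forall j, dt (fun s z => a s z j 0) t y +
  plane_adv h (a t) (a t) y j 0 =
  - col3 (partial 0 press y) (partial 1 press y) (turn y press / h) j 0.
Proof.
move=> Dy j; have [_ E _ _ _] := euler.
have Ej := congr1 (fun u : 'cV[R]_3 => u j 0) (E t (point y 0) tT Dy).
have addE (A B : 'cV[R]_3) : (A + B) j 0 = A j 0 + B j 0 by rewrite mxE.
have oppE (A : 'cV[R]_3) : (- A) j 0 = - A j 0 by rewrite mxE.
rewrite /= addE oppE in Ej.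
have G : grad (P t) (point y 0) = grad (fun x => press (foot h x)) (point y 0).
  apply/matrixP => i k; rewrite !mxE.
  by apply: (partial_eq oO i (y := point y 0) Dy) => x Ox; exact: pressure_plane.
have A : adv (v t) (v t) (point y 0) = adv (ext h (a t)) (ext h (a t)) (point y 0).
  rewrite /adv; apply: eq_bigr => i _; rewrite -(velocity_ext_plane (x := point y 0) Dy); congr (_ *: _).
  by apply: (partial_eq oO i (y := point y 0) Dy) => x Ox; exact: velocity_ext_plane.
rewrite G A adv_ext ?grad_foot ?no_turn ?rot3_0 ?point_foot in Ej.
- rewrite -Ej; congr (_ + _); rewrite /dt !derive1E derive_mx ?mxE //.
  apply/derivable_mxP => i k; rewrite ord1.
  by have [] := field_derivable_dt (ako i) tT Dy.
- exact: differentiable_pressure.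
- by move=> k; exact: (field_differentiable oD (ako k) tT Dy).
Qed.

Let d0 y (Dy : D y) := field_differentiable oD F0ko tT Dy.
Let d1 y (Dy : D y) := field_differentiable oD F1ko tT Dy.
Let dQ y (Dy : D y) := field_differentiable oD Qko tT Dy.

Lemma closed_flow y : D y -> partial 1 (F0 t) y = partial 0 (F1 t) y.
Proof.
move=> Dy; have [_ _ E _ _] := euler; have := E t (point y 0) tT Dy.
have -> : div (v t) (point y 0) = div (ext h (a t)) (point y 0).
  rewrite /div; apply: eq_bigr => i _.
  by apply: (partial_eq oO i (y := point y 0) Dy) => x Ox; rewrite velocity_ext_plane.
rewrite (div_ext (da Dy)) point_foot /turn -(aE t).
have [-> _ A2] := partial_stream_field h (d0 Dy) (d1 Dy) (dQ Dy) 0.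
have [_ -> B2] := partial_stream_field h (d0 Dy) (d1 Dy) (dQ Dy) 1.
rewrite A2 B2 /= {A2 B2}; atoms => E'.
by apply/eqP; rewrite eq_sym -subr_eq0 -[X in _ == X]E'; apply/eqP; field.
Qed.

Lemma curl_at_plane y : D y -> curl (v t) (point y 0) 2 0 =
  partial 0 (fun z => a t z 1 0) y - partial 1 (fun z => a t z 0 0) y.
Proof.
move=> Dy; have -> : curl (v t) (point y 0) 2 0 = curl (ext h (a t)) (point y 0) 2 0.
  rewrite /curl !col3E; congr (_ - _).
    by apply: (partial_eq oO 0 (y := point y 0) Dy) => x Ox; rewrite velocity_ext_plane.
  by apply: (partial_eq oO 1 (y := point y 0) Dy) => x Ox; rewrite velocity_ext_plane.
by rewrite (curl_ext (da Dy)) rot3E point_foot /plane_curl col3E.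
Qed.

Lemma vorticity_at_plane y : D y ->
  curl (v t) (point y 0) 2 0 = stream_vorticity (F0 t) (F1 t) (Q t) y.
Proof.
move=> Dy; rewrite curl_at_plane // -(aE t).
have [_ -> _] := partial_stream_field h (d0 Dy) (d1 Dy) (dQ Dy) 0.
have [-> _ _] := partial_stream_field h (d0 Dy) (d1 Dy) (dQ Dy) 1.
by rewrite ?eqxx /= /stream_vorticity /radial; atoms; ring.
Qed.

(** The velocity is tangent and xi is tangent, so the horizontal flow is
    tangent to the boundary of the cross-section. *)
Lemma boundary_flow p rho (G0 G1 : R) : frontier D p -> defining_function D p rho ->
  F0 t y @[y --> within D (nbhs p)] --> G0 -> F1 t y @[y --> within D (nbhs p)] --> G1 ->
  G0 * partial 1 rho p - G1 * partial 0 rho p = 0.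
Proof.
move=> Fp [U [oU Up rk gn DU]] l0 l1.
have idn (k u0 u1 x0 x1 s r0 r1 : R) : k * (u1 * r0 - u0 * r1) =
    (u1 + x1 * s) * (k * r0) + (- u0 - x0 * s) * (k * r1) +
    (h * s) * (k * ((x0 * r1 - x1 * r0) / h)) by field.
have [cp _] := (frontierE _ oD).1 Fp.
have [q lq] := Ck_limit (Ck_slice oD Qko tT) cp.
pose rho' x := rho (foot h x); pose x0 : 'cV[R]_3 := point p 0.
have x0p : foot h x0 = p by exact: foot_point.
have rk1 : Ck_upto 1 U U U rho by exact: (rk 1%N).
have dr : differentiable rho (foot h x0).
  by rewrite x0p; exact: (Ck_differentiable (cv_frame R 1) oU (@subset_refl _ _) rk1 Up).
have gE : grad rho' x0 = col3 (partial 0 rho p) (partial 1 rho p) (turn p rho / h).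
  by rewrite (grad_foot dr) no_turn rot3_0 x0p.
pose g := grad rho' x0.
have g0 : grad rho' x0 != 0.
  apply/eqP => gz; move/eqP: gn; apply.
  have z0 := congr1 (fun u : 'cV[R]_3 => u 0 0) gz.
  have z1 := congr1 (fun u : 'cV[R]_3 => u 1 0) gz.
  rewrite /= gE !col3E !mxE in z0 z1.
  by apply: cv2P; rewrite !mxE.
have dg : 0 < dot g g.
  rewrite dot3E -!expr2 lt_neqAle !addr_ge0 ?sqr_ge0 // andbT eq_sym.
  apply/eqP => /eqP; rewrite !paddr_eq0 ?addr_ge0 ?sqr_ge0 // !sqrf_eq0.
  move=> /andP[/andP[/eqP e0 /eqP e1] /eqP e2].
  by move/eqP: g0; apply; apply: cv3P; rewrite ?e0 ?e1 ?e2 mxE.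
have n0 : enorm g != 0 by rewrite /enorm sqrtr_eq0 -ltNge.
have def : defining_function Omega x0 rho'.
  exists (foot h @^-1` U); split.
  - by apply: open_comp => // x _; exact: foot_continuous.
  - by rewrite /= x0p.
  - move=> k; have rkk : Ck_upto k U U U rho by exact: (rk k).
    have [S0 S1] := @Sm_foot R h.
    have oF : open (foot h @^-1` U) by apply: open_comp => // x _; exact: foot_continuous.
    apply: (@Ck_comp R k _ _ _ _ _ rho (foot h) _ _ _ U U U (cv_frame R 1) oF oU) => //.
    exact: (@plane_coords R _ (foot h) (fun f => Sm f)).
  - exact: g0.
  - move=> x Ux; rewrite -(DU _ Ux); exact: (helical_domainE h_gt0 helO x).
have [_ _ _ tang _] := euler.
have L := tang t tT x0 _ (frontier_point oO Fp) (ex_intro2 _ _ rho' def erefl).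
set l := (enorm _)^-1 in L.
have l_neq0 : l != 0 by rewrite invr_eq0.
have L0 : (fun y => dot (a t y) (l *: g)) y @[y --> within D (nbhs p)] --> (0 : R).
  by apply: cvg_trans L => N /point_near.
have L1 : (fun y => dot (a t y) (l *: g)) y @[y --> within D (nbhs p)] -->
    l * (G1 * partial 0 rho p - G0 * partial 1 rho p).
  have smooth (f : 'cV[R]_2 -> R) : Sm f -> f y @[y --> within D (nbhs p)] --> (f p : R).
    move=> fS N /(@Sm_continuous R _ f fS p) nN.
    have {}nN : \forall z \near p, N (f z) by [].
    have : \forall z \near p, D z -> N (f z) by apply: filterS nN.
    by [].
  have c0 := smooth _ (Sm_coord R 0); have c1 := smooth _ (Sm_coord R 1).
  rewrite (_ : (fun y => dot _ _) = fun y : 'cV[R]_2 =>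
    (F1 t y + y 1 0 * Q t y) * (l * partial 0 rho p) +
    (- F0 t y - y 0 0 * Q t y) * (l * partial 1 rho p) +
    (h * Q t y) * (l * (turn p rho / h))); last first.
    apply/funext => y; rewrite -(aE t) dot3E /stream_field !col3E.
    have E i : (l *: g) i 0 = l * g i 0 by rewrite mxE.
    by rewrite !E /g gE !col3E.
  rewrite (_ : l * (G1 * partial 0 rho p - G0 * partial 1 rho p) = (G1 + p 1 0 * q) * (l * partial 0 rho p) +
    (- G0 - p 0 0 * q) * (l * partial 1 rho p) + (h * q) * (l * (turn p rho / h))).
    apply: cvgD; [apply: cvgD|]; apply: cvgM; try exact: cvg_cst.
    - by apply: cvgD => //; apply: cvgM.
    - by apply: cvgB; [exact: cvgN|apply: cvgM].
    - by apply: cvgM => //; exact: cvg_cst.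
  exact: idn.
have Z : 0 = l * (G1 * partial 0 rho p - G0 * partial 1 rho p).
  exact: (@trace_unique R D (fun y => dot (a t y) (l *: g)) p _ _ cp L0 L1).
have X : G1 * partial 0 rho p - G0 * partial 1 rho p = 0.
  by apply: (mulfI l_neq0); rewrite -Z mulr0.
by rewrite -opprB X oppr0.
Qed.

Lemma slice1 (F : R -> 'cV[R]_2 -> R) : Ck_field 2 T (time_oo T) D F -> Ck_upto 1 D D D (F t).
Proof.
by move=> Fk; apply: (Ck_mono _ _ _ (Ck_pred (Ck_slice oD Fk tT))) => //; exact: subset_closure.
Qed.

(** The potential of (F0 t, F1 t) has a gradient normal to the boundary, so its
    boundary values are all equal, and they are subtracted. *)
Lemma stream_function : exists f : 'cV[R]_2 -> R,
  (forall y, D y -> is_derive y (e0 R) f (F0 t y) /\ is_derive y (e1 R) f (F1 t y)) /\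
  vanishes_on_boundary D f.
Proof.
have [f df] := poincare oD scD (slice1 F0ko) (slice1 F1ko) closed_flow.
have cF (F : R -> 'cV[R]_2 -> R) z : Ck_field 2 T (time_oo T) D F -> D z ->
    {for z, continuous (F t)}.
  by move=> Fk Dz; exact: (Ck_continuous oD (@subset_refl _ _) (@subset_refl _ _) (slice1 Fk) Dz).
have cont z : D z -> {for z, continuous (F0 t)} /\ {for z, continuous (F1 t)}.
  by move=> Dz; split; exact: cF.
have /choice[cb cbP] : forall p, exists c : R, frontier D p -> trace D f p c /\
    forall eps, 0 < eps -> \forall q \near p, frontier D q ->
      forall cq, trace D f q cq -> `|cq - c| <= eps * `|q - p|.
  move=> p; have [Fp|] := pselect (frontier D p); last by exists 0.
  have [cp _] := (frontierE _ oD).1 Fp.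
  have [rho def] := smoothD Fp.
  have [U [oU Up rk DU rn]] := defining_chart def.
  have [G0 l0] := Ck_limit (Ck_slice oD F0ko tT) cp.
  have [G1 l1] := Ck_limit (Ck_slice oD F1ko tT) cp.
  have Z := boundary_flow Fp def l0 l1.
  have [c E] := boundary_expansion oD Fp oU Up rk DU rn df cont l0 l1.
  exists c => _; split; first exact: (expansion_trace E).
  by move=> eps eps0; exact: (boundary_values_flat oD Fp oU Up rk DU rn E Z eps0).
have tr q : frontier D q -> trace D f q (cb q) by move=> /cbP[].
have flat q : frontier D q -> forall eps, 0 < eps ->
    \forall q' \near q, frontier D q' -> `|cb q' - cb q| <= eps * `|q' - q|.
  move=> Fq eps eps0; have [_ H] := cbP q Fq.
  by apply: filterS (H eps eps0) => q' H' Fq'; apply: H' => //; exact: tr.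
have loc p : frontier D p -> \forall q \near p, frontier D q -> cb q = cb p.
  move=> Fp; have [rho def] := smoothD Fp.
  have [U [oU Up rk DU rn]] := defining_chart def.
  exact: (boundary_values_locally_constant oD Fp oU Up rk DU rn flat).
have cf x : D x -> {for x, continuous f}.
  move=> Dx; apply: differentiable_continuous.
  have nD : nbhs x D by exact: open_nbhs_nbhs.
  apply: (@plane_differentiable R f x (F0 t) (F1 t)).
  - by apply: filterS nD => y /df.
  - exact: (cont x Dx).1.
  - exact: (cont x Dx).2.
have [c Hc] := boundary_values_constant oD domD bndD scD cf tr loc.
exists (fun y => f y - c); split=> [y Dy|p Fp].
  have [f0 f1] := df y Dy; rewrite -[F0 t y]subr0 -[F1 t y]subr0.
  by split; apply: dB => //; exact: dcst.
by rewrite -(subrr c); apply: cvgB; [exact: (Hc p Fp)|exact: cvg_cst].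
Qed.

End at_time.

Section equations.
Variables (t : R) (f : 'cV[R]_2 -> R) (y : 'cV[R]_2).
Hypothesis tT : time_oo T t.
Hypothesis df : forall z, D z ->
  is_derive z (e0 R) f (F0 t z) /\ is_derive z (e1 R) f (F1 t z).
Hypothesis Dy : D y.

Let press z := P t (point z 0).
Let d0 := field_differentiable oD F0ko tT Dy.
Let d1 := field_differentiable oD F1ko tT Dy.
Let dQ := field_differentiable oD Qko tT Dy.

Let sw s z := swirl h (v s) (point z 0).
Let vo s z := curl (v s) (point z 0) 2 0.

Let f0 z : D z -> partial 0 f z = F0 t z. Proof. by move=> /df[[_ <-]]. Qed.
Let f1 z : D z -> partial 1 f z = F1 t z. Proof. by move=> /df[_ [_ <-]]. Qed.

Let swS : sw t = stream_swirl h (F0 t) (F1 t) (Q t). Proof. exact: swE. Qed.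

Let near_D : nbhs y D. Proof. exact: open_nbhs_nbhs. Qed.

Lemma stream_equation : LK h f y =
  vo t y + 2 * h ^+ 2 * sw t y / xi2 h y ^+ 2 + radial (sw t) y / xi2 h y.
Proof.
rewrite /vo (vorticity_at_plane tT Dy) swS.
apply: (LK_stream h_gt0 d0 d1 dQ); first by rewrite (closed_flow tT Dy).
by apply: filterS near_D => z Dz; rewrite f0 // f1.
Qed.

Let transport (g : 'cV[R]_2 -> R) : dot (perp (grad f y)) (grad g y) =
  F1 t y * partial 0 g y - F0 t y * partial 1 g y.
Proof.
have gradE (k : 'cV[R]_2 -> R) z i : grad k z i 0 = partial i k z by rewrite mxE.
by rewrite dot2E /perp col2E0 col2E1 !gradE f0 // f1 // mulNr.
Qed.

Lemma swirl_equation : dt sw t y + dot (perp (grad f y)) (grad (sw t) y) = 0.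
Proof.
have E := plane_euler tT Dy.
pose b j := dt (fun s z => a s z j 0) t y.
have db j : is_derive t 1 (fun s => a s y j 0) (b j).
  exact: (field_derivable_dt (ako j) tT Dy).
have -> : dt sw t y = y 1 0 * b 0 - y 0 0 * b 1 + h * b 2.
  rewrite /dt derive1E; have b0 := db 0; have b1 := db 1; have b2 := db 2.
  suff [_ ->] : is_derive t 1 (sw^~ y) (y 1 0 * b 0 - y 0 0 * b 1 + h * b 2) by [].
  rewrite /sw /swirl; under eq_fun do rewrite dot3E !xiE !horE !pointE.
  by apply: is_derive_eq; dtac; rewrite /= ?scaleE; ring.
rewrite transport swS.
apply: (swirl_transport h_gt0 d0 d1 dQ (p0 := partial 0 press y)
  (p1 := partial 1 press y)); rewrite aE (E _) col3E //.
Qed.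

(** Minus the derivatives of the pressure, read from the Euler equations. *)
Let A0 z := dt (fun s u => a s u 0 0) t z + (F1 t z * partial 0 (fun u => a t u 0 0) z -
  F0 t z * partial 1 (fun u => a t u 0 0) z) + Q t z * a t z 1 0.
Let A1 z := dt (fun s u => a s u 1 0) t z + (F1 t z * partial 0 (fun u => a t u 1 0) z -
  F0 t z * partial 1 (fun u => a t u 1 0) z) + - Q t z * a t z 0 0.

Let AE : forall z, D z ->
  is_derive z (delta_mx 0 0) press (- A0 z) /\ is_derive z (delta_mx 1 0) press (- A1 z).
Proof.
move=> z Dz; have E := plane_euler tT Dz.
have fl : flow_comp h (a t) z = col2 (F1 t z) (- F0 t z).
  by rewrite -(aE t); exact: flow_stream_field.
have := E 0; have := E 1; rewrite !(plane_adv_val fl erefl erefl erefl erefl erefl erefl) !col3E.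
rewrite !(mulNr (F0 t z)) => E1 E0.
have e0 : partial 0 press z = - A0 z by rewrite -[LHS]opprK -E0 /A0 addrA.
have e1 : partial 1 press z = - A1 z by rewrite -[LHS]opprK -E1 /A1 (mulNr (Q t z)) addrA.
have dp := differentiable_pressure tT Dz.
by split; [rewrite -e0|rewrite -e1]; exact: is_derive_partial.
Qed.

Let dtk j : Ck_upto 1 D D D (dt (fun s u => a s u j 0) t).
Proof.
have H := field_dt oD (ako j).
by apply: (Ck_mono _ _ _ (Ck_slice oD H tT)) => //; exact: subset_closure.
Qed.

Let pak i j : Ck_upto 1 D D D (partial i (fun u => a t u j 0)).
Proof.
have H := field_partial oD i (ako j).
by apply: (Ck_mono _ _ _ (Ck_slice oD H tT)) => //; exact: subset_closure.
Qed.

Let compat : partial 1 A0 y = partial 0 A1 y.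
Proof.
have sD : D `<=` D by exact: subset_refl.
have trk j : Ck_upto 1 D D D (fun z => dt (fun s u => a s u j 0) t z +
    (F1 t z * partial 0 (fun u => a t u j 0) z - F0 t z * partial 1 (fun u => a t u j 0) z)).
  apply: (Ck_add oD sD); first exact: dtk.
  by apply: (Ck_sub oD sD); apply: (Ck_mul oD sD);
    [exact: (slice1 tT F1ko)|exact: pak|exact: (slice1 tT F0ko)|exact: pak].
have A0k : Ck_upto 1 D D D A0.
  apply: (Ck_add oD sD); first exact: (trk 0).
  by apply: (Ck_mul oD sD); [exact: (slice1 tT Qko)|exact: (slice1 tT (ako 1))].
have A1k : Ck_upto 1 D D D A1.
  apply: (Ck_add oD sD); first exact: (trk 1).
  by apply: (Ck_mul oD sD); [apply: (Ck_opp oD sD); exact: (slice1 tT Qko)|exact: (slice1 tT (ako 0))].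
have dN0 : is_derive y (delta_mx 1 0) (fun z => - A0 z) (- partial 1 A0 y).
  by apply: dN; apply: DeriveDef; [exact: (@Ck_derivable R 0 _ R D D D A0 y _ A0k Dy)|exact: erefl].
have dN1 : is_derive y (delta_mx 0 0) (fun z => - A1 z) (- partial 0 A1 y).
  by apply: dN; apply: DeriveDef; [exact: (@Ck_derivable R 0 _ R D D D A1 y _ A1k Dy)|exact: erefl].
have := mixed_partials oD sD (Ck_opp oD sD A0k) (Ck_opp oD sD A1k) AE Dy.
by rewrite (partial_val dN0) (partial_val dN1) => /oppr_inj.
Qed.

(** The plane curl of the horizontal Euler equations: compat eliminates the
    pressure, and the remaining terms are rewritten through F0, F1 and Q. *)
Lemma vorticity_equation : dt vo t y + dot (perp (grad f y)) (grad (vo t) y) =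
  partial 0 (sw t) y * partial 1 (fun z => radial f z / xi2 h z) y
  - partial 1 (sw t) y * partial 0 (fun z => radial f z / xi2 h z) y
  + 2 * sw t y * (y 1 0 * partial 0 (sw t) y - y 0 0 * partial 1 (sw t) y) / xi2 h y ^+ 2.
Proof.
have re i : partial i (fun z => radial f z / xi2 h z) y =
    partial i (fun z => (z 0 0 * F0 t z + z 1 0 * F1 t z) / xi2 h z) y.
  by apply: (partial_eq oD i Dy) => z Dz; rewrite /radial f0 // f1.
rewrite !re swS (stretching_term h_gt0 d0 d1 dQ) transport.
have S0 := partial_stream_swirl h d0 d1 dQ 0; have S1 := partial_stream_swirl h d0 d1 dQ 1.
have [P0 P1 _] := partial_stream_field h d0 d1 dQ 0.
have [R0 R1 _] := partial_stream_field h d0 d1 dQ 1.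
rewrite aE !eqxx /= in S0 S1 P0 P1 R0 R1.
pose pa i j z := partial i (fun u => a t u j 0) z.
have dpa i j k : is_derive y (delta_mx k 0) (pa i j) (partial k (pa i j) y).
  by apply: DeriveDef; [exact: (@Ck_derivable R 0 _ R D D D (pa i j) y _ (pak i j) Dy)|exact: erefl].
have vo_i k : partial k (vo t) y = partial k (pa 0 1) y - partial k (pa 1 0) y.
  rewrite (partial_eq oD k Dy (fun z Dz => curl_at_plane tT Dz)).
  exact: (partial_val (dB (dpa 0 1 k) (dpa 1 0 k))).
have vo_t : dt vo t y = partial 0 (dt (fun s u => a s u 1 0) t) y -
    partial 1 (dt (fun s u => a s u 0 0) t) y.
  rewrite -(dt_partial oD 0 (ako 1) tT Dy) -(dt_partial oD 1 (ako 0) tT Dy).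
  pose g s z := partial 0 (fun u => a s u 1 0) z - partial 1 (fun u => a s u 0 0) z.
  have -> : dt vo t y = dt g t y.
    exact: (field_near_dt (f := vo) (g := g) tT (fun s sT => curl_at_plane sT Dy)).
  rewrite {1}/dt derive1E.
  exact: (@derive_val _ _ _ _ _ _ _ (dB (field_derivable_dt (field_partial oD 0 (ako 1)) tT Dy)
    (field_derivable_dt (field_partial oD 1 (ako 0)) tT Dy))).
have ddt i k : is_derive y (delta_mx k 0) (dt (fun s u => a s u i 0) t)
    (partial k (dt (fun s u => a s u i 0) t) y).
  by apply: DeriveDef; [exact: (@Ck_derivable R 0 _ R D D D _ y _ (dtk i) Dy)|exact: erefl].
have da i k := is_derive_partial k (field_differentiable oD (ako i) tT Dy).
have dp0 k := is_derive_partial k d0; have dp1 k := is_derive_partial k d1.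
have dpQ k := is_derive_partial k dQ.
have C0 := partial_val (is_derive_transport (ddt 0 1) (dp1 1) (dpa 0 0 1) (dp0 1)
  (dpa 1 0 1) (dpQ 1) (da 1 1)).
have C1 := partial_val (is_derive_transport (ddt 1 0) (dp1 0) (dpa 0 1 0) (dp0 0)
  (dpa 1 1 0) (dN (dpQ 0)) (da 0 0)).
have := compat; rewrite C0 C1 vo_t !vo_i S0 S1.
have -> : partial 0 (pa 1 0) y = partial 1 (pa 0 0) y.
  exact: (partial_sym oD 0 1 (ako 0) tT Dy).
have -> : partial 1 (pa 0 1) y = partial 0 (pa 1 1) y.
  exact: (partial_sym oD 1 0 (ako 1) tT Dy).
rewrite /pa P0 P1 R0 R1 (closed_flow tT Dy).
have -> : a t y 1 0 = - F0 t y - y 0 0 * Q t y by rewrite -(aE t) col3E.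
have -> : a t y 0 0 = F1 t y + y 1 0 * Q t y by rewrite -(aE t) col3E.
rewrite /xi2; move: (partial 0 (dt _ t) y) (partial 1 (dt _ t) y) => X1 X0.
move: (F0 t y) (F1 t y) (Q t y) => u0 u1 q; atoms.
by move=> /(canRL (addrK _))/(canRL (addrK _)) ->; ring.
Qed.

End equations.

(** The stream function is chosen at each time separately; the regularity in
    time is that of its spatial derivatives F0 and F1. *)
Theorem planar_solution_of_euler : exists phi : R -> 'cV[R]_2 -> R,
  planar_solution T h D (fun y => swirl h v0 (point y 0))
    (fun y => curl v0 (point y 0) 2 0) phi
    (fun t y => swirl h (v t) (point y 0)) (fun t y => curl (v t) (point y 0) 2 0).
Proof.
have /choice[phi phiP] : forall t, exists f : 'cV[R]_2 -> R, time_oo T t ->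
    (forall y, D y -> is_derive y (e0 R) f (F0 t y) /\ is_derive y (e1 R) f (F1 t y)) /\
    vanishes_on_boundary D f.
  move=> t; have [tT|] := pselect (time_oo T t); last by exists (fun _ => 0).
  by have [f Hf] := stream_function tT; exists f.
exists phi; split.
- split; [exact: swk|exact: wk|].
  have P0 t y : time_oo T t -> D y -> is_derive y (e0 R) (phi t) (F0 t y).
    by move=> /phiP[df _] /df[].
  have P1 t y : time_oo T t -> D y -> is_derive y (e1 R) (phi t) (F1 t y).
    by move=> /phiP[df _] /df[].
  have reg (i : 'I_2) (F : R -> 'cV[R]_2 -> R) : Ck_field 2 T (time_oo T) D F ->
      (forall t y, time_oo T t -> D y -> is_derive y (delta_mx i 0) (phi t) (F t y)) ->
      (forall t y, time_oo T t -> D y -> derivable (phi t) y (delta_mx i 0)) /\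
      Ck_field 2 T (time_oo T) D (fun t => partial i (phi t)).
    move=> Fk dF; split=> [t y tT Dy|]; first by have [] := dF t y tT Dy.
    have E (z : R * 'cV[R]_2) : C z -> F z.1 z.2 = partial i (phi z.1) z.2.
      by case: z => t y [tT Dy]; have [_ <-] := dF t y tT Dy.
    exact: (Ck_eq oC (@subset_refl _ C) E Fk).
  by apply: ord2_ind; [exact: reg F0ko P0|exact: reg F1ko P1].
- move=> t y tT Dy; have [df _] := phiP t tT; split.
  + exact: swirl_equation.
  + exact: vorticity_equation.
  + exact: stream_equation.
- by move=> t tT; have [_] := phiP t tT.
- move=> y Dy; have [_ _ _ _ E] := euler; split.
    by rewrite /swirl E.
  rewrite /curl !col3E; congr (_ - _).
    by apply: (partial_eq oO 0 (y := point y 0) Dy) => x Ox; rewrite E.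
  by apply: (partial_eq oO 1 (y := point y 0) Dy) => x Ox; rewrite E.
Qed.

End space_to_plane.

Theorem theorem1p1 (R : realType) (h : R) (T : \bar R) (Omega : set 'cV[R]_3)
  (h_gt0 : 0 < h) (T_gt0 : (0 < T)%E)
  (domOmega : domain Omega) (helOmega : helical_set h Omega)
  (domD : domain (cross_section Omega))
  (bndD : bounded_set (cross_section Omega))
  (scD : simply_connected R (cross_section Omega))
  (smoothD : smooth_boundary (cross_section Omega)) :
  (forall (v0 : 'cV[R]_3 -> 'cV[R]_3) (v : R -> 'cV[R]_3 -> 'cV[R]_3)
          (P : R -> 'cV[R]_3 -> R),
     euler_solution T Omega v0 v P ->
     (forall t, time_oo T t ->
        helical_field h Omega (v t) /\ helical_function h Omega (P t)) ->
     exists phi : R -> 'cV[R]_2 -> R,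
       planar_solution T h (cross_section Omega)
         (fun y => swirl h v0 (point y 0))
         (fun y => curl v0 (point y 0) 2 0)
         phi
         (fun t y => swirl h (v t) (point y 0))
         (fun t y => curl (v t) (point y 0) 2 0))
  /\
  (forall (v0 w0 : 'cV[R]_2 -> R) (phi v w : R -> 'cV[R]_2 -> R),
     planar_solution T h (cross_section Omega) v0 w0 phi v w ->
     vorticity_solution T Omega
       (fun t => helical_velocity h (phi t) (v t))
       (fun t => helical_vorticity h (v t) (w t)) /\
     (forall t, time_oo T t ->
        helical_field h Omega (helical_velocity h (phi t) (v t)) /\
        helical_field h Omega (helical_vorticity h (v t) (w t)))).

Proof.
have [_ oO _] := domOmega; split.
- move=> v0 v P euler helical.
  exact: (planar_solution_of_euler h_gt0 T_gt0 oO helOmega domD bndD scD smoothD euler helical).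
- move=> v0 w0 phi v w sol; split.
    exact: (vorticity_solution_of_planar h_gt0 oO helOmega sol).
  by move=> t tT; exact: (reconstruction_helical h_gt0 oO helOmega sol tT).
Qed.
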